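(* For $f,g\in\mathcal{SF}(\mathbb{C})$ with $\frac{\partial}{\partial z}f\in\mathcal{SF}(\mathbb{C})$ and $M_zg\in\mathcal{SF}(\mathbb{C})$, $$\Big\langle \frac{\partial}{\partial z}f,g\Big\rangle_{\mathcal{SF}(\mathbb{C})}=\langle f,M_{z}g\rangle_{\mathcal{SF}(\mathbb{C})};$$ moreover, for $f,g\in\mathcal{SF}(\mathbb{C})$ with $\frac{\partial}{\partial \overline{z}}f\in\mathcal{SF}(\mathbb{C})$ and $M_{\overline z}g\in\mathcal{SF}(\mathbb{C})$, $$\Big\langle \frac{\partial}{\partial \overline{z}}f,g\Big\rangle_{\mathcal{SF}(\mathbb{C})}=\langle f,M_{\overline{z}}g\rangle_{\mathcal{SF}(\mathbb{C})}.$$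
   Context: $\mathcal{F}(\mathbb{C})$ is the classical Fock space of entire functions $h$ with $\|h\|^2_{\mathcal F(\mathbb C)}=\frac1\pi\int_{\mathbb C}|h(z)|^2e^{-|z|^2}dA(z)<\infty$. The polyanalytic Fock space of infinite order $\mathcal{SF}(\mathbb{C})$ is the set of functions of the form $f(z)=\sum_{n=0}^{\infty}\overline{z}^nf_n(z)$ with $f_n\in\mathcal{F}(\mathbb{C})$ for all $n\ge0$ and $\|f\|^2_{\mathcal{SF}(\mathbb{C})}=\sum_{n=0}^{\infty}n!\,\|f_n\|^2_{\mathcal{F}(\mathbb{C})}<\infty$, with scalar product $\langle f,g\rangle_{\mathcal{SF}(\mathbb{C})}=\sum_{k=0}^{\infty}k!\,\langle f_k,g_k\rangle_{\mathcal{F}(\mathbb{C})}$ for $f=\sum_k\overline z^kf_k$, $g=\sum_k\overline z^kg_k$. $M_z$ and $M_{\overline z}$ denote multiplication by $z$ and $\overline z$; $\frac{\partial}{\partial z},\frac{\partial}{\partial\overline z}$ are the Wirtinger derivatives. *)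

(* Defs.v *)
From mathcomp Require Import all_boot all_order all_algebra.
From mathcomp Require Import all_classical all_reals all_analysis.
From mathcomp Require Import complex.
Set Implicit Arguments.
Unset Strict Implicit.
Unset Printing Implicit Defensive.
Import Order.TTheory GRing.Theory Num.Theory.
Import numFieldNormedType.Exports.
Local Open Scope classical_set_scope.
Local Open Scope ring_scope.
Local Open Scope complex_scope.

Section Fock.
Variable R : realType.
Local Notation C := R[i].
Implicit Types (f g h k : C -> C) (c d : nat -> C -> C) (z : C) (p : R * R).

Definition complex_of_pair p : C := p.1 +i* p.2.

(* Lebesgue area measure dA on the plane, C being identified with R * R. *)
Definition area :
    {measure set (measurableTypeR R * measurableTypeR R)%type -> \bar R} :=
  (@lebesgue_measure R \x @lebesgue_measure R)%E.

Definition gauss_weight p : R := expR (- (p.1 ^+ 2 + p.2 ^+ 2)).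

(* [C^o] is C as a normed space over itself, so [derivable] in the direction 1
   is complex differentiability. *)
Definition entire h : Prop :=
  forall z, derivable (h : C^o -> C^o) (z : C^o) (1 : C^o).

Definition fock_norm2 h : \bar R :=
  ((pi^-1)%:E * \int[area]_p
    (ComplexField.Normc.normc (h (complex_of_pair p)) ^+ 2
       * gauss_weight p)%:E)%E.

Definition fock h : Prop := entire h /\ (fock_norm2 h < +oo)%E.

(* The complex integral (1/pi) \int h * conj k * exp (-|z|^2) dA, taken through
   its real and imaginary parts. *)
Definition fock_dot h k : C :=
  let F p := h (complex_of_pair p) * (k (complex_of_pair p))^* in
  (pi^-1 * \int[area]_p (complex.Re (F p) * gauss_weight p))
  +i* (pi^-1 * \int[area]_p (complex.Im (F p) * gauss_weight p)).

Definition sfock_expansion f c : Prop :=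
  [/\ forall n, fock (c n),
      forall z, series (fun n => z^* ^+ n * c n z : C^o) @ \oo --> (f z : C^o)
    & (\sum_(0 <= n <oo) (n`!%:R)%:E * fock_norm2 (c n) < +oo)%E].

Definition sfock f : Prop := exists c, sfock_expansion f c.

(* The components f_n are determined by f (expand f as a power series in z and
   its conjugate), so the choice below is immaterial when [sfock f] holds. *)
Definition sfock_coef f : nat -> C -> C :=
  xget (fun _ _ => 0) [set c | sfock_expansion f c].

Definition sfock_dot f g : C :=
  lim (series (fun n => n`!%:R * fock_dot (sfock_coef f n) (sfock_coef g n)
                        : C^o) @ \oo).

(* Partial derivatives of a complex function along the real and imaginary axes,
   componentwise; elements of the space are smooth, so these are genuine
   derivatives there. *)
Definition partial_x f z : C :=
  derive1 (fun t => complex.Re (f (t +i* complex.Im z))) (complex.Re z)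
  +i* derive1 (fun t => complex.Im (f (t +i* complex.Im z))) (complex.Re z).

Definition partial_y f z : C :=
  derive1 (fun t => complex.Re (f (complex.Re z +i* t))) (complex.Im z)
  +i* derive1 (fun t => complex.Im (f (complex.Re z +i* t))) (complex.Im z).

Definition d_z f z : C := (partial_x f z - 'i * partial_y f z) / 2.
Definition d_zbar f z : C := (partial_x f z + 'i * partial_y f z) / 2.

Definition mul_z g z : C := z * g z.
Definition mul_zbar g z : C := z^* * g z.

End Fock.

(* Main.v *)
Require Import Defs.
From mathcomp Require Import all_boot all_order all_algebra.
From mathcomp Require Import all_classical all_reals all_analysis.
From mathcomp Require Import complex.
From mathcomp Require Import measurable_realfun ring lra.

(* The heart of the matter is that the components of an element of SF(C) are determined by it, so
   that the components of d_z f, z g, d_zbar f and z^* g can be read off termwise.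

   Entire functions are expanded in power series from Goursat's theorem on rectangles.  Choosing
   contours that carry little mass bounds the Taylor coefficients of h by its Fock norm, and with the
   weights n! this makes the coefficients a n m of z^* ^n z^m in f decay faster than any T^-(n+m).
   Hence f may be differentiated termwise in z and z^*, and all derivatives at 0 vanish only if every
   coefficient does, which gives uniqueness.

   The second identity is then a shift of index in the series defining the scalar product.  The first
   one reduces to <u', v> = <u, z v> in the Fock space, which is Green's formula for
   u v^* exp(-|z|^2): the boundary terms are made small by integrating over boxes with well chosen
   sides, so that no decay of the functions is needed beyond integrability. *)

Set Implicit Arguments.
Unset Strict Implicit.
Unset Printing Implicit Defensive.
Import Order.TTheory GRing.Theory Num.Theory.
Import numFieldNormedType.Exports.
Import ComplexField.Normc.
Local Open Scope classical_set_scope.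
Local Open Scope ring_scope.
Local Open Scope complex_scope.

(** * Complex numbers *)

(** The definition of SF(C) supplies little: pointwise convergence of one series in [n] and a bound
    on the weighted norms, while [sfock_coef] is an arbitrary choice of components. Everything
    therefore passes through estimates of coefficients. The Cauchy estimate has to hold with one
    constant for all functions and all orders [m], for each size [T] of the contour, because it is
    applied to every component; the bound [S] on n! times the squared norm then adds a factor
    [sqrt (S / n!)], which beats every geometric sequence. Rapid decay leaves so much room that no
    constant has to be sharp: integrals are estimated by components at the price of a factor 2, and
    polynomial factors are absorbed by enlarging [T]. Since [d_z] and [d_zbar] are built from real
    partial derivatives, termwise differentiation aims at first-order expansions in [z] and its
    conjugate with a quadratic remainder. As for the scalar product, [lim] picks a limit whether or
    not the series converges; the two series are compared as sequences, so that both sides are the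
    same choice. *)

Section ComplexNorm.
Variable R : realType.
Local Notation C := R[i].
Implicit Types z : C.

Lemma normrcE z : `|z| = (normc z)%:C.
Proof. by rewrite normc_def; case: z. Qed.

Lemma normc_ge0 z : 0 <= normc z.
Proof. by case: z => x y; exact: sqrtr_ge0. Qed.

Lemma normc_sqr z : normc z ^+ 2 = complex.Re z ^+ 2 + complex.Im z ^+ 2.
Proof. by case: z => x y /=; rewrite sqr_sqrtr// addr_ge0// sqr_ge0. Qed.

Lemma conjE z : z^*%R = conjc z.
Proof. by []. Qed.

Lemma normc_conj z : normc z^*%R = normc z.
Proof. by rewrite conjE; case: z => x y /=; rewrite sqrrN. Qed.

Lemma normcX z n : normc (z ^+ n) = normc z ^+ n.
Proof.
elim: n => [|n IH]; first by rewrite !expr0 normc1.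
by rewrite !exprS normcM IH.
Qed.

Lemma normc_real (x : R) : normc x%:C = `|x|.
Proof. by rewrite /= expr0n addr0 sqrtr_sqr. Qed.

Lemma normc_nat n : normc (n%:R : C) = n%:R.
Proof. by rewrite -[n%:R](rmorph_nat (@real_complex_def R (Phant R))) normc_real normr_nat. Qed.

Lemma normc_i : normc ('i : C) = 1.
Proof. by rewrite /= expr0n expr1n add0r sqrtr1. Qed.

Lemma ler_Re_normc z : `|complex.Re z| <= normc z.
Proof. by have := normc_ge_Re z; rewrite normrcE lecR. Qed.

Lemma ler_Im_normc z : `|complex.Im z| <= normc z.
Proof.
case: z => x y /=; rewrite -[leLHS]sqrtr_sqr ler_sqrt ?addr_ge0 ?sqr_ge0//.
by rewrite lerDr sqr_ge0.
Qed.

Lemma ler_normc_ReIm z : normc z <= `|complex.Re z| + `|complex.Im z|.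
Proof.
rewrite -(ler_pXn2r (n := 2)) ?nnegrE ?normc_ge0 ?addr_ge0//.
rewrite normc_sqr sqrrD -[in leLHS]real_normK ?num_real// -[complex.Im z ^+ 2]real_normK ?num_real//.
by rewrite lerD2r lerDl mulrn_wge0// mulr_ge0.
Qed.

Lemma ler_normc_sum I (r : seq I) (P : pred I) (F : I -> C) :
  normc (\sum_(i <- r | P i) F i) <= \sum_(i <- r | P i) normc (F i).
Proof.
elim/big_ind2 : _ => //; first by rewrite normc0.
by move=> x1 x2 y1 y2 h1 h2; rewrite (le_trans (le_normcD _ _))// lerD.
Qed.

Lemma normcB x y : normc (x - y : C) = normc (y - x).
Proof. by rewrite -normcN opprB. Qed.

Lemma normc_eq0 z : (normc z == 0) = (z == 0).
Proof. by apply/eqP/eqP => [/eq0_normc|->]; rewrite ?normc0. Qed.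

Lemma normc_gt0 z : (0 < normc z) = (z != 0).
Proof. by rewrite lt0r normc_ge0 andbT normc_eq0. Qed.

End ComplexNorm.

(** * Limits and derivatives in terms of the real-valued norm *)

Section ComplexLimits.
Variable R : realType.
Local Notation C := R[i].

(** As a normed space over itself, [C^o] has a norm with values in [R[i]], and the epsilons of its
    limits range over [R[i]] as well. This equivalence and [nbhs_normcP] carry limits and
    neighbourhoods over to [normc], where the order is total and [lra] applies. *)
Lemma cvgc_normP (T : Type) (F : set_system T) {FF : Filter F} (f : T -> C) (l : C) :
  ((fun x => f x : C^o) @ F --> (l : C^o)) <->
  ((fun x => normc (f x - l)) @ F --> (0 : R)).
Proof.
split.
  move=> /cvgrPdist_lt fl; apply/cvgrPdist_lt => e e0.
  have /fl : (0 : C) < e%:C by rewrite ltcR.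
  apply: filterS => x; rewrite normrcE ltcR sub0r normrN ger0_norm ?normc_ge0//.
  by rewrite normcB.
move=> /cvgrPdist_lt fl; apply/cvgrPdist_lt => e e0.
(* A positive element of [R[i]] is real, so the radius [e] comes from [R]. *)
have eE : e = (complex.Re e)%:C by rewrite RRe_real// gtr0_real.
have {}e0 : 0 < complex.Re e by rewrite -ltcR -eE.
have /fl := e0.
apply: filterS => x; rewrite normrcE eE ltcR sub0r normrN ger0_norm ?normc_ge0//.
by rewrite normcB.
Qed.

Lemma continuous_Re : continuous (fun z : C^o => complex.Re z : R).
Proof.
move=> z; apply/(@cvgrPdist_le _ _ _ _ (nbhs_filter (z : C^o))) => e e0.
have [+ _] := @cvgc_normP _ (nbhs (z : C^o)) (nbhs_filter (z : C^o)) id z.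
move=> /(_ cvg_id)/cvgrPdist_le/(_ e e0).
apply: (@filterS _ _ (nbhs_filter (z : C^o))) => x; rewrite sub0r normrN ger0_norm ?normc_ge0// normcB.
by apply: le_trans; rewrite (le_trans _ (ler_Re_normc _))// raddfB.
Qed.

Lemma continuous_Im : continuous (fun z : C^o => complex.Im z : R).
Proof.
move=> z; apply/(@cvgrPdist_le _ _ _ _ (nbhs_filter (z : C^o))) => e e0.
have [+ _] := @cvgc_normP _ (nbhs (z : C^o)) (nbhs_filter (z : C^o)) id z.
move=> /(_ cvg_id)/cvgrPdist_le/(_ e e0).
apply: (@filterS _ _ (nbhs_filter (z : C^o))) => x; rewrite sub0r normrN ger0_norm ?normc_ge0// normcB.
by apply: le_trans; rewrite (le_trans _ (ler_Im_normc _))// raddfB.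
Qed.

Lemma cvgc_ReIm (T : Type) (F : set_system T) {FF : Filter F} (f g : T -> R) (a b : R) :
  f @ F --> a -> g @ F --> b ->
  (fun x => f x +i* g x : C^o) @ F --> (a +i* b : C^o).
Proof.
move=> fa gb; apply/cvgc_normP.
apply: (squeeze_cvgr (f := cst 0) (h := fun x => `|f x - a| + `|g x - b|)).
- by apply: nearW => x; rewrite normc_ge0 /= (ler_normc_ReIm (_ +i* _)).
- exact: cvg_cst.
- rewrite -[0]addr0; apply: cvgD.
    by rewrite -(@normr0 _ R) -[X in `|X|](subrr a); apply: cvg_norm; apply: cvgB => //; exact: cvg_cst.
  by rewrite -(@normr0 _ R) -[X in `|X|](subrr b); apply: cvg_norm; apply: cvgB => //; exact: cvg_cst.
Qed.

Lemma continuous_complex_of_pair : continuous (fun p : R * R => complex_of_pair p : C^o).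
Proof. by move=> p; apply: (@cvgc_ReIm _ (nbhs p) (nbhs_filter p) fst snd); [exact: cvg_fst|exact: cvg_snd]. Qed.

Lemma continuous_hline (y : R) : continuous (fun t : R => t +i* y : C^o).
Proof. by move=> t; apply: (@cvgc_ReIm _ (nbhs t) (nbhs_filter t) id (cst y)); [exact: cvg_id|exact: cvg_cst]. Qed.

Lemma continuous_vline (x : R) : continuous (fun t : R => x +i* t : C^o).
Proof. by move=> t; apply: (@cvgc_ReIm _ (nbhs t) (nbhs_filter t) (cst x) id); [exact: cvg_cst|exact: cvg_id]. Qed.

Lemma entire_continuous (h : C -> C) : entire h -> continuous (h : C^o -> C^o).
Proof. by move=> hh z; apply: differentiable_continuous; apply/derivable1_diffP; exact: hh. Qed.

End ComplexLimits.

Section NbhsC.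
Variable R : realType.
Local Notation C := R[i].

Lemma nbhs_normcP (z : C) (P : set C) :
  nbhs (z : C^o) P <-> exists2 d : R, 0 < d & forall w, normc (w - z) < d -> P w.
Proof.
have [h1 h2] := @nbhs_normP _ (C^o) z P.
split.
  move=> /h1[e /= e0 eP].
  have eE : e = (complex.Re e)%:C by rewrite RRe_real// gtr0_real.
  exists (complex.Re e); first by rewrite -ltcR -eE.
  by move=> w wz; apply: eP => /=; rewrite eE normrcE ltcR normcB.
move=> [d d0 dP]; apply: h2; exists d%:C => /=; first by rewrite ltcR.
by move=> w /=; rewrite normrcE ltcR normcB => /dP.
Qed.

(** The derivative as a first-order expansion with real bounds on a full disc, [w = z] included, a
    point that the difference quotient excludes. *)
Lemma derivable_normcP (F : C -> C) (z : C) :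
  derivable (F : C^o -> C^o) (z : C^o) (1 : C^o) ->
  exists D : C, forall e : R, 0 < e -> exists2 d : R, 0 < d &
   forall w, normc (w - z) < d -> normc (F w - F z - D * (w - z)) <= e * normc (w - z).
Proof.
move=> /cvg_ex[/= D FD]; exists D => e e0.
have [+ _] := @cvgc_normP _ _ (0^' : set_system C^o) _ (fun h => h^-1 *: ((F \o shift z) (h *: (1 : C^o)) - F z)) D.
move=> /(_ FD)/cvgrPdist_le/(_ e e0)/nbhs_normcP[d d0 dP].
exists d => // w wz.
have [->|wz0] := eqVneq w z; first by rewrite !subrr mulr0 subrr normc0 mulr0.
have wz1 : w - z != 0 by rewrite subr_eq0.
have := dP (w - z); rewrite subr0 => /(_ wz wz1).
rewrite sub0r normrN ger0_norm ?normc_ge0//= /GRing.scale/= mulr1 subrK => h.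
rewrite -[leLHS]mulr1 -(@divff _ (normc (w - z))) ?normc_eq0//.
rewrite mulrCA mulrC ler_wpM2r ?normc_ge0// mulrC -normcV -normcM.
rewrite mulrBr mulrCA mulVf// mulr1.
by [].
Qed.

End NbhsC.

(** * Complex-valued integrals *)

Section ComplexIntegral.
Variables (R : realType) (d : measure_display) (T : measurableType d).
Variable mu : {measure set T -> \bar R}.
Local Notation C := R[i].
Implicit Types (D : set T) (F G : T -> C).

(** Integration by components, the form in which [fock_dot] is defined; complex linearity is
    recovered in [cintD] and [cintZ]. *)
Definition cint D F : C :=
  (\int[mu]_(x in D) complex.Re (F x)) +i* (\int[mu]_(x in D) complex.Im (F x)).

Definition cintegrable D F :=
  mu.-integrable D (EFin \o (fun x => complex.Re (F x))) /\
  mu.-integrable D (EFin \o (fun x => complex.Im (F x))).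

Lemma eq_cint D F G : {in D, F =1 G} -> cint D F = cint D G.
Proof. by move=> FG; rewrite /cint; congr (_ +i* _); apply: eq_Rintegral => x xD; rewrite FG. Qed.

Lemma cintegrableD D F G : measurable D ->
  cintegrable D F -> cintegrable D G -> cintegrable D (fun x => F x + G x).
Proof.
move=> mD [F1 F2] [G1 G2]; split.
  apply: (eq_integrable mD _ _ _ (integrableD mD F1 G1)) => x _ /=.
  by rewrite raddfD.
apply: (eq_integrable mD _ _ _ (integrableD mD F2 G2)) => x _ /=.
by rewrite raddfD.
Qed.

Lemma cintegrableZ D F (c : C) : measurable D ->
  cintegrable D F -> cintegrable D (fun x => c * F x).
Proof.
case: c => a b mD [F1 F2]; split.
  apply: (eq_integrable mD _ _ _ (integrableB mD (integrableZl mD a F1) (integrableZl mD b F2))) => x _ /=.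
  by case: (F x).
apply: (eq_integrable mD _ _ _ (integrableD mD (integrableZl mD a F2) (integrableZl mD b F1))) => x _ /=.
by case: (F x).
Qed.

Lemma cintD D F G : measurable D -> cintegrable D F -> cintegrable D G ->
  cint D (fun x => F x + G x) = cint D F + cint D G.
Proof.
move=> mD [F1 F2] [G1 G2]; rewrite /cint.
rewrite [RHS]/GRing.add/= -!RintegralD//.
by congr (_ +i* _); apply: eq_Rintegral => x _; rewrite raddfD.
Qed.

Lemma cintZ D F (c : C) : measurable D -> cintegrable D F ->
  cint D (fun x => c * F x) = c * cint D F.
Proof.
case: c => a b mD [F1 F2]; rewrite /cint.
rewrite [RHS]/GRing.mul/= -!RintegralZl// -RintegralB//; last 2 first.
- by apply: (eq_integrable mD _ _ _ (integrableZl mD a F1)) => x _.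
- by apply: (eq_integrable mD _ _ _ (integrableZl mD b F2)) => x _.
rewrite -RintegralD//; last 2 first.
- by apply: (eq_integrable mD _ _ _ (integrableZl mD a F2)) => x _.
- by apply: (eq_integrable mD _ _ _ (integrableZl mD b F1)) => x _.
by congr (_ +i* _); apply: eq_Rintegral => x _; case: (F x).
Qed.

Lemma cintegrableB D F G : measurable D ->
  cintegrable D F -> cintegrable D G -> cintegrable D (fun x => F x - G x).
Proof.
move=> mD F1 G1; have -> : (fun x => F x - G x) = (fun x => F x + (-1) * G x).
  by apply/funext => x; rewrite mulN1r.
by apply: cintegrableD => //; exact: cintegrableZ.
Qed.

Lemma cintB D F G : measurable D -> cintegrable D F -> cintegrable D G ->
  cint D (fun x => F x - G x) = cint D F - cint D G.
Proof.
move=> mD F1 G1; have -> : (fun x => F x - G x) = (fun x => F x + (-1) * G x).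
  by apply/funext => x; rewrite mulN1r.
rewrite cintD//; last exact: cintegrableZ.
by rewrite cintZ// mulN1r.
Qed.

(** Real and imaginary parts are bounded separately, which costs the factor 2; the sharp inequality
    would need a rotation of the integral, and every use tolerates a constant. *)
Lemma ler_normc_cint D F (g : T -> R) : measurable D -> cintegrable D F ->
  mu.-integrable D (EFin \o g) -> (forall x, D x -> normc (F x) <= g x) ->
  normc (cint D F) <= 2 * \int[mu]_(x in D) g x.
Proof.
move=> mD [F1 F2] ig Fg; rewrite (le_trans (ler_normc_ReIm _))//= mulr_natl mulr2n.
have norm_int f : mu.-integrable D (EFin \o f) -> mu.-integrable D (EFin \o (fun x => `|f x|)).
  move=> /integrable_abse; exact: (eq_integrable mD).
apply: lerD.
- rewrite (le_trans (le_normr_Rintegral _ _))// le_Rintegral//; first exact: norm_int.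
  by move=> x Dx; rewrite (le_trans (ler_Re_normc _))// Fg.
- rewrite (le_trans (le_normr_Rintegral _ _))// le_Rintegral//; first exact: norm_int.
  by move=> x Dx; rewrite (le_trans (ler_Im_normc _))// Fg.
Qed.

End ComplexIntegral.

(** * Integrals along segments *)

Section Segment.
Variable R : realType.
Local Notation C := R[i].
Local Notation mu := (@lebesgue_measure R).
Implicit Types (F G : R -> C) (a b : R).

Definition seg F a b : C := cint mu `[a, b] F.

(** Two-sided continuity at each point of the closed segment. The integrands are restrictions of
    functions continuous around the segment, so this costs nothing and composition stays free of
    subspace topologies. *)
Definition cont_on F a b := forall t, a <= t <= b -> {for t, continuous (F : R -> C^o)}.

Lemma cont_integrable (f : R -> R) a b :
  (forall t, a <= t <= b -> {for t, continuous f}) -> mu.-integrable `[a, b] (EFin \o f).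
Proof.
move=> cf; apply: continuous_compact_integrable; first exact: segment_compact.
apply: continuous_in_subspaceT => t; rewrite inE/= in_itv/=; exact: cf.
Qed.

Lemma cont_cintegrable F a b : cont_on F a b -> cintegrable mu `[a, b] F.
Proof.
move=> cF; split; apply: cont_integrable => t tab.
- by apply: continuous_comp (cF t tab) _; exact: continuous_Re.
- by apply: continuous_comp (cF t tab) _; exact: continuous_Im.
Qed.

Lemma segB (F G : R -> C) a b : cont_on F a b -> cont_on G a b ->
  seg (fun t => F t - G t) a b = seg F a b - seg G a b.
Proof. by move=> cF cG; apply: cintB => //; exact: cont_cintegrable. Qed.

Lemma seg_cst (c : C) a b : a <= b -> seg (fun=> c) a b = c * (b - a)%:C.
Proof.
move=> ab; rewrite /seg /cint !Rintegral_cst//=.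
have -> : fine (mu `[a, b]) = b - a.
  rewrite lebesgue_measure_itv/= lte_fin; case: ltP => // ba.
  by rewrite (@le_anti _ _ a b) ?ab// subrr.
by case: c => x y; rewrite [RHS]/GRing.mul/= !mulr0 subr0 add0r.
Qed.

Lemma seg_split F a c b : a <= c -> c <= b -> cont_on F a b ->
  seg F a b = seg F a c + seg F c b.
Proof.
move=> ac cb /cont_cintegrable[i1 i2].
have key (f : R -> R) : mu.-integrable `[a, b] (EFin \o f) ->
  \int[mu]_(x in `[a, b]) f x = \int[mu]_(x in `[a, c]) f x + \int[mu]_(x in `[c, b]) f x.
  move=> fi; rewrite -(@Rintegral_itv_obnd_cbnd _ c); last first.
    by apply: integrableS fi => //; apply: subset_itvr; rewrite bnd_simp.
  by rewrite -(@Rintegral_itvB _ _ (BLeft a))// addrC subrK.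
by rewrite /seg /cint !(key _ i1) !(key _ i2).
Qed.

Lemma ler_normc_seg F (g : R -> R) a b : cont_on F a b ->
  mu.-integrable `[a, b] (EFin \o g) ->
  (forall t, a <= t <= b -> normc (F t) <= g t) ->
  normc (seg F a b) <= 2 * \int[mu]_(t in `[a, b]) g t.
Proof.
move=> cF ig Fg; apply: ler_normc_cint => //; exact: cont_cintegrable.
Qed.

Lemma ler_normc_seg_cst F (M : R) a b : a <= b -> cont_on F a b ->
  (forall t, a <= t <= b -> normc (F t) <= M) ->
  normc (seg F a b) <= 2 * M * (b - a).
Proof.
move=> ab cF FM; rewrite (le_trans (@ler_normc_seg F (cst M) _ _ cF _ FM))//.
  apply: cont_integrable => t _; exact: cst_continuous.
rewrite Rintegral_cst//= lebesgue_measure_itv/= lte_fin; case: ltP => [_|ba].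
  by rewrite /= mulrA.
by rewrite (@le_anti _ _ a b) ?ab// subrr !mulr0.
Qed.

End Segment.

Lemma nested_intervals (R : realType) (a b : nat -> R) :
  (forall n, a n <= a n.+1) -> (forall n, b n.+1 <= b n) -> (forall n, a n <= b n) ->
  exists c, forall n, a n <= c <= b n.
Proof.
move=> /nondecreasing_seqP aS /nonincreasing_seqP bS ab.
have amb m n : a m <= b n.
  rewrite (le_trans (aS _ _ (leq_maxl m n)))// (le_trans (ab _))//.
  exact/bS/leq_maxr.
exists (sup (range a)) => n; apply/andP; split.
  apply: ub_le_sup; last by exists n.
  by exists (b 0%N) => _ [m _ <-].
apply: ge_sup; first by exists (a 0%N), 0%N.
by move=> _ [m _ <-].
Qed.

Lemma sum4_pigeonhole (R : realType) (N a b c d : R) : N <= a + b + (c + d) ->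
  [|| N <= 4 * a, N <= 4 * b, N <= 4 * c | N <= 4 * d].
Proof.
by case: (leP N (4 * a)) => //= ?; case: (leP N (4 * b)) => //= ?;
  case: (leP N (4 * c)) => //= ?; case: (leP N (4 * d)) => //= ? ?; lra.
Qed.

(** * Goursat's theorem and power series *)

Section Rectangle.
Variable R : realType.
Local Notation C := R[i].
Implicit Types (F G : C -> C) (x y : R).

(** The contour integral of [F] along the boundary, counterclockwise: [dz] is [dt] on the horizontal
    sides and ['i * dt] on the vertical ones. *)
Definition rect F x1 x2 y1 y2 : C :=
  seg (fun t => F (t +i* y1)) x1 x2 - seg (fun t => F (t +i* y2)) x1 x2
  + 'i * (seg (fun t => F (x2 +i* t)) y1 y2 - seg (fun t => F (x1 +i* t)) y1 y2).

Definition hcont F y x1 x2 := forall t, x1 <= t <= x2 -> {for (t +i* y : C^o), continuous (F : C^o -> C^o)}.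
Definition vcont F x y1 y2 := forall t, y1 <= t <= y2 -> {for (x +i* t : C^o), continuous (F : C^o -> C^o)}.

(** Only the four sides matter: integrands with a pole inside the rectangle must qualify. *)
Definition bdcont F x1 x2 y1 y2 :=
  [/\ hcont F y1 x1 x2, hcont F y2 x1 x2, vcont F x1 y1 y2 & vcont F x2 y1 y2].

Lemma hcont_on F y x1 x2 : hcont F y x1 x2 -> cont_on (fun t => F (t +i* y)) x1 x2.
Proof. by move=> cF t tx; apply: continuous_comp (cF t tx); exact: continuous_hline. Qed.

Lemma vcont_on F x y1 y2 : vcont F x y1 y2 -> cont_on (fun t => F (x +i* t)) y1 y2.
Proof. by move=> cF t tx; apply: continuous_comp (cF t tx); exact: continuous_vline. Qed.

Lemma eq_rect F G x1 x2 y1 y2 : x1 <= x2 -> y1 <= y2 ->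
  (forall t, x1 <= t <= x2 -> F (t +i* y1) = G (t +i* y1)) ->
  (forall t, x1 <= t <= x2 -> F (t +i* y2) = G (t +i* y2)) ->
  (forall t, y1 <= t <= y2 -> F (x1 +i* t) = G (x1 +i* t)) ->
  (forall t, y1 <= t <= y2 -> F (x2 +i* t) = G (x2 +i* t)) ->
  rect F x1 x2 y1 y2 = rect G x1 x2 y1 y2.
Proof.
move=> x12 y12 h1 h2 h3 h4; rewrite /rect /seg.
by congr (_ - _ + 'i * (_ - _)); apply: eq_cint => t; rewrite inE/= in_itv/=; [exact: h1|exact: h2|exact: h4|exact: h3].
Qed.

Lemma continuousDc F G (z : C) : {for (z : C^o), continuous (F : C^o -> C^o)} ->
  {for (z : C^o), continuous (G : C^o -> C^o)} ->
  {for (z : C^o), continuous ((fun z => F z + G z) : C^o -> C^o)}.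
Proof.
move=> cF cG; apply: (@cvgD C (C^o) _ _ (nbhs_filter (z : C^o)) F G (F z) (G z)).
  exact: cF.
exact: cG.
Qed.

Lemma bdcontD F G x1 x2 y1 y2 : bdcont F x1 x2 y1 y2 -> bdcont G x1 x2 y1 y2 ->
  bdcont (fun z => F z + G z) x1 x2 y1 y2.
Proof.
move=> [a1 a2 a3 a4] [b1 b2 b3 b4].
by split => t tx; apply: continuousDc;
  [exact: a1|exact: b1|exact: a2|exact: b2|exact: a3|exact: b3|exact: a4|exact: b4].
Qed.

Lemma rectD F G x1 x2 y1 y2 : bdcont F x1 x2 y1 y2 -> bdcont G x1 x2 y1 y2 ->
  rect (fun z => F z + G z) x1 x2 y1 y2 = rect F x1 x2 y1 y2 + rect G x1 x2 y1 y2.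
Proof.
move=> [f1 f2 f3 f4] [g1 g2 g3 g4]; rewrite /rect /seg.
rewrite !cintD//; try (by apply/cont_cintegrable/hcont_on); try by apply/cont_cintegrable/vcont_on.
by ring.
Qed.

Lemma rectZ F (c : C) x1 x2 y1 y2 : bdcont F x1 x2 y1 y2 ->
  rect (fun z => c * F z) x1 x2 y1 y2 = c * rect F x1 x2 y1 y2.
Proof.
move=> [f1 f2 f3 f4]; rewrite /rect /seg.
rewrite !cintZ//; try (by apply/cont_cintegrable/hcont_on); try by apply/cont_cintegrable/vcont_on.
by ring.
Qed.

Lemma affine_continuous (A B : C) : continuous (fun z : C^o => A + B * z : C^o).
Proof.
move=> z; apply: (@cvgD C (C^o) (C^o) (nbhs (z : C^o)) (nbhs_filter (z : C^o)) (cst A)); first exact: cvg_cst.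
exact: (@mulrl_continuous C B z).
Qed.

(** On opposite sides the integrand differs by a constant, [B] times the displacement. The
    horizontal pair and the vertical pair then give ['i * B] times the area with opposite signs. *)
Lemma rect_affine (A B : C) x1 x2 y1 y2 : x1 <= x2 -> y1 <= y2 ->
  rect (fun z => A + B * z) x1 x2 y1 y2 = 0.
Proof.
move=> x12 y12.
have ch y : hcont (fun z => A + B * z) y x1 x2.
  by move=> t _; exact: affine_continuous.
have cv x : vcont (fun z => A + B * z) x y1 y2.
  by move=> t _; exact: affine_continuous.
rewrite /rect -(segB (hcont_on (ch y1)) (hcont_on (ch y2))).
rewrite -(segB (vcont_on (cv x2)) (vcont_on (cv x1))).
have -> : (fun t => A + B * (t +i* y1) - (A + B * (t +i* y2))) = (fun=> B * (0 +i* (y1 - y2))).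
  apply/funext => t; rewrite opprD addrACA subrr add0r -mulrBr; congr (_ * _).
  by rewrite [LHS]/GRing.add/= subrr.
have -> : (fun t => A + B * (x2 +i* t) - (A + B * (x1 +i* t))) = (fun=> B * (x2 - x1)%:C).
  apply/funext => t; rewrite opprD addrACA subrr add0r -mulrBr; congr (_ * _).
  by rewrite [LHS]/GRing.add/= subrr.
rewrite !seg_cst//.
have -> : 0 +i* (y1 - y2) = - ('i * (y2 - y1)%:C) :> C.
  by congr (_ +i* _) => /=; ring.
by ring.
Qed.


Lemma rect_splitx F x1 x x2 y1 y2 : x1 <= x -> x <= x2 ->
  hcont F y1 x1 x2 -> hcont F y2 x1 x2 ->
  rect F x1 x2 y1 y2 = rect F x1 x y1 y2 + rect F x x2 y1 y2.
Proof.
move=> x1x xx2 h1 h2; rewrite /rect (seg_split x1x xx2 (hcont_on h1)).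
by rewrite (seg_split x1x xx2 (hcont_on h2)); ring.
Qed.

Lemma rect_splity F x1 x2 y1 y y2 : y1 <= y -> y <= y2 ->
  vcont F x1 y1 y2 -> vcont F x2 y1 y2 ->
  rect F x1 x2 y1 y2 = rect F x1 x2 y1 y + rect F x1 x2 y y2.
Proof.
move=> y1y yy2 h1 h2; rewrite /rect (seg_split y1y yy2 (vcont_on h1)).
by rewrite (seg_split y1y yy2 (vcont_on h2)); ring.
Qed.

Lemma ler_normc_rect F (M : R) x1 x2 y1 y2 : x1 <= x2 -> y1 <= y2 -> bdcont F x1 x2 y1 y2 ->
  (forall t, x1 <= t <= x2 -> normc (F (t +i* y1)) <= M) ->
  (forall t, x1 <= t <= x2 -> normc (F (t +i* y2)) <= M) ->
  (forall t, y1 <= t <= y2 -> normc (F (x1 +i* t)) <= M) ->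
  (forall t, y1 <= t <= y2 -> normc (F (x2 +i* t)) <= M) ->
  normc (rect F x1 x2 y1 y2) <= 4 * M * ((x2 - x1) + (y2 - y1)).
Proof.
move=> x12 y12 [/hcont_on c1 /hcont_on c2 /vcont_on c3 /vcont_on c4] m1 m2 m3 m4.
have := ler_normc_seg_cst x12 c1 m1.
have := ler_normc_seg_cst x12 c2 m2.
have := ler_normc_seg_cst y12 c3 m3.
have := ler_normc_seg_cst y12 c4 m4.
rewrite /rect; set a1 := seg _ _ _; set a2 := seg _ _ _; set a3 := seg _ _ _; set a4 := seg _ _ _.
move=> h1 h2 h3 h4.
have := le_normcD (a4 - a3) ('i * (a1 - a2)).
have := le_normcD a4 (- a3); have := le_normcD a1 (- a2).
rewrite !normcN normcM normc_i mul1r.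
by lra.
Qed.

(** For sides known only through the size of their integrals, as when a side is chosen for its small
    mass. *)
Lemma ler_normc_rect_segs F x1 x2 y1 y2 Q :
  normc (seg (fun t => F (t +i* y1)) x1 x2) <= Q -> normc (seg (fun t => F (t +i* y2)) x1 x2) <= Q ->
  normc (seg (fun t => F (x1 +i* t)) y1 y2) <= Q -> normc (seg (fun t => F (x2 +i* t)) y1 y2) <= Q ->
  normc (rect F x1 x2 y1 y2) <= 4 * Q.
Proof.
rewrite /rect; move: (seg _ _ _) (seg _ _ _) (seg _ _ _) (seg _ _ _) => a1 a2 a3 a4 h1 h2 h3 h4.
have := le_normcD (a4 - a3) ('i * (a1 - a2)).
have := le_normcD a1 (- a2); have := le_normcD a4 (- a3).
rewrite !normcN normcM normc_i mul1r.
by lra.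
Qed.

Definition holo F (z : C) := derivable (F : C^o -> C^o) (z : C^o) (1 : C^o).

Lemma holo_continuous F z : holo F z -> {for (z : C^o), continuous (F : C^o -> C^o)}.
Proof. by move=> hz; apply: differentiable_continuous; apply/derivable1_diffP. Qed.

Definition rholo F x1 x2 y1 y2 := forall x y, x1 <= x <= x2 -> y1 <= y <= y2 -> holo F (x +i* y).

Lemma rholoW F x1 x2 y1 y2 x1' x2' y1' y2' :
  x1 <= x1' -> x2' <= x2 -> y1 <= y1' -> y2' <= y2 ->
  rholo F x1 x2 y1 y2 -> rholo F x1' x2' y1' y2'.
Proof.
move=> a b c d H x y /andP[xa xb] /andP[ya yb]; apply: H; apply/andP; split.
- exact: le_trans xa.
- exact: le_trans xb _.
- exact: le_trans ya.
- exact: le_trans yb _.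
Qed.

Lemma rholo_bdcont F x1 x2 y1 y2 : x1 <= x2 -> y1 <= y2 ->
  rholo F x1 x2 y1 y2 -> bdcont F x1 x2 y1 y2.
Proof.
move=> x12 y12 H.
by split => t tx; apply: holo_continuous; apply: H; rewrite ?lexx ?x12 ?y12 ?tx.
Qed.

(** The integrals over the four quarters add up to the whole, so one of them carries at least a
    fourth of it. A rectangle is given by a corner and its side lengths; iteration then moves the
    corner and halves the lengths. *)
Lemma rect_quarter F x y w h : 0 <= w -> 0 <= h -> rholo F x (x + w) y (y + h) ->
  exists x' y', [/\ x <= x', x' + w / 2 <= x + w, y <= y', y' + h / 2 <= y + h &
    normc (rect F x (x + w) y (y + h)) <= 4 * normc (rect F x' (x' + w / 2) y' (y' + h / 2))].
Proof.
move=> w0 h0 H.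
have xw : x <= x + w by lra.
have yh : y <= y + h by lra.
have x2 : x <= x + w / 2 by lra.
have x3 : x + w / 2 <= x + w by lra.
have y2 : y <= y + h / 2 by lra.
have y3 : y + h / 2 <= y + h by lra.
have [h1 h2 _ _] := rholo_bdcont xw yh H.
have [_ _ h3 h4] := rholo_bdcont x2 yh (rholoW (lexx _) x3 (lexx _) (lexx _) H).
have [_ _ h5 h6] := rholo_bdcont x3 yh (rholoW x2 (lexx _) (lexx _) (lexx _) H).
rewrite (rect_splitx x2 x3 h1 h2) (rect_splity y2 y3 h3 h4) (rect_splity y2 y3 h5 h6).
have -> : x + w = x + w / 2 + w / 2 by lra.
have -> : y + h = y + h / 2 + h / 2 by lra.
set r1 := rect _ _ _ _ _; set r2 := rect _ _ _ _ _.
set r3 := rect _ _ _ _ _; set r4 := rect _ _ _ _ _.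
have N4 := le_trans (le_normcD (r1 + r2) (r3 + r4)) (lerD (le_normcD r1 r2) (le_normcD r3 r4)).
have /or4P[] := sum4_pigeonhole N4 => N1.
- by exists x, y; split => //; lra.
- by exists x, (y + h / 2); split => //; lra.
- by exists (x + w / 2), y; split => //; lra.
- by exists (x + w / 2), (y + h / 2); split => //; lra.
Qed.

Lemma goursat F x1 x2 y1 y2 : x1 <= x2 -> y1 <= y2 -> rholo F x1 x2 y1 y2 ->
  rect F x1 x2 y1 y2 = 0.
Proof.
move=> x12 y12 H.
pose w n := (x2 - x1) / 2 ^+ n; pose h n := (y2 - y1) / 2 ^+ n.
have wS n : w n / 2 = w n.+1 by rewrite /w exprSr invfM mulrA.
have hS n : h n / 2 = h n.+1 by rewrite /h exprSr invfM mulrA.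
have w_ge0 n : 0 <= w n by rewrite divr_ge0 ?exprn_ge0// subr_ge0.
have h_ge0 n : 0 <= h n by rewrite divr_ge0 ?exprn_ge0// subr_ge0.
pose inr n (s : R * R) := [/\ x1 <= s.1, s.1 + w n <= x2, y1 <= s.2 & s.2 + h n <= y2].
pose I n (s : R * R) := normc (rect F s.1 (s.1 + w n) s.2 (s.2 + h n)).
(* The invariant [inr] is a premise under the existential: the statement is then total in [p], and
   [choice] yields a function [nxt] that can be iterated. *)
have step (p : nat * (R * R)) : exists s', inr p.1 p.2 ->
    [/\ inr p.1.+1 s', p.2.1 <= s'.1 /\ s'.1 + w p.1.+1 <= p.2.1 + w p.1,
     p.2.2 <= s'.2 /\ s'.2 + h p.1.+1 <= p.2.2 + h p.1 &
     I p.1 p.2 <= 4 * I p.1.+1 s'].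
  case: p => n [x y] /=.
  have [[/= i1 i2 i3 i4]|] := pselect (inr n (x, y)); last by exists (x, y).
  have [x' [y' [a b c d e]]] := rect_quarter (w_ge0 n) (h_ge0 n) (rholoW i1 i2 i3 i4 H).
  exists (x', y') => _; rewrite -!wS -!hS; split => //=; last first.
    rewrite /I/= -wS -hS; exact: e.
  rewrite /inr/= -wS -hS; split => //.
  - exact: le_trans i1 a.
  - exact: le_trans b i2.
  - exact: le_trans i3 c.
  - exact: le_trans d i4.
have [nxt nxtP] := choice step.
pose fix S n := if n is m.+1 then nxt (m, S m) else (x1, y1).
have SP n : inr n (S n).
  elim: n => [|n IH]; first by rewrite /inr/= /w /h !expr0 !divr1; split; lra.
  by have [] := nxtP (n, S n) IH.
have SQ n := nxtP (n, S n) (SP n).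
have [px pxP] : exists c, forall n, (S n).1 <= c <= (S n).1 + w n.
  apply: nested_intervals => n; first by have [_ [? ?] _ _] := SQ n.
  - by have [_ [? ?] _ _] := SQ n.
  - by rewrite lerDl.
have [py pyP] : exists c, forall n, (S n).2 <= c <= (S n).2 + h n.
  apply: nested_intervals => n; first by have [_ _ [? ?] _] := SQ n.
  - by have [_ _ [? ?] _] := SQ n.
  - by rewrite lerDl.
have Ile n : normc (rect F x1 x2 y1 y2) <= 4 ^+ n * I n (S n).
  elim: n => [|n IH].
    by rewrite /I /= /w /h !expr0 !divr1 mul1r !subrKC.
  have [_ _ _ In] := SQ n.
  by rewrite (le_trans IH)// exprSr -mulrA ler_wpM2l// exprn_ge0.
have hp : holo F (px +i* py).
  have := SP 0%N; have := pxP 0%N; have := pyP 0%N => /andP[a1 a2] /andP[b1 b2] [c1 c2 c3 c4].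
  by apply: H; apply/andP; split; lra.
have [D DP] := derivable_normcP hp.
(* Perimeter and diameter of the n-th rectangle both scale like [2^-n], which cancels the factor
   [4^n] gathered in the subdivisions. *)
have small e : 0 < e -> normc (rect F x1 x2 y1 y2) <= 4 * e * ((x2 - x1) + (y2 - y1)) ^+ 2.
  move=> e0; have [d d0 dP] := DP e e0.
  have [n nd] : exists n, w n + h n < d.
    have : (fun n => geometric ((x2 - x1) + (y2 - y1)) 2^-1 n) @ \oo --> (0 : R).
      by apply: cvg_geometric; rewrite ger0_norm// invf_lt1// ltr1n.
    move=> /cvgrPdist_lt/(_ d d0) [n _ /(_ n (leqnn n))].
    rewrite /= sub0r normrN => nd; exists n.
    by rewrite -mulrDl -exprVn (le_lt_trans _ nd)// ler_norm.
  rewrite (le_trans (Ile n))//.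
  set L := x2 - x1 + (y2 - y1).
  have wh : w n + h n = L / 2 ^+ n by rewrite -mulrDl.
  have close x y : (S n).1 <= x <= (S n).1 + w n -> (S n).2 <= y <= (S n).2 + h n ->
      normc (x +i* y - px +i* py) <= w n + h n.
    move=> /andP[a1 a2] /andP[b1 b2]; have := pxP n; have := pyP n => /andP[c1 c2] /andP[d1 d2].
    rewrite (le_trans (ler_normc_ReIm _))//= lerD// ler_norml; apply/andP; split; lra.
  (* The first-order expansion of [F] at the limit point is affine and contributes nothing to the
     contour integral; [G] is the remainder, of size [e] times the distance. *)
  pose A := F (px +i* py) - D * (px +i* py).
  pose G z := F z + (- A + - D * z).
  have GE z : G z = F z - F (px +i* py) - D * (z - px +i* py) by rewrite /G /A; ring.
  have Gs x y : (S n).1 <= x <= (S n).1 + w n -> (S n).2 <= y <= (S n).2 + h n ->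
      normc (G (x +i* y)) <= e * (w n + h n).
    move=> xs ys; rewrite GE (le_trans (dP _ _))//.
      by rewrite (le_lt_trans (close _ _ xs ys)).
    by rewrite ler_pM2l// close.
  have [i1 i2 i3 i4] := SP n.
  have xw : (S n).1 <= (S n).1 + w n by rewrite lerDl.
  have yh : (S n).2 <= (S n).2 + h n by rewrite lerDl.
  have cF := rholo_bdcont xw yh (rholoW i1 i2 i3 i4 H).
  have cA : bdcont (fun z => - A + - D * z) (S n).1 ((S n).1 + w n) (S n).2 ((S n).2 + h n).
    by split => t _; exact: affine_continuous.
  have GI : rect G (S n).1 ((S n).1 + w n) (S n).2 ((S n).2 + h n) =
      rect F (S n).1 ((S n).1 + w n) (S n).2 ((S n).2 + h n).
    by rewrite rectD// rect_affine// addr0.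
  have cG : bdcont G (S n).1 ((S n).1 + w n) (S n).2 ((S n).2 + h n).
    exact: bdcontD.
  have : I n (S n) <= 4 * (e * (w n + h n)) * (w n + h n).
    rewrite /I -GI (le_trans (ler_normc_rect (M := e * (w n + h n)) xw yh cG _ _ _ _))//.
    - by move=> t tx; apply: Gs => //; rewrite lexx.
    - by move=> t tx; apply: Gs => //; rewrite lexx andbT.
    - by move=> t tx; apply: Gs => //; rewrite lexx.
    - by move=> t tx; apply: Gs => //; rewrite lexx andbT.
    - by rewrite le_eqVlt; apply/orP; left; apply/eqP; ring.
  move=> In; rewrite (le_trans (ler_wpM2l _ In)) ?exprn_ge0// wh.
  have -> : (4 : R) ^+ n = 2 ^+ n * 2 ^+ n by rewrite -exprMn; congr (_ ^+ _); ring.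
  have n2 : (2 : R) ^+ n != 0 by rewrite expf_neq0.
  by rewrite le_eqVlt; apply/orP; left; apply/eqP; field.
apply/eqP; rewrite -normc_eq0; apply/eqP/le_anti; rewrite normc_ge0 andbT.
apply/ler_addgt0Pr => e e0; rewrite add0r.
set L := x2 - x1 + (y2 - y1) in small.
(* The [+ 1] covers a rectangle reduced to a point, where [L = 0]. *)
have L0 : 0 < 4 * (L ^+ 2 + 1) by rewrite mulr_gt0// ltr_wpDl// sqr_ge0.
have := small (e / (4 * (L ^+ 2 + 1))); rewrite divr_gt0// => /(_ isT) /le_trans; apply.
rewrite [leLHS](_ : _ = e * (L ^+ 2 / (L ^+ 2 + 1))); last first.
  by have := lt0r_neq0 L0; rewrite mulf_eq0 negb_or => /andP[_ ?]; field.
rewrite ler_piMr ?(ltW e0)// ler_pdivrMr ?mul1r ?lerDl//.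
by rewrite ltr_wpDl// sqr_ge0.
Qed.

End Rectangle.

(** * Contours around an isolated singularity *)

Section Holo.
Variable R : realType.
Local Notation C := R[i].
Implicit Types (F G h : C -> C) (z w : C).

Lemma holo_cst (c : C) z : holo (fun=> c) z.
Proof. exact: (@derivable_cst C (C^o) (C^o) c z 1). Qed.

Lemma holo_id z : holo id z.
Proof. exact: (@derivable_id C (C^o) z 1). Qed.

Lemma holoB F G z : holo F z -> holo G z -> holo (fun z => F z - G z) z.
Proof. by move=> hF hG; exact: (derivableB hF hG). Qed.

Lemma holoM F G z : holo F z -> holo G z -> holo (fun z => F z * G z) z.
Proof. by move=> hF hG; exact: (derivableM hF hG). Qed.

Lemma holoX F n z : holo F z -> holo (fun z => F z ^+ n) z.
Proof.
move=> hF; elim: n => [|n IH].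
  rewrite (_ : (fun z => F z ^+ 0) = fun=> 1); first exact: holo_cst.
  by apply/funext => y; rewrite expr0.
rewrite (_ : (fun z => F z ^+ n.+1) = fun z => F z * F z ^+ n); first exact: holoM.
by apply/funext => y; rewrite exprS.
Qed.

Lemma holoV F z : F z != 0 -> holo F z -> holo (fun z => (F z)^-1) z.
Proof. by move=> F0 hF; exact: (derivableV F0 hF). Qed.

Lemma continuous_normc : continuous (fun z : C^o => normc z).
Proof.
move=> z; apply/(@cvgrPdist_le _ _ _ _ (nbhs_filter (z : C^o))) => e e0.
apply/nbhs_normcP; exists e => // w wz.
have h1 := le_normcD (w - z) z; have h2 := le_normcD (z - w) w.
rewrite !subrK (normcB z) in h1 h2.
by rewrite ler_norml; apply/andP; split; lra.
Qed.

Lemma cont_on_bounded (F : R -> C) a b : a <= b -> cont_on F a b ->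
  exists M, forall t, a <= t <= b -> normc (F t) <= M.
Proof.
move=> ab cF.
have : {within `[a, b], continuous (fun t => normc (F t))}.
  apply: continuous_in_subspaceT => t; rewrite inE/= in_itv/= => tab.
  by apply: continuous_comp (cF t tab) _; exact: continuous_normc.
move=> /(EVT_max ab)[c _ cM]; exists (normc (F c)) => t tab.
by apply: cM; rewrite in_itv.
Qed.

Lemma bdcont_bounded F x1 x2 y1 y2 : x1 <= x2 -> y1 <= y2 -> bdcont F x1 x2 y1 y2 ->
  exists M, [/\ forall t, x1 <= t <= x2 -> normc (F (t +i* y1)) <= M,
  forall t, x1 <= t <= x2 -> normc (F (t +i* y2)) <= M,
  forall t, y1 <= t <= y2 -> normc (F (x1 +i* t)) <= M &
  forall t, y1 <= t <= y2 -> normc (F (x2 +i* t)) <= M].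
Proof.
move=> x12 y12 [/hcont_on c1 /hcont_on c2 /vcont_on c3 /vcont_on c4].
have [M1 M1P] := cont_on_bounded x12 c1.
have [M2 M2P] := cont_on_bounded x12 c2.
have [M3 M3P] := cont_on_bounded y12 c3.
have [M4 M4P] := cont_on_bounded y12 c4.
have N1 := ler_norm M1; have N2 := ler_norm M2; have N3 := ler_norm M3; have N4 := ler_norm M4.
have p1 := normr_ge0 M1; have p2 := normr_ge0 M2; have p3 := normr_ge0 M3; have p4 := normr_ge0 M4.
exists (`|M1| + `|M2| + `|M3| + `|M4|); split => t tx.
- by apply: (le_trans (M1P t tx)); lra.
- by apply: (le_trans (M2P t tx)); lra.
- by apply: (le_trans (M3P t tx)); lra.
- by apply: (le_trans (M4P t tx)); lra.
Qed.

(** The four strips between the two rectangles avoid [p], and Goursat's theorem removes them one at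
    a time. *)
Lemma rect_shrink F p X1 X2 Y1 Y2 x1 x2 y1 y2 :
  X1 <= x1 -> x1 < complex.Re p -> complex.Re p < x2 -> x2 <= X2 ->
  Y1 <= y1 -> y1 < complex.Im p -> complex.Im p < y2 -> y2 <= Y2 ->
  (forall z, z != p -> holo F z) ->
  rect F X1 X2 Y1 Y2 = rect F x1 x2 y1 y2.
Proof.
case: p => a b /= Xx1 x1a ax2 xX2 Yy1 y1b by2 yY2 H.
have hx x y : x != a -> holo F (x +i* y).
  by move=> xa; apply: H; rewrite eq_complex/= negb_and xa.
have hy x y : y != b -> holo F (x +i* y).
  by move=> yb; apply: H; rewrite eq_complex/= negb_and yb orbT.
have hcy y u v : y != b -> hcont F y u v.
  by move=> yb t _; apply/holo_continuous/hy.
have vcx x u v : x != a -> vcont F x u v.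
  by move=> xa t _; apply/holo_continuous/hx.
rewrite (@rect_splitx _ F X1 x1 X2); [|lra|lra|by apply: hcy; lra|by apply: hcy; lra].
rewrite (@goursat _ F X1 x1) ?add0r; [|lra|lra|by move=> x y *; apply: hx; lra].
rewrite (@rect_splitx _ F x1 x2 X2); [|lra|lra|by apply: hcy; lra|by apply: hcy; lra].
rewrite (@goursat _ F x2 X2) ?addr0; [|lra|lra|by move=> x y *; apply: hx; lra].
rewrite (@rect_splity _ F _ _ Y1 y1 Y2); [|lra|lra|by apply: vcx; lra|by apply: vcx; lra].
rewrite (@goursat _ F _ _ Y1 y1) ?add0r; [|lra|lra|by move=> x y *; apply: hy; lra].
rewrite (@rect_splity _ F _ _ y1 y2 Y2); [|lra|lra|by apply: vcx; lra|by apply: vcx; lra].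
by rewrite (@goursat _ F _ _ y2 Y2) ?addr0; [|lra|lra|move=> x y *; apply: hy; lra].
Qed.

(** Neither rectangle need contain the other; both are shrunk from the smallest rectangle containing
    the two. *)
Lemma rect_indep F p X1 X2 Y1 Y2 x1 x2 y1 y2 :
  X1 < complex.Re p < X2 -> Y1 < complex.Im p < Y2 ->
  x1 < complex.Re p < x2 -> y1 < complex.Im p < y2 ->
  (forall z, z != p -> holo F z) ->
  rect F X1 X2 Y1 Y2 = rect F x1 x2 y1 y2.
Proof.
move=> /andP[a1 a2] /andP[a3 a4] /andP[b1 b2] /andP[b3 b4] H.
pose u1 := Num.min X1 x1; pose u2 := Num.max X2 x2.
pose v1 := Num.min Y1 y1; pose v2 := Num.max Y2 y2.
transitivity (rect F u1 u2 v1 v2); first apply/esym.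
  by apply: (@rect_shrink F p) => //; rewrite ?ge_min ?le_max ?lexx.
by apply: (@rect_shrink F p) => //; rewrite ?ge_min ?le_max ?lexx ?orbT.
Qed.

(** The contour may be shrunk to a small square around [p], where the bound [M] makes the integral
    at most proportional to the side. *)
Lemma rect_removable F p x1 x2 y1 y2 M d :
  x1 < complex.Re p < x2 -> y1 < complex.Im p < y2 ->
  (forall z, z != p -> holo F z) ->
  0 < d -> (forall z, z != p -> normc (z - p) < d -> normc (F z) <= M) ->
  rect F x1 x2 y1 y2 = 0.
Proof.
move=> px py H d0 FM.
have M0 : 0 <= M.
  rewrite (le_trans (normc_ge0 (F (p + (d / 2)%:C))))// FM//.
    by rewrite -subr_eq0 addrC addKr -normc_eq0 normc_real normr_eq0; lra.
  by rewrite addrC addKr normc_real ger0_norm; lra.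
have small e : 0 < e -> normc (rect F x1 x2 y1 y2) <= e.
  move=> e0.
  (* On the square of half side [s] the integral is at most [16 * M * s], whence the second term,
     with [M + 1] in case [M = 0]. The first term keeps the sides within [2 * s < d] of [p]. *)
  pose s := Num.min (d / 3) (e / (16 * (M + 1))).
  have M1 : 0 < 16 * (M + 1) by lra.
  have s0 : 0 < s by rewrite lt_min !divr_gt0.
  have sd : s <= d / 3 by rewrite ge_min lexx.
  have se : s * (16 * (M + 1)) <= e by rewrite -ler_pdivlMr// ge_min lexx orbT.
  case: p px py H FM => a b px py H FM.
  rewrite (@rect_indep F (a +i* b) _ _ _ _ (a - s) (a + s) (b - s) (b + s)) => //=; try (apply/andP; split; lra).
  have fx x y : x != a -> x +i* y != a +i* b :> C.
    by move=> xa; rewrite eq_complex/= negb_and xa.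
  have fy x y : y != b -> x +i* y != a +i* b :> C.
    by move=> yb; rewrite eq_complex/= negb_and yb orbT.
  have nz x y : a - s <= x <= a + s -> b - s <= y <= b + s -> normc (x +i* y - a +i* b) < d.
    move=> xs ys; rewrite (le_lt_trans (ler_normc_ReIm _))//=.
    have : `|x - a| <= s by rewrite ler_norml; lra.
    have : `|y - b| <= s by rewrite ler_norml; lra.
    by lra.
  rewrite (le_trans (@ler_normc_rect _ F M (a - s) (a + s) (b - s) (b + s) _ _ _ _ _ _ _))//; try lra.
  - by split => t _; apply/holo_continuous/H; (try by apply: fx; lra); apply: fy; lra.
  - by move=> t tx; apply: FM; [apply: fy; lra|apply: nz => //; lra].
  - by move=> t tx; apply: FM; [apply: fy; lra|apply: nz => //; lra].
  - by move=> t tx; apply: FM; [apply: fx; lra|apply: nz => //; lra].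
  - by move=> t tx; apply: FM; [apply: fx; lra|apply: nz => //; lra].
apply/eqP; rewrite -normc_eq0; apply/eqP/le_anti; rewrite normc_ge0 andbT.
by apply/ler_addgt0Pr => e e0; rewrite add0r small.
Qed.

End Holo.

(** * Power series of entire functions *)

Section PowerSeries.
Variable R : realType.
Local Notation C := R[i].
Implicit Types (F G h : C -> C) (z w : C) (t : R).

(** The square is only a reference contour: by [oint_rect] any rectangle around 0 does as well, for
    functions holomorphic off 0. *)
Definition oint F : C := rect F (-1) 1 (-1) 1.

Lemma oint_rect F x1 x2 y1 y2 : x1 < 0 < x2 -> y1 < 0 < y2 ->
  (forall z, z != 0 -> holo F z) -> oint F = rect F x1 x2 y1 y2.
Proof.
by move=> hx hy H; apply: (@rect_indep _ F 0) => //=; apply/andP; split; lra.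
Qed.

Lemma holo_invX m z : z != 0 -> holo (fun z => z^-1 ^+ m) z.
Proof. by move=> z0; apply: holoX; apply: holoV => //; exact: holo_id. Qed.

Lemma holo_off0_bdcont F x1 x2 y1 y2 : x1 < 0 < x2 -> y1 < 0 < y2 ->
  (forall z, z != 0 -> holo F z) -> bdcont F x1 x2 y1 y2.
Proof.
move=> /andP[a b] /andP[c d] H.
by split => t _; apply/holo_continuous/H; rewrite eq_complex/= negb_and;
  (try by rewrite lt_eqF); (try by rewrite gt_eqF);
  apply/orP; right; (try by rewrite lt_eqF); rewrite gt_eqF.
Qed.

(** The contour is moved to the square of half side [t], all of whose sides lie in
    [t <= normc z]. *)
Lemma ler_normc_oint F t M : 0 < t -> (forall z, z != 0 -> holo F z) ->
  (forall z, t <= normc z -> normc (F z) <= M) -> normc (oint F) <= 16 * M * t.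
Proof.
move=> t0 H FM.
have tt : - t < 0 < t by apply/andP; split; lra.
have tle x : `|- t| <= `|x| -> t <= `|x| by rewrite normrN gtr0_norm.
rewrite (oint_rect tt tt H).
rewrite (le_trans (ler_normc_rect (M := M) _ _ (holo_off0_bdcont tt tt H) _ _ _ _))//; try lra.
- by move=> s _; apply: FM; rewrite (le_trans _ (ler_Im_normc _))//= tle.
- by move=> s _; apply: FM; rewrite (le_trans _ (ler_Im_normc _))//= (ger0_norm (ltW t0)).
- by move=> s _; apply: FM; rewrite (le_trans _ (ler_Re_normc _))//= tle.
- by move=> s _; apply: FM; rewrite (le_trans _ (ler_Re_normc _))//= (ger0_norm (ltW t0)).
Qed.

(* Plays the part of 2 pi i; only its being nonzero matters. *)
Definition oint_inv : C := oint (fun z => z^-1 ^+ 1).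

(** No primitive is involved: on the square of half side [t >= 1] the integrand is at most [t^-2],
    so the integral is at most [16 / t], while it does not depend on [t]. *)
Lemma oint_invX m : oint (fun z => z^-1 ^+ m.+2) = 0.
Proof.
have bnd t : 1 <= t -> normc (oint (fun z : C => z^-1 ^+ m.+2)) * t <= 16.
  move=> t1; have t0 : 0 < t by lra.
  have := @ler_normc_oint (fun z => z^-1 ^+ m.+2) t (t^-1 ^+ 2) t0 (@holo_invX m.+2).
  have h z : t <= normc z -> normc (z^-1 ^+ m.+2) <= t^-1 ^+ 2.
    move=> tz; rewrite normcX normcV.
    have z0 : 0 < normc z by lra.
    have zt : (normc z)^-1 <= t^-1 by rewrite lef_pV2.
    have t1' : t^-1 <= 1 by rewrite invf_le1.
    apply: (@le_trans _ _ (t^-1 ^+ m.+2)).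
      by rewrite ler_pXn2r// nnegrE invr_ge0; apply: ltW.
    by rewrite ler_wiXn2l// invr_ge0; apply: ltW.
  move=> /(_ h) le; rewrite -ler_pdivlMr// (le_trans le)//.
  by rewrite le_eqVlt; apply/orP; left; apply/eqP; field; lra.
apply/eqP; rewrite -normc_eq0; apply/eqP/le_anti; rewrite normc_ge0 andbT.
rewrite leNgt; apply/negP => n0.
set N := normc _ in bnd n0.
(* At [t = 1 + 17 / N] the bound would read [N + 17 <= 16]. *)
have N17 : 0 <= 17 / N by rewrite divr_ge0// ltW.
have := bnd (1 + 17 / N); rewrite lerDl => /(_ N17).
by rewrite mulrDr mulr1 mulrC divfK ?gt_eqF//; lra.
Qed.

(** The imaginary part is a sum of four integrals of [1 / (1 + t^2)] over [[-1, 1]], one for each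
    side, and each is at least 1 because the integrand is at least 1/2. *)
Lemma oint_inv_neq0 : oint_inv != 0.
Proof.
have sq t : 0 < 1 + t ^+ 2 by rewrite ltr_wpDr// sqr_ge0.
have int1 (f : R -> R) : (forall t, f t = (1 + t ^+ 2)^-1) ->
    1 <= \int[@lebesgue_measure R]_(t in `[-1, 1]) f t.
  move=> fE.
  have -> : f = fun t => (1 + t ^+ 2)^-1 by exact/funext.
  apply: (@le_trans _ _ (\int[@lebesgue_measure R]_(t in `[-1, 1]) (2^-1 : R))).
    rewrite Rintegral_cst//= lebesgue_measure_itv/= lte_fin ifT/=; lra.
  apply: le_Rintegral => //.
  - apply: cont_integrable => t _; exact: cst_continuous.
  - apply: cont_integrable => t _; apply: cvgV; first by rewrite gt_eqF.
    by apply: cvgD; [exact: cvg_cst|exact: exprn_continuous].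
  - move=> t; rewrite /= in_itv/= => t1; rewrite lef_pV2 ?posrE//; nra.
have fI (f : R -> R) : (forall t, f t = - (1 + t ^+ 2)^-1) ->
    \int[@lebesgue_measure R]_(t in `[-1, 1]) f t <= - 1.
  move=> fE; have -> : f = fun t => -1 * (1 + t ^+ 2)^-1.
    by apply/funext => t; rewrite fE mulN1r.
  rewrite RintegralZl//; first by rewrite mulN1r lerN2 int1.
  apply: cont_integrable => t _; apply: cvgV; first by rewrite gt_eqF.
  by apply: cvgD; [exact: cvg_cst|exact: exprn_continuous].
have : 0 < complex.Im oint_inv.
  rewrite /oint_inv /oint /rect /seg /cint/=.
  have i1 : 1 <= \int[@lebesgue_measure R]_(x in `[-1, 1]) - (-1 / (x ^+ 2 + (-1) ^+ 2)).
    by apply: int1 => t; rewrite sqrrN expr1n mulN1r opprK addrC.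
  have i2 : \int[@lebesgue_measure R]_(x in `[-1, 1]) - (1 / (x ^+ 2 + 1 ^+ 2)) <= - 1.
    by apply: fI => t; rewrite expr1n mul1r addrC.
  have i3 : 1 <= \int[@lebesgue_measure R]_(x in `[-1, 1]) (1 / (1 ^+ 2 + x ^+ 2)).
    by apply: int1 => t; rewrite expr1n mul1r.
  have i4 : \int[@lebesgue_measure R]_(x in `[-1, 1]) (-1 / ((-1) ^+ 2 + x ^+ 2)) <= - 1.
    by apply: fI => t; rewrite sqrrN expr1n mulN1r.
  have aux (a b c d : R) : 1 <= a -> b <= - 1 -> 1 <= c -> d <= - 1 -> 0 < a - b + (c - d) by lra.
  by rewrite mul0r add0r mul1r; exact: aux.
by apply: contraTneq => ->; rewrite /= ltxx.
Qed.

(** Cauchy's formula for the coefficients of [h] at 0, normalised by [oint_inv]. *)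
Definition taylor h (m : nat) : C := oint_inv^-1 * oint (fun z => h z * z^-1 ^+ m.+1).

Lemma taylor_rect h m x1 x2 y1 y2 : x1 < 0 < x2 -> y1 < 0 < y2 -> entire h ->
  taylor h m = oint_inv^-1 * rect (fun z => h z * z^-1 ^+ m.+1) x1 x2 y1 y2.
Proof.
move=> hx hy hh; rewrite /taylor (oint_rect hx hy)// => z z0.
by apply: holoM; [exact: hh|exact: holo_invX].
Qed.

(* With q z = (h z - h w) / (z - w) one has z^-(m+1) h z = z^-(m+1) h w + z^-m q z - w z^-(m+1) q z,
   so the Taylor sum telescopes, and the first term vanishes because q has a removable singularity. *)
Lemma taylor_remainder h w : entire h -> exists K : R, forall n,
  normc (\sum_(0 <= m < n) taylor h m * w ^+ m - h w) <= K / 2 ^+ n.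
Proof.
move=> hh.
pose q z := (h z - h w) * (z - w)^-1.
have nw := normc_ge0 w.
(* A half side above [2 * normc w] puts [w] inside the contour and makes [normc w / t] at most 1/2,
   the ratio of the geometric bound. *)
have [t t0 wt] : exists2 t, 0 < t & 2 * normc w < t by exists (2 * (normc w + 1)); lra.
have tt : - t < 0 < t by apply/andP; split; lra.
have hole z : z != w -> holo q z.
  move=> zw; apply: holoM; first by apply: holoB; [exact: hh|exact: holo_cst].
  apply: holoV; first by rewrite subr_eq0.
  by apply: holoB; [exact: holo_id|exact: holo_cst].
have Ret := ler_Re_normc w; have Imt := ler_Im_normc w.
have wx : - t < complex.Re w < t by move: Ret; rewrite ler_norml; lra.
have wy : - t < complex.Im w < t by move: Imt; rewrite ler_norml; lra.
have Nt : - t <= t by lra.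
(* Near [w] the difference quotient is bounded by [normc D + 1], by differentiability with tolerance
   1. *)
have bq : rect q (- t) t (- t) t = 0.
  have [D DP] := derivable_normcP (hh w).
  have [d d0 dP] := DP 1 ltr01.
  apply: (@rect_removable _ q w _ _ _ _ (normc D + 1) d) => // z zw zd.
  have zw0 : z - w != 0 by rewrite subr_eq0.
  rewrite /q normcM normcV ler_pdivrMr ?normc_gt0//.
  have := dP z zd; have := le_normcD (h z - h w - D * (z - w)) (D * (z - w)).
  by rewrite subrK normcM; lra.
have bd0 (x y : R) : - t <= x <= t -> - t <= y <= t ->
   [|| x == - t, x == t, y == - t | y == t] -> (t <= normc (x +i* y)).
  move=> xt yt /or4P[] /eqP e.
  - by rewrite (le_trans _ (ler_Re_normc _))//= e normrN gtr0_norm.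
  - by rewrite (le_trans _ (ler_Re_normc _))//= e gtr0_norm.
  - by rewrite (le_trans _ (ler_Im_normc _))//= e normrN gtr0_norm.
  - by rewrite (le_trans _ (ler_Im_normc _))//= e gtr0_norm.
have nzw z : t <= normc z -> z != w by apply: contraTneq => ->; lra.
have nz0 z : t <= normc z -> z != 0 by apply: contraTneq => ->; rewrite normc0; lra.
have bdF F : (forall z, t <= normc z -> holo F z) -> bdcont F (- t) t (- t) t.
  move=> H; split => s st; apply/holo_continuous/H/bd0; rewrite ?lexx ?eqxx ?orbT//=; try lra.
have holX m z : t <= normc z -> holo (fun z => z^-1 ^+ m) z by move=> /nz0; exact: holo_invX.
have holQ m z : t <= normc z -> holo (fun z => q z * z^-1 ^+ m) z.
  by move=> zt; apply: holoM; [exact/hole/nzw|exact: holX].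
pose B m := rect (fun z => q z * z^-1 ^+ m) (- t) t (- t) t.
have rec m : rect (fun z => h z * z^-1 ^+ m.+1) (- t) t (- t) t =
    h w * oint (fun z => z^-1 ^+ m.+1) + (B m - w * B m.+1).
  rewrite (oint_rect tt tt (@holo_invX m.+1)) -mulNr /B.
  rewrite -rectZ; last by apply: bdF => z; exact: holX.
  rewrite -[X in _ + (_ + X)]rectZ; last by apply: bdF => z; exact: holQ.
  have cQ := bdF _ (holQ m).
  have cQ1 : bdcont (fun z => - w * (q z * z^-1 ^+ m.+1)) (- t) t (- t) t.
    by apply: bdF => z zt; apply: holoM; [exact: holo_cst|exact: holQ].
  have cX : bdcont (fun z => h w * z^-1 ^+ m.+1) (- t) t (- t) t.
    by apply: bdF => z zt; apply: holoM; [exact: holo_cst|exact: holX].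
  rewrite -(rectD cQ cQ1) -(rectD cX (bdcontD cQ cQ1)).
  have E z : t <= normc z -> h z * z^-1 ^+ m.+1 =
      h w * z^-1 ^+ m.+1 + (q z * z^-1 ^+ m + - w * (q z * z^-1 ^+ m.+1)).
    move=> zt; have z0 := nz0 _ zt.
    have qE : q z * (z - w) = h z - h w by rewrite /q divfK// subr_eq0 nzw.
    have -> : h z = h w + q z * (z - w) by rewrite qE; ring.
    rewrite exprS; set X := z^-1 ^+ m.
    have -> : q z * X = q z * X * (z * z^-1) by rewrite divff// mulr1.
    by ring.
  by apply: eq_rect => // s st; apply/E/bd0; rewrite ?lexx ?eqxx ?orbT//=; lra.
have [M [M1 M2 M3 M4]] := bdcont_bounded Nt Nt (bdF q (fun z zt => hole z (nzw z zt))).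
have M0 : 0 <= M by apply: le_trans (normc_ge0 _) (M1 0 _); lra.
pose K := 4 * M * (t + t + (t + t)).
have BK n : normc (B n) <= K * t^-1 ^+ n.
  have z1 z : t <= normc z -> normc (z^-1 ^+ n) <= t^-1 ^+ n.
    move=> tz; rewrite normcX normcV.
    have z0 : 0 < normc z by lra.
    by apply: lerXn2r; rewrite ?nnegrE ?invr_ge0 ?lef_pV2// ltW.
  have z2 z : normc (q z) <= M -> t <= normc z -> normc (q z * z^-1 ^+ n) <= M * t^-1 ^+ n.
    by move=> zM zt; rewrite normcM ler_pM ?normc_ge0// z1.
  have := @ler_normc_rect _ (fun z => q z * z^-1 ^+ n) (M * t^-1 ^+ n) (- t) t (- t) t.
  rewrite opprK /K.
  rewrite (_ : _ * _ * (t + t + (t + t)) = 4 * M * (t + t + (t + t)) * t^-1 ^+ n); last by ring.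
  apply; first lra; first lra; first by apply: bdF => z; exact: holQ.
  - by move=> s st; apply: z2; [exact: M1|apply: bd0; rewrite ?lexx ?eqxx ?orbT//=; lra].
  - by move=> s st; apply: z2; [exact: M2|apply: bd0; rewrite ?lexx ?eqxx ?orbT//=; lra].
  - by move=> s st; apply: z2; [exact: M3|apply: bd0; rewrite ?lexx ?eqxx ?orbT//=; lra].
  - by move=> s st; apply: z2; [exact: M4|apply: bd0; rewrite ?lexx ?eqxx ?orbT//=; lra].
have tel n : \sum_(0 <= m < n.+1) taylor h m * w ^+ m - h w =
    - (oint_inv^-1 * (B n.+1 * w ^+ n.+1)).
  elim: n => [|n IH].
    rewrite big_nat1 (taylor_rect _ tt tt hh) rec -/oint_inv.
    have -> : B 0%N = 0.
      rewrite /B (_ : (fun z => q z * z^-1 ^+ 0) = q) ?bq//.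
      by apply/funext => z; rewrite expr0 mulr1.
    rewrite expr0 mulr1 expr1 mulrDr mulrCA mulVf ?oint_inv_neq0//; ring.
  rewrite big_nat_recr//= addrAC IH (taylor_rect _ tt tt hh) rec oint_invX.
  by rewrite (exprS w n.+1); ring.
(* The summand [normc (h w)] is there for [n = 0], when the Taylor sum is empty and the telescoped
   formula does not apply. *)
exists (normc oint_inv^-1 * K + normc (h w)) => n.
have K0 : 0 <= K by rewrite /K !mulr_ge0//; lra.
case: n => [|n].
  by rewrite big_geq// sub0r normcN expr0 divr1 lerDr mulr_ge0// normc_ge0.
rewrite tel normcN !normcM.
have wn : (t^-1 * normc w) ^+ n.+1 <= 2^-1 ^+ n.+1.
  rewrite ler_pXn2r ?nnegrE ?invr_ge0//; last first.
    by rewrite mulr_ge0// invr_ge0 ltW.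
  by rewrite mulrC ler_pdivrMr//; lra.
rewrite normcX mulrDl.
apply: (@le_trans _ _ (normc oint_inv^-1 * K / 2 ^+ n.+1)); last first.
  by rewrite lerDl divr_ge0// normc_ge0.
rewrite -mulrA ler_wpM2l ?normc_ge0//.
apply: (@le_trans _ _ (K * t^-1 ^+ n.+1 * normc w ^+ n.+1)).
  by rewrite ler_wpM2r// exprn_ge0.
by rewrite -mulrA -exprMn -exprVn ler_wpM2l.
Qed.

End PowerSeries.

(** * Bounds in the Fock space *)

Section PlaneMeasurable.
Variable R : realType.
Local Notation C := R[i].
Local Notation mR := (measurableTypeR R).
Local Notation plane := (mR * mR)%type.
Local Notation mu := (@lebesgue_measure R).

(** The plane carries the product sigma-algebra, whereas openness refers to the product topology;
    the two are linked by writing an open set as a countable union of boxes with rational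
    corners. *)
Lemma open_measurable_plane (U : set (R * R)) : open U -> measurable (U : set plane).
Proof.
move=> oU.
pose box (q : rat * rat * (rat * rat)) : set plane :=
  `]ratr q.1.1, ratr q.1.2[%classic `*` `]ratr q.2.1, ratr q.2.2[%classic.
(* Boxes that are not inside [U] are replaced by the empty set, so that the index type remains the
   countable type of all rational boxes. *)
have -> : U = \bigcup_q (if pselect (box q `<=` U) then box q else set0).
  apply/seteqP; split => [[x y] Uxy|p [q _]]; last by case: pselect => // qU; exact: qU.
  have [[A B] /= [nA nB] AB] : nbhs (x, y) U by exact: open_nbhs_nbhs.
  have [e e0 eA] : exists2 e : R, 0 < e & forall t, `|x - t| < e -> A t.
    by have /nbhs_ballP[e /= e0 eA] := nA; exists e => // t xt; exact: eA.
  have [f f0 fB] : exists2 e : R, 0 < e & forall t, `|y - t| < e -> B t.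
    by have /nbhs_ballP[f /= f0 fB] := nB; exists f => // t yt; exact: fB.
  have x1 : x - e < x by rewrite ltrBlDr ltrDl.
  have x2 : x < x + e by rewrite ltrDl.
  have y1 : y - f < y by rewrite ltrBlDr ltrDl.
  have y2 : y < y + f by rewrite ltrDl.
  have [q1] := rat_in_itvoo x1; rewrite in_itv/= => /andP[q1P q1P'].
  have [q2] := rat_in_itvoo x2; rewrite in_itv/= => /andP[q2P q2P'].
  have [q3] := rat_in_itvoo y1; rewrite in_itv/= => /andP[q3P q3P'].
  have [q4] := rat_in_itvoo y2; rewrite in_itv/= => /andP[q4P q4P'].
  exists (q1, q2, (q3, q4)) => //; case: pselect => [qU|qU]/=; last first.
    exfalso; apply: qU => -[u v]; rewrite /box/= !in_itv/= => -[/andP[a b] /andP[c d]]; apply: (AB (u, v)); split => /=.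
      by apply: eA; rewrite ltr_norml; apply/andP; split; lra.
    by apply: fB; rewrite ltr_norml; apply/andP; split; lra.
  by rewrite /box/= !in_itv/= q1P' q2P q3P' q4P.
apply: countable_bigcupT_measurable; first exact: countableP.
move=> q; case: pselect => /= [qU|qU]; last exact: measurable0.
by apply: measurableX; exact: measurable_itv.
Qed.

Lemma continuous_measurable_plane (G : R * R -> R) : continuous G ->
  measurable_fun setT (G : plane -> mR).
Proof.
move=> /continuousP cG; apply: (measurability _ (RGenOpens.measurableE R)).
move=> V [W [a [b WE]] <-]; rewrite setTI WE; apply: open_measurable_plane.
exact/cG/interval_open.
Qed.

(** If the bound failed on all of []a, b[], the integral would be at least [2 * S]. The factor 2
    spares strict inequalities between integrals. *)
Lemma good_line (F : mR -> \bar R) (a b S : R) : a < b -> 0 < S ->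
  measurable_fun setT F -> (forall x, 0 <= F x)%E ->
  (\int[mu]_x F x <= S%:E)%E ->
  exists2 x, a < x < b & (F x <= (2 * S / (b - a))%:E)%E.
Proof.
move=> ab S0 mF F0 FS; apply: contrapT => H.
have ba : 0 < b - a by rewrite subr_gt0.
have {}H x : a < x < b -> ((2 * S / (b - a))%:E <= F x)%E.
  by move=> xab; rewrite leNgt; apply/negP => xF; apply: H; exists x => //; exact: ltW.
have : (\int[mu]_(x in `]a, b[) (cst (2 * S / (b - a))%:E x) <= \int[mu]_x F x)%E.
  apply: (@le_trans _ _ (\int[mu]_(x in `]a, b[) F x)%E).
    apply: ge0_le_integral => //.
    - by move=> x _; rewrite lee_fin divr_ge0// ?(ltW ba)// mulr_ge0// ltW.
    - exact: measurable_funTS.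
  by apply: ge0_subset_integral => //.
rewrite integral_cst//= lebesgue_measure_itv/= lte_fin ab -EFinD -EFinM.
move=> /le_trans/(_ FS); rewrite lee_fin divfK ?gt_eqF//; lra.
Qed.

(** By Tonelli, the integrals of [G] over vertical lines form a measurable function of [x] whose
    integral is at most [S], to which [good_line] applies. *)
Lemma good_vline (G : R * R -> R) (a b S : R) : a < b -> 0 < S ->
  continuous G -> (forall p, 0 <= G p) -> (\int[area R]_p (G p)%:E <= S%:E)%E ->
  exists2 x, a < x < b & (\int[mu]_y (G (x, y))%:E <= (2 * S / (b - a))%:E)%E.
Proof.
move=> ab S0 cG G0 GS.
have mG : measurable_fun setT (EFin \o (G : plane -> mR)).
  by apply/measurable_EFinP; exact: continuous_measurable_plane.
have G0' (p : plane) : (0 <= (EFin \o G) p)%E by rewrite lee_fin.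
apply: (good_line ab S0 (F := fun x => \int[mu]_y (G (x, y))%:E)%E) => //.
- exact: (measurable_fun_fubini_tonelli_F (EFin \o (G : plane -> R))).
- by move=> x; apply: integral_ge0 => y _; rewrite lee_fin.
- by rewrite /area (fubini_tonelli1 (EFin \o (G : plane -> R))) in GS.
Qed.

Lemma good_hline (G : R * R -> R) (a b S : R) : a < b -> 0 < S ->
  continuous G -> (forall p, 0 <= G p) -> (\int[area R]_p (G p)%:E <= S%:E)%E ->
  exists2 y, a < y < b & (\int[mu]_x (G (x, y))%:E <= (2 * S / (b - a))%:E)%E.
Proof.
move=> ab S0 cG G0 GS.
have mG : measurable_fun setT (EFin \o (G : plane -> mR)).
  by apply/measurable_EFinP; exact: continuous_measurable_plane.
have G0' (p : plane) : (0 <= (EFin \o G) p)%E by rewrite lee_fin.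
apply: (good_line ab S0 (F := fun y => \int[mu]_x (G (x, y))%:E)%E) => //.
- exact: (measurable_fun_fubini_tonelli_G (EFin \o (G : plane -> R))).
- by move=> x; apply: integral_ge0 => y _; rewrite lee_fin.
- by rewrite /area (fubini_tonelli2 (EFin \o (G : plane -> R))) in GS.
Qed.

Lemma le_Rintegral_line (g : R -> R) (a b S : R) :
  continuous g -> (forall x, 0 <= g x) ->
  (\int[mu]_x (g x)%:E <= S%:E)%E -> \int[mu]_(x in `[a, b]) g x <= S.
Proof.
move=> cg g0 gS.
have mg : measurable_fun setT (EFin \o (g : mR -> mR)).
  by apply/measurable_EFinP; exact: continuous_measurable_fun.
have h : (\int[mu]_(x in `[a, b]) (g x)%:E <= S%:E)%E.
  apply: le_trans gS; apply: ge0_subset_integral => //.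
  by move=> x _; rewrite lee_fin.
have h0 : (0 <= \int[mu]_(x in `[a, b]) (g x)%:E)%E.
  by apply: integral_ge0 => x _; rewrite lee_fin.
rewrite /Rintegral -lee_fin fineK// ge0_fin_numE//.
by rewrite (le_lt_trans h)// ltry.
Qed.

Lemma ler_normc_seg_line (F : R -> C) (g : R -> R) (a b A E S : R) :
  a <= b -> 0 <= E -> cont_on F a b -> continuous g -> (forall x, 0 <= g x) ->
  (\int[mu]_x (g x)%:E <= S%:E)%E ->
  (forall t, a <= t <= b -> normc (F t) <= A + E * g t) ->
  normc (seg F a b) <= 2 * (A * (b - a) + E * S).
Proof.
move=> ab E0 cF cg g0 gS Fg.
have ig : mu.-integrable `[a, b] (EFin \o g) by apply: cont_integrable => t _; exact: cg.
have ic : mu.-integrable `[a, b] (EFin \o cst A).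
  by apply: cont_integrable => t _; exact: cst_continuous.
have iE : mu.-integrable `[a, b] (EFin \o (fun t => E * g t)).
  by apply: (eq_integrable _ _ _ _ (integrableZl _ E ig)).
have iS : mu.-integrable `[a, b] (EFin \o (fun t => A + E * g t)).
  by apply: (eq_integrable _ _ _ _ (integrableD _ ic iE)).
rewrite (le_trans (ler_normc_seg cF iS Fg))// ler_pM2l//.
rewrite (RintegralD _ ic iE)//= RintegralZl// Rintegral_cst//= lebesgue_measure_itv/= lte_fin.
apply: lerD; last by rewrite ler_wpM2l// le_Rintegral_line.
case: ltP => // ba.
by rewrite (@le_anti _ _ a b) ?ab// subrr.
Qed.

End PlaneMeasurable.

(** * Cauchy estimates from the Fock norm *)

Section FockBound.
Variable R : realType.
Local Notation C := R[i].
Local Notation mu := (@lebesgue_measure R).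

Lemma continuous_pairl (x : R) : continuous (fun y : R => (x, y)).
Proof.
move=> y; apply: (@cvg_pair _ _ _ (nbhs y) (nbhs x) (nbhs y) (nbhs_filter y) _ _ (cst x) id).
  exact: cvg_cst.
exact: cvg_id.
Qed.

Lemma continuous_pairr (y : R) : continuous (fun x : R => (x, y)).
Proof.
move=> x; apply: (@cvg_pair _ _ _ (nbhs x) (nbhs x) (nbhs y) (nbhs_filter x) _ _ id (cst y)).
  exact: cvg_id.
exact: cvg_cst.
Qed.

Lemma continuous_gauss_weight : continuous (@gauss_weight R : R * R -> R).
Proof.
move=> p; rewrite /gauss_weight.
apply: (@continuous_comp _ _ _ (fun p : R * R => - (p.1 ^+ 2 + p.2 ^+ 2)) expR); last exact: continuous_expR.
apply: continuousN; apply: continuousD.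
- by apply: (@continuous_comp _ _ _ fst (fun x : R => x ^+ 2)); [exact: cvg_fst|exact: exprn_continuous].
- by apply: (@continuous_comp _ _ _ snd (fun x : R => x ^+ 2)); [exact: cvg_snd|exact: exprn_continuous].
Qed.

Definition fock_density (h : C -> C) (p : R * R) : R :=
  normc (h (complex_of_pair p)) ^+ 2 * gauss_weight p.

Lemma gauss_weight_ge0 (p : R * R) : 0 <= gauss_weight p.
Proof. exact: expR_ge0. Qed.

Lemma fock_density_ge0 h p : 0 <= fock_density h p.
Proof. by rewrite mulr_ge0 ?sqr_ge0 ?gauss_weight_ge0. Qed.

Lemma continuous_comp_pair (h : C -> C) : continuous (h : C^o -> C^o) ->
  continuous (fun p : R * R => h (complex_of_pair p) : C^o).
Proof.
move=> ch p; apply: (@continuous_comp _ _ _ (fun p : R * R => complex_of_pair p : C^o)).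
  exact: continuous_complex_of_pair.
exact: ch.
Qed.

Lemma continuous_fock_density h : continuous (h : C^o -> C^o) -> continuous (fock_density h).
Proof.
move=> ch p; apply: (@continuousM R _ (fun p => normc (h (complex_of_pair p)) ^+ 2)); last exact: continuous_gauss_weight.
apply: (@continuous_comp _ _ _ (fun p : R * R => normc (h (complex_of_pair p))) (fun x : R => x ^+ 2)); last exact: exprn_continuous.
apply: (@continuous_comp _ _ _ (fun p : R * R => h (complex_of_pair p) : C^o)).
  exact: continuous_comp_pair.
exact: continuous_normc.
Qed.

Lemma fock_norm2_le h (S : R) : (fock_norm2 h <= S%:E)%E ->
  (\int[area R]_p (fock_density h p)%:E <= (pi * S)%:E)%E.
Proof.
rewrite /fock_norm2 -/(fock_density h) => hS.
set I := (\int[_]_p _)%E.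
have -> : I = (pi%:E * ((pi^-1)%:E * I))%E.
  by rewrite muleA -EFinM mulfV ?gt_eqF ?pi_gt0// mul1e.
by rewrite EFinM lee_wpmul2l// lee_fin pi_ge0.
Qed.

(* Cauchy's formula on a rectangle whose four sides are chosen, by Tonelli, to carry little mass of
   the Fock density; [n <= lam + n^2 / lam] passes from the square of [n = |h z|] to [n] itself. *)
Lemma fock_taylor_bound (T : R) : 0 < T -> exists2 K : R, 0 <= K &
  forall (h : C -> C) (lam : R) m, entire h -> 0 < lam ->
   (fock_norm2 h <= (lam ^+ 2)%:E)%E -> normc (taylor h m) <= K * lam / T ^+ m.
Proof.
move=> T0.
have p0 := @pi_gt0 R.
(* The four sides lie in the square where [|x|] and [|y|] are at most [2 * T], and there the
   Gaussian weight is at least [1 / E]. *)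
pose E := expR (8 * T ^+ 2).
have E0 : 0 < E by exact: expR_gt0.
exists (normc (oint_inv R)^-1 * (8 * (4 * T + E * (2 * pi / T)) / T)).
  by rewrite mulr_ge0 ?normc_ge0// divr_ge0 ?ltW// mulr_gt0// addr_gt0 ?mulr_gt0 ?invr_gt0.
move=> h lam m hh l0 hlam.
have ch : continuous (h : C^o -> C^o) by exact: entire_continuous.
have cG := continuous_fock_density ch.
have GS := fock_norm2_le hlam.
have S0 : 0 < pi * lam ^+ 2 by rewrite mulr_gt0// exprn_gt0.
pose F z := h z * z^-1 ^+ m.+1.
pose A := lam * T^-1 ^+ m.+1.
pose D := E / lam * T^-1 ^+ m.+1.
have Ti : 0 < T^-1 ^+ m.+1 by rewrite exprn_gt0// invr_gt0.
have A0 : 0 < A by rewrite mulr_gt0.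
have D0 : 0 < D by rewrite mulr_gt0// divr_gt0.
(* Bound for one side: its length is at most [4 * T], and [good_line] on an interval of length [T]
   leaves it a mass of at most [2 * (pi * lam ^+ 2) / T]. *)
pose Q := 2 * (A * (4 * T) + D * (2 * (pi * lam ^+ 2) / T)).
have pt x y : - (2 * T) <= x <= 2 * T -> - (2 * T) <= y <= 2 * T -> T <= normc (x +i* y) ->
    normc (F (x +i* y)) <= A + D * fock_density h (x, y).
  move=> hx hy hz; rewrite /F normcM normcX normcV /A /D.
  set n := normc (h _).
  have n0 : 0 <= n by exact: normc_ge0.
  have nle : n <= lam + n ^+ 2 / lam.
    have [nl|ln] := leP n lam.
      by rewrite (le_trans nl)// lerDl divr_ge0 ?sqr_ge0// ltW.
    by apply: ler_wpDl; [exact: ltW|rewrite ler_pdivlMr// expr2 ler_wpM2l// ltW].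
  have wE : 1 <= E * gauss_weight (x, y).
    have sq u : - (2 * T) <= u <= 2 * T -> u ^+ 2 <= 4 * T ^+ 2.
      move=> /andP[u1 u2]; have : 0 <= (u + 2 * T) * (2 * T - u) by rewrite mulr_ge0//; lra.
      by lra.
    have := sq x hx; have := sq y hy.
    by rewrite /E /gauss_weight -expRD -expR0 ler_expR/=; lra.
  have nE : n ^+ 2 <= E * fock_density h (x, y).
    by rewrite /fock_density mulrCA ler_peMr// sqr_ge0.
  have n1 : n <= lam + E / lam * fock_density h (x, y).
    apply: (le_trans nle); rewrite lerD2l [E / lam * _]mulrAC; apply: ler_wpM2r => //.
    by rewrite invr_ge0 ltW.
  have z1 : (normc (x +i* y))^-1 ^+ m.+1 <= T^-1 ^+ m.+1.
    by apply: lerXn2r; rewrite ?nnegrE ?invr_ge0 ?normc_ge0 ?(ltW T0)// lef_pV2// posrE; lra.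
  rewrite [leRHS](_ : _ = (lam + E / lam * fock_density h (x, y)) * T^-1 ^+ m.+1); last by ring.
  by apply: ler_pM => //; rewrite exprn_ge0// invr_ge0 normc_ge0.
have segv x y1 y2 : T <= `|x| -> `|x| <= 2 * T -> - (2 * T) <= y1 -> y1 <= y2 -> y2 <= 2 * T ->
    cont_on (fun t => F (x +i* t)) y1 y2 ->
    (\int[mu]_y (fock_density h (x, y))%:E <= (2 * (pi * lam ^+ 2) / T)%:E)%E ->
    normc (seg (fun t => F (x +i* t)) y1 y2) <= Q.
  move=> Tx xT hy1 hy hy2 cF GI.
  apply: (@le_trans _ _ (2 * (A * (y2 - y1) + D * (2 * (pi * lam ^+ 2) / T)))).
    apply: (ler_normc_seg_line (g := fun y => fock_density h (x, y))) => //; first exact: ltW.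
    - move=> y; apply: (@continuous_comp _ _ _ (fun y => (x, y)) (fock_density h)); last exact: cG.
      exact: continuous_pairl.
    - by move=> y; exact: fock_density_ge0.
    - move=> t tt; apply: pt; first by move: xT; rewrite ler_norml.
        lra.
      exact: le_trans Tx (ler_Re_normc (x +i* t)).
  by rewrite ler_pM2l// lerD2r ler_wpM2l ?(ltW A0)//; lra.
have segh y x1 x2 : T <= `|y| -> `|y| <= 2 * T -> - (2 * T) <= x1 -> x1 <= x2 -> x2 <= 2 * T ->
    cont_on (fun t => F (t +i* y)) x1 x2 ->
    (\int[mu]_x (fock_density h (x, y))%:E <= (2 * (pi * lam ^+ 2) / T)%:E)%E ->
    normc (seg (fun t => F (t +i* y)) x1 x2) <= Q.
  move=> Ty yT hx1 hx hx2 cF GI.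
  apply: (@le_trans _ _ (2 * (A * (x2 - x1) + D * (2 * (pi * lam ^+ 2) / T)))).
    apply: (ler_normc_seg_line (g := fun x => fock_density h (x, y))) => //; first exact: ltW.
    - move=> x; apply: (@continuous_comp _ _ _ (fun x => (x, y)) (fock_density h)); last exact: cG.
      exact: continuous_pairr.
    - by move=> x; exact: fock_density_ge0.
    - move=> t tt; apply: pt; last exact: le_trans Ty (ler_Im_normc (t +i* y)).
        lra.
      by move: yT; rewrite ler_norml.
  by rewrite ler_pM2l// lerD2r ler_wpM2l ?(ltW A0)//; lra.
have L1 : T < 2 * T by lra.
have L2 : - (2 * T) < - T by lra.
have e1 : 2 * T - T = T by ring.
have e2 : - T - (- (2 * T)) = T by ring.
have [x2 /andP[x2a x2b]] := good_vline L1 S0 cG (fock_density_ge0 h) GS.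
have [x1 /andP[x1a x1b]] := good_vline L2 S0 cG (fock_density_ge0 h) GS.
have [y2 /andP[y2a y2b]] := good_hline L1 S0 cG (fock_density_ge0 h) GS.
have [y1 /andP[y1a y1b]] := good_hline L2 S0 cG (fock_density_ge0 h) GS.
rewrite e1 e2 => Iy1 Iy2 Ix1 Ix2.
have pos u : T < u -> 0 < u by exact: lt_trans.
have neg u : u < - T -> u < 0 by move=> uT; rewrite (lt_trans uT)// oppr_lt0.
have abs1 u : T < u -> u < 2 * T -> T <= `|u| /\ `|u| <= 2 * T.
  by move=> u1 u2; rewrite gtr0_norm ?pos//; split; exact: ltW.
have abs2 u : - (2 * T) < u -> u < - T -> T <= `|u| /\ `|u| <= 2 * T.
  by move=> u1 u2; rewrite ltr0_norm ?neg//; split; apply: ltW; [rewrite ltrNr|rewrite ltrNl].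
have hx : x1 < 0 < x2 by rewrite (pos _ x2a) (neg _ x1b).
have hy : y1 < 0 < y2 by rewrite (pos _ y2a) (neg _ y1b).
have x12 : x1 <= x2 by case/andP: hx => u1 u2; apply/ltW/(lt_trans u1).
have y12 : y1 <= y2 by case/andP: hy => u1 u2; apply/ltW/(lt_trans u1).
have ho z : z != 0 -> holo F z.
  by move=> z0; apply: holoM; [exact: hh|exact: holo_invX].
have [/hcont_on c1 /hcont_on c2 /vcont_on c3 /vcont_on c4] := holo_off0_bdcont hx hy ho.
have [u1 u2] := abs1 _ x2a x2b; have [v1 v2] := abs1 _ y2a y2b.
have [u3 u4] := abs2 _ x1a x1b; have [v3 v4] := abs2 _ y1a y1b.
have rQ : normc (rect F x1 x2 y1 y2) <= 4 * Q.
  apply: ler_normc_rect_segs.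
  - exact: (segh y1 x1 x2 v3 v4 (ltW x1a) x12 (ltW x2b) c1 Iy1).
  - exact: (segh y2 x1 x2 v1 v2 (ltW x1a) x12 (ltW x2b) c2 Iy2).
  - exact: (segv x1 y1 y2 u3 u4 (ltW y1a) y12 (ltW y2b) c3 Ix1).
  - exact: (segv x2 y1 y2 u1 u2 (ltW y1a) y12 (ltW y2b) c4 Ix2).
rewrite (taylor_rect _ hx hy hh) normcM -!mulrA ler_wpM2l ?normc_ge0//.
rewrite (le_trans rQ)// /Q /A /D.
rewrite le_eqVlt; apply/orP; left; apply/eqP.
rewrite exprSr exprVn; set t := T ^+ m.
have t0 : t != 0 by rewrite expf_neq0// gt_eqF.
have T1 : T != 0 by rewrite gt_eqF.
have l1 : lam != 0 by rewrite gt_eqF.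
by field; rewrite ?t0 ?T1 ?l1.
Qed.

End FockBound.

(** * Wirtinger derivatives and double power series *)

Section Wirtinger.
Variable R : realType.
Local Notation C := R[i].

Lemma is_derive_of_estimate (g : R -> R) (x d : R) :
  (forall e, 0 < e -> exists2 r : R, 0 < r & forall s, `|s - x| < r -> `|g s - g x - d * (s - x)| <= e * `|s - x|) ->
  is_derive x 1 g d.
Proof.
move=> H.
have gd : (fun h => h^-1 *: ((g \o shift x) (h *: (1 : R)) - g x)) @ 0^' --> d.
  apply/cvgrPdist_le => e e0; have [r r0 rP] := H e e0.
  near=> h.
  have h0 : h != 0 by near: h; exact: nbhs_dnbhs_neq.
  have hr : `|h| < r.
    by near: h; apply: dnbhs0_lt.
  have := rP (h + x); rewrite addrK => /(_ hr).
  rewrite /= /GRing.scale/= mulr1 => le.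
  rewrite distrC -(ler_pM2r (_ : 0 < `|h|)) ?normr_gt0// -normrM mulrBl.
  rewrite (_ : h^-1 * _ * h = g (h + x) - g x)//.
  by rewrite mulrAC mulVf// mul1r.
by apply: DeriveDef; [apply/cvg_ex; exists d|exact: cvg_lim].
Unshelve. all: by end_near. Qed.

(** Differentiation by components, as in [partial_x] and [partial_y], where real and imaginary parts
    are differentiated separately. *)
Definition is_derive_ReIm (phi : R -> C) (t : R) (D : C) :=
  is_derive t 1 (fun s => complex.Re (phi s)) (complex.Re D) /\
  is_derive t 1 (fun s => complex.Im (phi s)) (complex.Im D).

Lemma is_derive_ReImM phi psi t (D E : C) : is_derive_ReIm phi t D -> is_derive_ReIm psi t E ->
  is_derive_ReIm (fun s => phi s * psi s) t (D * psi t + phi t * E).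
Proof.
move=> [p1 p2] [q1 q2]; split.
  have -> : (fun s => complex.Re (phi s * psi s)) =
      (fun s => complex.Re (phi s)) * (fun s => complex.Re (psi s)) -
      (fun s => complex.Im (phi s)) * (fun s => complex.Im (psi s)).
    by apply/funext => s; rewrite !fctE; case: (phi s) => ? ?; case: (psi s).
  apply: (is_derive_eq (is_deriveB (is_deriveM p1 q1) (is_deriveM p2 q2))); rewrite /GRing.scale/=.
  by case: (phi t) (psi t) D E {p1 p2 q1 q2} => [a b] [a' b'] [d e] [d' e'] /=; ring.
have -> : (fun s => complex.Im (phi s * psi s)) =
    (fun s => complex.Re (phi s)) * (fun s => complex.Im (psi s)) +
    (fun s => complex.Im (phi s)) * (fun s => complex.Re (psi s)).
  by apply/funext => s; rewrite !fctE; case: (phi s) => ? ?; case: (psi s).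
apply: (is_derive_eq (is_deriveD (is_deriveM p1 q2) (is_deriveM p2 q1))); rewrite /GRing.scale/=.
by case: (phi t) (psi t) D E {p1 p2 q1 q2} => [a b] [a' b'] [d e] [d' e'] /=; ring.
Qed.

Lemma is_derive_ReIm_conj phi t (D : C) : is_derive_ReIm phi t D -> is_derive_ReIm (fun s => (phi s)^*%R) t D^*%R.
Proof.
move=> [p1 p2]; rewrite conjE; split.
  have -> : (fun s => complex.Re (phi s)^*%R) = (fun s => complex.Re (phi s)).
    by apply/funext => s; rewrite conjE; case: (phi s).
  by case: D p1 {p2}.
have -> : (fun s => complex.Im (phi s)^*%R) = - (fun s => complex.Im (phi s)).
  by apply/funext => s; rewrite !fctE conjE; case: (phi s).
by apply: (is_derive_eq (is_deriveN p2)); case: D {p1 p2}.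
Qed.

Lemma is_derive_ReIm_real (g : R -> R) (t d : R) : is_derive t 1 g d -> is_derive_ReIm (fun s => (g s)%:C) t d%:C.
Proof. by move=> gd; split => //=; exact: is_derive_cst. Qed.

(* [A] and [B] are the Wirtinger derivatives of [F] at [z]. *)
Definition wirtinger (F : C -> C) (z A B : C) := forall e : R, 0 < e ->
  exists2 r : R, 0 < r & forall w, normc (w - z) < r ->
   normc (F w - F z - A * (w - z) - B * (w - z)^*) <= e * normc (w - z).

Lemma wirtinger_derive_x F z A B : wirtinger F z A B ->
  is_derive_ReIm (fun t => F (t +i* complex.Im z)) (complex.Re z) (A + B).
Proof.
case: z => x y H /=.
have key e : 0 < e -> exists2 r : R, 0 < r & forall s, `|s - x| < r ->
   normc (F (s +i* y) - F (x +i* y) - (A + B) * (s - x)%:C) <= e * `|s - x|.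
  move=> e0; have [r r0 rP] := H e e0; exists r => // s sx.
  have E : (s +i* y) - (x +i* y) = (s - x)%:C :> C.
    by apply/eqP; rewrite eq_complex/= subrr !eqxx.
  have := rP (s +i* y); rewrite E normc_real => /(_ sx).
  rewrite conjE conjc_real.
  by rewrite -addrA -opprD -mulrDl.
split; apply: is_derive_of_estimate => e e0; have [r r0 rP] := key e e0; exists r => // s sx;
  apply: le_trans (rP s sx).
  apply: le_trans (ler_Re_normc _); rewrite le_eqVlt; apply/orP; left; apply/eqP; congr `|_|.
  by case: (F _) (F _) (A + B) => [a b] [a' b'] [c d] /=; ring.
apply: le_trans (ler_Im_normc _); rewrite le_eqVlt; apply/orP; left; apply/eqP; congr `|_|.
by case: (F _) (F _) (A + B) => [a b] [a' b'] [c d] /=; ring.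
Qed.

Lemma wirtinger_derive_y F z A B : wirtinger F z A B ->
  is_derive_ReIm (fun t => F (complex.Re z +i* t)) (complex.Im z) ('i * (A - B)).
Proof.
case: z => x y H /=.
have key e : 0 < e -> exists2 r : R, 0 < r & forall s, `|s - y| < r ->
   normc (F (x +i* s) - F (x +i* y) - ('i * (A - B)) * (s - y)%:C) <= e * `|s - y|.
  move=> e0; have [r r0 rP] := H e e0; exists r => // s sy.
  have E : (x +i* s) - (x +i* y) = 'i * (s - y)%:C :> C.
    by apply/eqP; rewrite eq_complex/=; apply/andP; split; apply/eqP; ring.
  have := rP (x +i* s); rewrite E normcM normc_i mul1r normc_real => /(_ sy).
  rewrite (_ : ('i * (s - y)%:C)^*%R = - ('i * (s - y)%:C)); last first.
    by rewrite conjE; apply/eqP; rewrite eq_complex/=; apply/andP; split; apply/eqP; ring.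
  apply: le_trans; rewrite le_eqVlt; apply/orP; left; apply/eqP; congr normc.
  by ring.
set D := 'i * (A - B) in key *.
split; apply: is_derive_of_estimate => e e0; have [r r0 rP] := key e e0; exists r => // s sx;
  apply: le_trans (rP s sx).
  apply: le_trans (ler_Re_normc _); rewrite le_eqVlt; apply/orP; left; apply/eqP; congr `|_|.
  by case: (F _) (F _) D {key rP} => [a b] [a' b'] [c d] /=; ring.
apply: le_trans (ler_Im_normc _); rewrite le_eqVlt; apply/orP; left; apply/eqP; congr `|_|.
by case: (F _) (F _) D {key rP} => [a b] [a' b'] [c d] /=; ring.
Qed.

Lemma wirtinger_partial F z A B : wirtinger F z A B ->
  partial_x F z = A + B /\ partial_y F z = 'i * (A - B).
Proof.
move=> H; have [x1 x2] := wirtinger_derive_x H; have [y1 y2] := wirtinger_derive_y H.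
rewrite /partial_x /partial_y !derive1E !derive_val.
by split; apply/eqP; rewrite eq_complex/= !eqxx.
Qed.

Lemma wirtinger_d_z F z A B : wirtinger F z A B -> d_z F z = A.
Proof.
move=> /wirtinger_partial[xE yE]; rewrite /d_z xE yE mulrA -expr2 sqr_i mulN1r opprK.
by field.
Qed.

Lemma wirtinger_d_zbar F z A B : wirtinger F z A B -> d_zbar F z = B.
Proof.
move=> /wirtinger_partial[xE yE]; rewrite /d_zbar xE yE mulrA -expr2 sqr_i mulN1r opprB.
by field.
Qed.

Lemma wirtinger_cst (c : C) z : wirtinger (fun=> c) z 0 0.
Proof.
move=> e e0; exists 1 => // w _; rewrite subrr !mul0r !subr0 normc0.
by rewrite mulr_ge0 ?normc_ge0// ltW.
Qed.

Lemma wirtinger_of_sqr F z A B M : (forall w, normc (w - z) < 1 ->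
  normc (F w - F z - A * (w - z) - B * (w - z)^*) <= M * normc (w - z) ^+ 2) -> wirtinger F z A B.
Proof.
move=> H e e0.
have M1 : 0 < `|M| + 1 by rewrite ltr_wpDl.
exists (Num.min 1 (e / (`|M| + 1))); first by rewrite lt_min ltr01 divr_gt0.
move=> w; rewrite lt_min => /andP[w1 we]; rewrite (le_trans (H w w1))//.
rewrite expr2 mulrA ler_wpM2r ?normc_ge0//.
move: we; rewrite ltr_pdivlMr// => we; apply: le_trans (ltW we).
rewrite mulrC ler_wpM2l ?normc_ge0// (le_trans (ler_norm _))// lerDl//.
Qed.

Lemma wirtinger_continuous F z A B : wirtinger F z A B -> {for (z : C^o), continuous (F : C^o -> C^o)}.
Proof.
move=> H; apply/(@cvgc_normP _ _ _ (nbhs_filter (z : C^o))).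
apply/(@cvgrPdist_le _ _ _ _ (nbhs_filter (z : C^o))) => e e0.
have [r r0 rP] := H 1 ltr01.
pose K := 1 + normc A + normc B.
have K0 : 0 < K by rewrite /K -addrA ltr_wpDr ?addr_ge0 ?normc_ge0.
apply/nbhs_normcP; exists (Num.min r (e / K)); first by rewrite lt_min r0 divr_gt0.
move=> w; rewrite lt_min => /andP[wr we].
rewrite sub0r normrN ger0_norm ?normc_ge0//.
move: we; rewrite ltr_pdivlMr// => /ltW; apply: le_trans; rewrite mulrC.
have h0 := rP w wr.
have h1 := le_normcD (F w - F z - A * (w - z) - B * (w - z)^*) (A * (w - z) + B * (w - z)^*).
rewrite (_ : F w - F z - A * (w - z) - B * (w - z)^* + (A * (w - z) + B * (w - z)^*) = F w - F z) in h1; last by ring.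
have h2 := le_normcD (A * (w - z)) (B * (w - z)^*).
rewrite !normcM normc_conj in h2.
by rewrite /K !mulrDl; lra.
Qed.

End Wirtinger.

(** * Double power series in [z] and its conjugate *)

Section Expansion.
Variable R : realType.
Local Notation C := R[i].
Implicit Types (a b : nat -> nat -> C) (z w : C) (f : C -> C).

Lemma cvgc_le (u : nat -> C) (l : C) (c : R) :
  ((fun n => u n : C^o) @ \oo --> (l : C^o)) -> (forall n, normc (u n) <= c) -> normc l <= c.
Proof.
move=> /cvgc_normP/cvgrPdist_lt ul uc; apply/ler_addgt0Pr => e e0.
have [n _ /(_ n (leqnn n))] := ul e e0.
rewrite /= sub0r normrN ger0_norm ?normc_ge0// => h.
have := le_normcD (l - u n) (u n); rewrite subrK normcB => h1.
by have := uc n; lra.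
Qed.

Lemma cvgc_unique (u : nat -> C) (l l' : C) :
  ((fun n => u n : C^o) @ \oo --> (l : C^o)) -> ((fun n => u n : C^o) @ \oo --> (l' : C^o)) -> l = l'.
Proof. by move=> ul ul'; exact: (@cvg_unique _ (@norm_hausdorff _ C^o) _ _ _ _ ul ul'). Qed.

Lemma le_succ_exp2 k : (k.+1)%:R <= 2 ^+ k :> R.
Proof. by rewrite -natrX ler_nat ltn_expl. Qed.

Lemma geo_half_sum (K : R) n : 0 <= K -> \sum_(0 <= k < n) K / 2 ^+ k <= 2 * K.
Proof.
move=> K0.
suff -> : \sum_(0 <= k < n) K / 2 ^+ k = 2 * K - 2 * K / 2 ^+ n.
  by rewrite gerBl divr_ge0// mulr_ge0.
elim: n => [|n IH]; first by rewrite big_geq// expr0 divr1 subrr.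
by rewrite big_nat_recr//= IH exprS; have n2 : (2 : R) ^+ n != 0 by [rewrite expf_neq0]; field.
Qed.

Lemma cvgc_geo (u : nat -> C) (K : R) : (forall k, normc (u k) <= K / 2 ^+ k) ->
  exists l : C, series (fun k => u k : C^o) @ \oo --> (l : C^o).
Proof.
move=> uK.
have K0 : 0 <= K by have := uK 0%N; rewrite expr0 divr1; apply: le_trans; exact: normc_ge0.
have key (v : nat -> R) : (forall k, `|v k| <= normc (u k)) -> cvgn (series v).
  move=> vu; apply: normed_cvg; apply: nondecreasing_is_cvgn.
    by apply/nondecreasing_seqP => n; rewrite /normed_series_of seriesSr lerDl normr_ge0.
  exists (2 * K) => _ [n _ <-]; apply: le_trans (geo_half_sum n K0).
  by rewrite /normed_series_of /series/=; apply: ler_sum => k _; exact: le_trans (vu k) (uK k).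
have c1 : cvgn (series (fun k => complex.Re (u k))) by apply: key => k; exact: ler_Re_normc.
have c2 : cvgn (series (fun k => complex.Im (u k))) by apply: key => k; exact: ler_Im_normc.
exists (limn (series (fun k => complex.Re (u k))) +i* limn (series (fun k => complex.Im (u k)))).
rewrite (_ : series (fun k => u k : C^o) = fun n =>
  series (fun k => complex.Re (u k)) n +i* series (fun k => complex.Im (u k)) n); first exact: cvgc_ReIm.
apply/funext => n; apply/eqP; rewrite eq_complex /series/=.
by rewrite (raddf_sum (@complex.Re R)) (raddf_sum (@complex.Im R)) !eqxx.
Qed.

(* The double series [sum a n m * z^* ^n * z^m] is summed along the diagonals [n + m = k], so that
   d_z and d_zbar turn the partial sum of order [k + 1] into one of order [k]. *)
Definition diag a k z : C := \sum_(i < k.+1) a i (k - i)%N * (z^* ^+ i * z ^+ (k - i)).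

Definition expands a f := forall z, series (fun k => diag a k z : C^o) @ \oo --> (f z : C^o).

(** Infinite radius of convergence in both variables. As [T] is arbitrary, a proof at radius [rho]
    may take [T] to be a multiple of [rho] and spend the surplus on numbers of terms and polynomial
    factors. *)
Definition rapid_decay a := forall T : R, 0 < T ->
  exists2 K, 0 <= K & forall n m, normc (a n m) <= K / T ^+ (n + m).

Lemma normc_diag a k z (M : R) : (forall i, (i <= k)%N -> normc (a i (k - i)%N) <= M) ->
  normc (diag a k z) <= k.+1%:R * M * normc z ^+ k.
Proof.
move=> aM; rewrite (le_trans (ler_normc_sum _ _ _))//.
apply: (@le_trans _ _ (\sum_(i < k.+1) M * normc z ^+ k)).
  apply: ler_sum => i _.
  have ik : (i <= k)%N by rewrite -ltnS.
  have e : normc (z^* ^+ i * z ^+ (k - i)) = normc z ^+ k.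
    by rewrite normcM 2!normcX normc_conj -exprD subnKC.
  rewrite normcM e.
  by rewrite ler_wpM2r ?exprn_ge0 ?normc_ge0// aM// -ltnS.
by rewrite sumr_const card_ord -[leLHS]mulr_natl mulrA.
Qed.

(** Decay at [T = 4 * rho] leaves [4^-k]; the [k + 1] terms of the diagonal, at most [2^k], use up
    half of the exponent. *)
Lemma diag_bound a (rho : R) : rapid_decay a -> 0 < rho -> exists2 K : R, 0 <= K &
  forall k z, normc z <= rho -> normc (diag a k z) <= K / 2 ^+ k.
Proof.
move=> ga r0; have [|K K0 aK] := ga (4 * rho); first by rewrite mulr_gt0.
exists K => // k z zr.
rewrite (le_trans (@normc_diag _ _ _ (K / (4 * rho) ^+ k) _))//.
  by move=> i ik; have := aK i (k - i)%N; rewrite subnKC.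
have zk : normc z ^+ k <= rho ^+ k by apply: lerXn2r; rewrite ?nnegrE ?normc_ge0// ltW.
have rk : 0 < rho ^+ k by rewrite exprn_gt0.
have k2 := le_succ_exp2 k.
have p0 : 0 <= K / (4 * rho) ^+ k by rewrite divr_ge0// exprn_ge0// mulr_ge0// ltW.
apply: (@le_trans _ _ (2 ^+ k * (K / (4 * rho) ^+ k) * rho ^+ k)).
  apply: ler_pM => //; first by rewrite mulr_ge0.
    by rewrite exprn_ge0// normc_ge0.
  by rewrite ler_wpM2r.
rewrite le_eqVlt; apply/orP; left; apply/eqP.
have -> : (4 : R) = 2 * 2 by ring.
rewrite !exprMn; set t := 2 ^+ k; have t0 : t != 0 by rewrite expf_neq0.
by field; rewrite t0 gt_eqF.
Qed.

Definition dz_coef a n m : C := m.+1%:R * a n m.+1.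
Definition dzb_coef a n m : C := n.+1%:R * a n.+1 m.

(** Decay at [2 * T] absorbs the factor [m + 1], which is at most [2^m]. *)
Lemma rapid_decay_dz a : rapid_decay a -> rapid_decay (dz_coef a).
Proof.
move=> ga T T0; have [|K K0 aK] := ga (2 * T); first by rewrite mulr_gt0.
exists (K / (2 * T)); first by rewrite divr_ge0// mulr_ge0// ltW.
move=> n m; rewrite /dz_coef normcM normc_nat.
have m2 : (m.+1)%:R <= 2 ^+ (n + m) :> R.
  by rewrite (le_trans (le_succ_exp2 m))// ler_eXn2l ?leq_addl// ltr1n.
apply: (@le_trans _ _ (2 ^+ (n + m) * (K / (2 * T) ^+ (n + m.+1)))).
  by apply: ler_pM; rewrite ?normc_ge0.
rewrite addnS exprS exprMn le_eqVlt; apply/orP; left; apply/eqP.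
set t := 2 ^+ (n + m); have t0 : t != 0 by rewrite expf_neq0.
set s := T ^+ (n + m); have s0 : s != 0 by rewrite expf_neq0// gt_eqF.
by field; rewrite t0 s0 gt_eqF.
Qed.

Lemma rapid_decay_dzb a : rapid_decay a -> rapid_decay (dzb_coef a).
Proof.
move=> ga; have := @rapid_decay_dz (fun n m => a m n).
have tr b : rapid_decay b -> rapid_decay (fun n m => b m n).
  move=> gb T T0; have [K K0 bK] := gb T T0; exists K => // n m.
  by rewrite addnC; exact: bK.
by move=> /(_ (tr _ ga))/tr.
Qed.

(** Both bounds go through one induction because the second at [n + 1] uses the first at [n]. With
    [1 <= rho] all lower powers of [rho] are rounded up to [rho^n], which keeps the constants
    uniform. *)
Lemma pow_est (rho : R) (x y : C) n : 1 <= rho -> normc x <= rho -> normc y <= rho ->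
  normc (x ^+ n - y ^+ n) <= n%:R * rho ^+ n * normc (x - y) /\
  normc (x ^+ n - y ^+ n - n%:R * y ^+ n.-1 * (x - y)) <= n%:R ^+ 2 * rho ^+ n * normc (x - y) ^+ 2.
Proof.
move=> r1 xr yr; have r0 : 0 <= rho by lra.
have d0 := normc_ge0 (x - y).
elim: n => [|n [IH1 IH2]]; first by rewrite !expr0 subrr !mul0r subrr normc0 expr2 !mul0r.
have yn : normc (y ^+ n) <= rho ^+ n by rewrite normcX; apply: lerXn2r; rewrite ?nnegrE ?normc_ge0.
have rn0 : 0 <= rho ^+ n by rewrite exprn_ge0.
have rn : rho ^+ n <= rho * rho ^+ n by rewrite ler_peMl.
have n0 : 0 <= n%:R :> R by [].
split.
  have -> : x ^+ n.+1 - y ^+ n.+1 = x * (x ^+ n - y ^+ n) + (x - y) * y ^+ n.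
    by rewrite !exprS; ring.
  rewrite (le_trans (le_normcD _ _))// !normcM.
  apply: (@le_trans _ _ (rho * (n%:R * rho ^+ n * normc (x - y)) + normc (x - y) * (rho * rho ^+ n))).
    apply: lerD; first by apply: ler_pM; rewrite ?normc_ge0.
    by rewrite ler_wpM2l// (le_trans yn).
  by rewrite -[n.+1]addn1 natrD exprD expr1 le_eqVlt; apply/orP; left; apply/eqP; ring.
have -> : x ^+ n.+1 - y ^+ n.+1 - n.+1%:R * y ^+ n * (x - y) =
    y * (x ^+ n - y ^+ n - n%:R * y ^+ n.-1 * (x - y)) + (x - y) * (x ^+ n - y ^+ n).
  case: n {IH1 IH2 yn rn0 rn n0} => [|n]; first by rewrite !expr0 !expr1; ring.
  rewrite -[n.+2]addn1 natrD /= !exprD !expr1 !exprS.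
  by ring.
rewrite (le_trans (le_normcD _ _))// !normcM.
apply: (@le_trans _ _ (rho * (n%:R ^+ 2 * rho ^+ n * normc (x - y) ^+ 2) +
    normc (x - y) * (n%:R * (rho * rho ^+ n) * normc (x - y)))).
  apply: lerD; first by apply: ler_pM; rewrite ?normc_ge0.
  by rewrite ler_wpM2l// (le_trans IH1)// ler_wpM2r// ler_wpM2l.
rewrite -[n.+1]addn1 natrD exprD expr1.
set N := n%:R in n0 *; set s := rho ^+ n in rn0 rn *; set d := normc _ in d0 *.
have : 0 <= (N + 1) * (rho * s) * d ^+ 2 by rewrite !mulr_ge0 ?exprn_ge0// addr_ge0.
have -> : (N + 1) ^+ 2 * (s * rho) * d ^+ 2 =
  rho * (N ^+ 2 * s * d ^+ 2) + d * (N * (rho * s) * d) + (N + 1) * (rho * s) * d ^+ 2 by ring.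
by rewrite lerDl.
Qed.

(** The remainder of a product is each factor times the remainder of the other, plus the product of
    the increments; the constants add up to [i^2 + j^2 + i * j], at most [(i + j)^2]. *)
Lemma mono_est (rho : R) (z w : C) i j : 1 <= rho -> normc z <= rho -> normc w <= rho ->
  normc (w^* ^+ i * w ^+ j - z^* ^+ i * z ^+ j - (z^* ^+ i * (j%:R * z ^+ j.-1)) * (w - z)
    - (i%:R * z^* ^+ i.-1 * z ^+ j) * (w - z)^*) <= (i + j)%:R ^+ 2 * rho ^+ (i + j) * normc (w - z) ^+ 2.
Proof.
move=> r1 zr wr; have r0 : 0 <= rho by lra.
have [V1 V2] := pow_est j r1 wr zr.
have cr u : normc u <= rho -> normc (u^*)%R <= rho by rewrite normc_conj.
have [U1 U2] := pow_est i r1 (cr _ wr) (cr _ zr).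
rewrite -!rmorphB normc_conj in U1 U2.
have Uz : normc (z^* ^+ i) <= rho ^+ i by rewrite normcX normc_conj; apply: lerXn2r; rewrite ?nnegrE ?normc_ge0.
have Vz : normc (z ^+ j) <= rho ^+ j by rewrite normcX; apply: lerXn2r; rewrite ?nnegrE ?normc_ge0.
set RV := w ^+ j - z ^+ j - _ in V2.
set RU := w^* ^+ i - z^* ^+ i - _ in U2.
set dV := w ^+ j - z ^+ j in V1; set dU := w^* ^+ i - z^* ^+ i in U1.
rewrite (_ : _ - _ = z^* ^+ i * RV + z ^+ j * RU + dU * dV); last first.
  by rewrite /RV /RU /dU /dV; ring.
set d := normc (w - z) in V1 V2 U1 U2 *.
have d0 : 0 <= d by exact: normc_ge0.
rewrite (le_trans (le_normcD _ _))//.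
apply: (@le_trans _ _ (rho ^+ i * (j%:R ^+ 2 * rho ^+ j * d ^+ 2) + rho ^+ j * (i%:R ^+ 2 * rho ^+ i * d ^+ 2)
   + (i%:R * rho ^+ i * d) * (j%:R * rho ^+ j * d))).
  rewrite lerD//; last by rewrite normcM; apply: ler_pM; rewrite ?normc_ge0.
  by rewrite (le_trans (le_normcD _ _))// !normcM lerD//; apply: ler_pM; rewrite ?normc_ge0.
rewrite natrD exprD.
have p : 0 <= i%:R * j%:R * (rho ^+ i * rho ^+ j) * d ^+ 2 by rewrite !mulr_ge0 ?exprn_ge0.
by rewrite -subr_ge0; apply: le_trans p _; rewrite le_eqVlt; apply/orP; left; apply/eqP; ring.
Qed.

Lemma diag_dz a k z : \sum_(i < k.+2) a i (k.+1 - i)%N * (z^* ^+ i * ((k.+1 - i)%:R * z ^+ (k.+1 - i).-1)) =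
  diag (dz_coef a) k z.
Proof.
rewrite big_ord_recr/= subnn mul0r !mulr0 addr0.
have aux (x y n v : C) : x * (y * (n * v)) = n * x * (y * v) by ring.
apply: eq_bigr => i _; have ik : (i <= k)%N by rewrite -ltnS.
rewrite /dz_coef (subSn ik); exact: aux.
Qed.

Lemma diag_dzb a k z : \sum_(i < k.+2) a i (k.+1 - i)%N * (i%:R * z^* ^+ i.-1 * z ^+ (k.+1 - i)) =
  diag (dzb_coef a) k z.
Proof.
rewrite big_ord_recl/= !mul0r mulr0 add0r.
have aux (x y n v : C) : x * (n * y * v) = n * x * (y * v) by ring.
apply: eq_bigr => i _; rewrite /dzb_coef -[bump 0 i]/(i.+1) subSS; exact: aux.
Qed.


Lemma series_shift (u v : nat -> C) (l : C) : u 0%N = 0 -> (forall k, u k.+1 = v k) ->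
  series (fun k => v k : C^o) @ \oo --> (l : C^o) -> series (fun k => u k : C^o) @ \oo --> (l : C^o).
Proof.
move=> u0 uv vl; rewrite -(cvg_shiftS (series (fun k => u k : C^o))).
rewrite (_ : [sequence _]_n = series (fun k => v k : C^o))//.
apply/funext => n; rewrite /series/= big_nat_recl// u0 add0r.
by apply: eq_bigr => k _.
Qed.

(** Each monomial has a quadratic remainder by [mono_est]. These bounds are summable over the
    diagonals, so the remainder of the partial sums is quadratic uniformly in their order and stays
    so in the limit. *)
Lemma expands_wirtinger a f z : rapid_decay a -> expands a f ->
  exists A B, [/\ series (fun k => diag (dz_coef a) k z : C^o) @ \oo --> (A : C^o),
    series (fun k => diag (dzb_coef a) k z : C^o) @ \oo --> (B : C^o) & wirtinger f z A B].
Proof.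
move=> ga af.
(* The disc of radius [rho] contains the unit disc around [z], on which the remainder is estimated,
   and [1 <= rho] as [pow_est] demands. *)
pose rho := normc z + 1.
have zr : normc z <= rho by rewrite lerDl.
have r1 : 1 <= rho by rewrite lerDr normc_ge0.
have r0 : 0 < rho by lra.
have [KA _ AK] := diag_bound (rapid_decay_dz ga) r0.
have [KB _ BK] := diag_bound (rapid_decay_dzb ga) r0.
have [A cA] := cvgc_geo (fun k => AK k z zr).
have [B cB] := cvgc_geo (fun k => BK k z zr).
exists A, B; split => //.
pose dA k := \sum_(i < k.+1) a i (k - i)%N * (z^* ^+ i * ((k - i)%:R * z ^+ (k - i).-1)).
pose dB k := \sum_(i < k.+1) a i (k - i)%N * (i%:R * z^* ^+ i.-1 * z ^+ (k - i)).
have cdA : series (fun k => dA k : C^o) @ \oo --> (A : C^o).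
  apply: (series_shift _ _ cA); last by move=> k; exact: diag_dz.
  by rewrite /dA big_ord_recl big_ord0 subnn addr0 mul0r !mulr0.
have cdB : series (fun k => dB k : C^o) @ \oo --> (B : C^o).
  apply: (series_shift _ _ cB); last by move=> k; exact: diag_dzb.
  by rewrite /dB big_ord_recl big_ord0 addr0 !mul0r !mulr0.
(* A diagonal has [k + 1 <= 2^k] terms, each with a factor [k^2 <= 4^k]; against [16^k] this leaves
   [2^-k]. *)
have [|K K0 aK] := ga (16 * rho); first by rewrite mulr_gt0.
apply: (@wirtinger_of_sqr _ _ _ _ _ (2 * K)) => w wz.
have wr : normc w <= rho.
  by have := le_normcD (w - z) z; rewrite subrK /rho; lra.
pose D := w - z.
have term k : normc (diag a k w - diag a k z - dA k * D - dB k * D^*) <= K * normc D ^+ 2 / 2 ^+ k.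
  rewrite /diag /dA /dB !mulr_suml -!sumrB.
  apply: (le_trans (ler_normc_sum _ _ _)).
  apply: (@le_trans _ _ (\sum_(i < k.+1) K / (16 * rho) ^+ k * (k%:R ^+ 2 * rho ^+ k * normc D ^+ 2))).
    apply: ler_sum => i _.
    have ik : (i <= k)%N by rewrite -ltnS.
    have aux (x X Y Z W U V : C) : x * X - x * Y - x * Z * U - x * W * V = x * (X - Y - Z * U - W * V) by ring.
    rewrite aux normcM; apply: ler_pM; [exact: normc_ge0|exact: normc_ge0| |].
      by have := aK i (k - i)%N; rewrite (subnKC ik).
    by have := mono_est i (k - i)%N r1 zr wr; rewrite (subnKC ik).
  rewrite sumr_const card_ord -[leLHS]mulr_natl.
  have k2 := le_succ_exp2 k; have k1 : k%:R <= 2 ^+ k :> R by rewrite (le_trans _ k2)// ler_nat.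
  have k22 : k%:R ^+ 2 <= (2 ^+ k) ^+ 2 :> R by apply: lerXn2r; rewrite ?nnegrE ?exprn_ge0.
  have d2 := sqr_ge0 (normc D).
  have c0 : 0 <= K / (16 * rho) ^+ k by rewrite divr_ge0// exprn_ge0// mulr_ge0// ltW.
  have rk : 0 < rho ^+ k by rewrite exprn_gt0.
  have t0 : 0 < (2 : R) ^+ k by rewrite exprn_gt0.
  apply: (@le_trans _ _ (2 ^+ k * (K / (16 * rho) ^+ k * ((2 ^+ k) ^+ 2 * rho ^+ k * normc D ^+ 2)))).
    apply: ler_pM => //.
      by rewrite mulr_ge0// mulr_ge0// mulr_ge0// ltW.
    by rewrite ler_wpM2l// ler_wpM2r// ler_wpM2r// ltW.
  rewrite le_eqVlt; apply/orP; left; apply/eqP.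
  have -> : (16 : R) = 2 * 2 * (2 * 2) by ring.
  rewrite !exprMn; move: t0 rk; set t := 2 ^+ k; set s := rho ^+ k => t0 s0.
  by field; rewrite !gt_eqF.
pose v N := series (fun k => diag a k w : C^o) N - series (fun k => diag a k z : C^o) N -
  series (fun k => dA k : C^o) N * D - series (fun k => dB k : C^o) N * D^*.
have vl : (fun N => v N : C^o) @ \oo --> (f w - f z - A * D - B * D^* : C^o).
  have e1 : (fun N => series (fun k => dA k : C^o) N * D : C^o) @ \oo --> (A * D : C^o).
    by apply: cvgM; [exact: cdA|exact: cvg_cst].
  have e2 : (fun N => series (fun k => dB k : C^o) N * D^* : C^o) @ \oo --> (B * D^* : C^o).
    by apply: cvgM; [exact: cdB|exact: cvg_cst].
  by apply: cvgB e2; apply: cvgB e1; apply: cvgB; exact: af.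
apply: (cvgc_le vl) => N.
have -> : v N = \sum_(0 <= k < N) (diag a k w - diag a k z - dA k * D - dB k * D^*).
  by rewrite /v /series/= !mulr_suml -!sumrB.
apply: (le_trans (ler_normc_sum _ _ _)).
apply: (@le_trans _ _ (\sum_(0 <= k < N) K * normc D ^+ 2 / 2 ^+ k)).
  by apply: ler_sum => k _; exact: term.
rewrite -mulrA; apply: geo_half_sum.
by rewrite mulr_ge0// sqr_ge0.
Qed.

Lemma expands_dz a f : rapid_decay a -> expands a f -> expands (dz_coef a) (d_z f).
Proof. by move=> ga af z; have [A [B [cA _ /wirtinger_d_z->]]] := expands_wirtinger z ga af. Qed.

Lemma expands_dzb a f : rapid_decay a -> expands a f -> expands (dzb_coef a) (d_zbar f).
Proof. by move=> ga af z; have [A [B [_ cB /wirtinger_d_zbar->]]] := expands_wirtinger z ga af. Qed.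

Lemma diag_at0 a k : diag a k 0 = if k == 0%N then a 0%N 0%N else 0.
Proof.
rewrite /diag; case: k => [|k]; first by rewrite big_ord_recl big_ord0 subnn !expr0 !mulr1 addr0.
rewrite big1// => -[[|i] ik] _.
  by rewrite -[nat_of_ord _]/(0%N) subn0 [0 ^+ k.+1]expr0n /= mulr0 mulr0.
by rewrite rmorph0 -[nat_of_ord _]/(i.+1) [0 ^+ i.+1]expr0n /= mul0r mulr0.
Qed.

(* Repeated differentiation, followed by evaluation at 0, isolates each coefficient. *)
Lemma expands_zero a n m : rapid_decay a -> expands a (fun=> 0) -> a n m = 0.
Proof.
have d0 z : d_z (fun=> 0 : C) z = 0 by exact: wirtinger_d_z (wirtinger_cst 0 z).
have b0 z : d_zbar (fun=> 0 : C) z = 0 by exact: wirtinger_d_zbar (wirtinger_cst 0 z).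
elim: n m a => [|n IHn].
  elim=> [|m IHm] a ga a0.
    apply: (cvgc_unique _ (a0 0)).
    rewrite -(cvg_shiftS (series (fun k => diag a k 0 : C^o))).
    rewrite (_ : [sequence _]_n = fun=> a 0%N 0%N); first exact: cvg_cst.
    apply/funext => N; rewrite /series/= big_nat_recl// diag_at0 big1 ?addr0// => k _.
    by rewrite diag_at0.
  have := IHm _ (rapid_decay_dz ga); rewrite (_ : (fun=> 0) = d_z (fun=> 0 : C)); last exact/esym/funext.
  move=> /(_ (expands_dz ga a0))/eqP; rewrite /dz_coef mulf_eq0 pnatr_eq0/=.
  by move/eqP.
move=> m a ga a0.
have := IHn m _ (rapid_decay_dzb ga); rewrite (_ : (fun=> 0) = d_zbar (fun=> 0 : C)); last exact/esym/funext.
move=> /(_ (expands_dzb ga a0))/eqP; rewrite /dzb_coef mulf_eq0 pnatr_eq0/=.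
by move/eqP.
Qed.

Lemma expands_unique a b f : rapid_decay a -> rapid_decay b -> expands a f -> expands b f ->
  forall n m, a n m = b n m.
Proof.
move=> ga gb af bf n m; apply/eqP; rewrite -subr_eq0; apply/eqP.
apply: (@expands_zero (fun n m => a n m - b n m)).
  move=> T T0; have [K K0 aK] := ga T T0; have [L L0 bL] := gb T T0.
  exists (K + L); first exact: addr_ge0.
  by move=> i j; rewrite (le_trans (le_normcD _ _))// normcN mulrDl lerD.
move=> z.
rewrite (_ : series _ = fun N => series (fun k => diag a k z : C^o) N - series (fun k => diag b k z : C^o) N).
  by rewrite -[0](subrr (f z)); apply: cvgB; [exact: af|exact: bf].
apply/funext => N; rewrite /series/= -sumrB; apply: eq_bigr => k _.
by rewrite /diag -sumrB; apply: eq_bigr => i _; rewrite mulrBl.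
Qed.

End Expansion.

(** * From components to double power series *)

Section FockExpansion.
Variable R : realType.
Local Notation C := R[i].
Implicit Types (a b : nat -> nat -> C) (z w : C) (f h : C -> C) (c : nat -> C -> C).

Lemma cvg_geo0 (K : R) : (fun n => K / 2 ^+ n) @ \oo --> (0 : R).
Proof.
rewrite (_ : (fun n => _) = geometric K 2^-1); last by apply/funext => n; rewrite /= exprVn.
by apply: cvg_geometric; rewrite ger0_norm// invf_lt1// ltr1n.
Qed.

Lemma cvgc_of_geo (u : nat -> C) (l : C) (K : R) : (forall n, normc (u n - l) <= K / 2 ^+ n) ->
  (fun n => u n : C^o) @ \oo --> (l : C^o).
Proof.
move=> uK; apply/cvgc_normP.
apply: (squeeze_cvgr (f := cst 0) (h := fun n => K / 2 ^+ n)).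
- by apply: nearW => n; rewrite normc_ge0 uK.
- exact: cvg_cst.
- exact: cvg_geo0.
Qed.

Lemma cvgc_close (u v : nat -> C) (l : C) (K : R) : (forall n, normc (u n - v n) <= K / 2 ^+ n) ->
  ((fun n => v n : C^o) @ \oo --> (l : C^o)) -> (fun n => u n : C^o) @ \oo --> (l : C^o).
Proof.
move=> uvK vl.
have c0 : (fun n => u n - v n : C^o) @ \oo --> (0 : C^o).
  by apply: (@cvgc_of_geo _ _ K) => n; rewrite subr0.
rewrite (_ : u = fun n => (u n - v n) + v n); last by apply/funext => n; rewrite subrK.
by rewrite -[l]add0r; exact: cvgD c0 vl.
Qed.

Lemma taylor_series h z : entire h -> series (fun m => taylor h m * z ^+ m : C^o) @ \oo --> (h z : C^o).
Proof. by move=> /taylor_remainder-/(_ z)[K hK]; exact: (cvgc_of_geo hK). Qed.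

Lemma fock_norm2_ge0 h : (0 <= fock_norm2 h)%E.
Proof.
rewrite /fock_norm2 mule_ge0 ?lee_fin ?invr_ge0 ?pi_ge0//.
by apply: integral_ge0 => p _; rewrite lee_fin mulr_ge0 ?sqr_ge0 ?expR_ge0.
Qed.

Lemma pow_le_fact (T : R) n : 0 <= T -> T ^+ n / n`!%:R <= expR T.
Proof.
move=> T0; case: n => [|n]; first by rewrite expr0 divr1 -expR0 ler_expR.
by rewrite (le_trans _ (expR_ge1Dxn n T0))// lerDr.
Qed.

(** The square of the left side times [T^(2n)] is [S * (T^2)^n / n!], at most [S * exp (T^2)] by the
    exponential series. *)
Lemma fact_weight_growth (S : R) : 0 < S -> forall T, 0 < T -> exists2 L : R, 0 <= L &
  forall n, Num.sqrt (S / n`!%:R) <= L / T ^+ n.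
Proof.
move=> S0 T T0; exists (Num.sqrt (S * expR (T ^+ 2))) => [|n]; first exact: sqrtr_ge0.
have Tn : 0 < T ^+ n by rewrite exprn_gt0.
have n0 : 0 < n`!%:R :> R by rewrite ltr0n fact_gt0.
have Sn : 0 <= S / n`!%:R by rewrite divr_ge0// ltW.
rewrite ler_pdivlMr//.
have {1}-> : T ^+ n = Num.sqrt ((T ^+ n) ^+ 2) by rewrite sqrtr_sqr gtr0_norm.
rewrite -sqrtrM// ler_sqrt; last by rewrite mulr_ge0 ?expR_ge0// ltW.
rewrite mulrAC -mulrA ler_wpM2l ?(ltW S0)// exprAC.
by apply: pow_le_fact; exact: sqr_ge0.
Qed.

(** Decay in [m] is the Cauchy estimate, whose constant is the same for all components. Decay in [n]
    comes from the norm of the n-th component, at most [sqrt (S / n!)]. *)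
Lemma sfock_taylor_growth f c : sfock_expansion f c -> rapid_decay (fun n m => taylor (c n) m).
Proof.
move=> [ck _ cS].
have u0 n : (0 <= (n`!%:R)%:E * fock_norm2 (c n))%E by rewrite mule_ge0// ?fock_norm2_ge0// lee_fin.
(* Adding 1 makes [S] positive even for the zero function, as the estimate requires a positive
   [lam]. *)
pose S := fine (\sum_(0 <= n <oo) (n`!%:R)%:E * fock_norm2 (c n))%E + 1.
have S1 : (\sum_(0 <= n <oo) (n`!%:R)%:E * fock_norm2 (c n) <= S%:E)%E.
  rewrite /S EFinD fineK; first by rewrite leeDl// lee_fin.
  by rewrite ge0_fin_numE//; apply: nneseries_ge0.
have S0 : 0 < S.
  by rewrite /S ltr_wpDl// fine_ge0//; apply: nneseries_ge0.
have cn n : (fock_norm2 (c n) <= (Num.sqrt (S / n`!%:R) ^+ 2)%:E)%E.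
  have n0 : 0 < n`!%:R :> R by rewrite ltr0n fact_gt0.
  rewrite sqr_sqrtr; last by rewrite divr_ge0// ltW.
  have : ((n`!%:R)%:E * fock_norm2 (c n) <= S%:E)%E.
    apply: le_trans S1; apply: le_trans (nneseries_lim_ge n.+1 _) => //.
    by rewrite big_nat_recr//= leeDr// sume_ge0.
  have [_ +] := ck n; have := fock_norm2_ge0 (c n).
  case: (fock_norm2 (c n)) => // r _ _.
  by rewrite -EFinM !lee_fin ler_pdivlMr// mulrC.
move=> T T0; have [K K0 hK] := fock_taylor_bound T0.
have [L L0 hL] := fact_weight_growth S0 T0.
exists (K * L); first by rewrite mulr_ge0.
move=> n m; have [en _] := ck n.
have l0 : 0 < Num.sqrt (S / n`!%:R) by rewrite sqrtr_gt0 divr_gt0// ltr0n fact_gt0.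
apply: (le_trans (hK _ _ m en l0 (cn n))).
have Tm : T ^+ m != 0 by rewrite expf_neq0// gt_eqF.
have Tn : T ^+ n != 0 by rewrite expf_neq0// gt_eqF.
apply: (@le_trans _ _ (K * (L / T ^+ n) / T ^+ m)).
  apply: ler_wpM2r; first by rewrite invr_ge0 exprn_ge0// ltW.
  by apply: ler_wpM2l => //; exact: hL.
rewrite exprD le_eqVlt; apply/orP; left; apply/eqP.
by move: Tm Tn; set s := T ^+ m; set t := T ^+ n => s0 t0; field; rewrite s0 t0.
Qed.

Lemma tri_sum (g : nat -> nat -> C) N :
  \sum_(0 <= k < N) \sum_(i < k.+1) g i (k - i)%N = \sum_(0 <= n < N) \sum_(0 <= m < N - n) g n m.
Proof.
elim: N => [|N IH]; first by rewrite !big_geq.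
rewrite big_nat_recr//= IH -(big_mkord xpredT (fun i => g i (N - i)%N)).
rewrite !big_nat_recr//= subnn subSnn big_nat1 addrA -big_split/=; congr (_ + _).
rewrite !big_nat; apply: eq_bigr => n /andP[_ nN].
by rewrite subSn ?(ltnW nN)// big_nat_recr.
Qed.

Lemma taylor_tail a n h z (rho K : R) : 0 < rho -> 0 <= K -> normc z <= rho ->
  (forall m, normc (a n m) <= K / (4 * rho) ^+ (n + m)) ->
  series (fun m => a n m * z ^+ m : C^o) @ \oo --> (h z : C^o) ->
  forall M, normc (h z - \sum_(0 <= m < M) a n m * z ^+ m) <= 2 * K / (4 * rho) ^+ n / 4 ^+ M.
Proof.
move=> r0 K0 zr aK hz M.
have r4 : 0 < 4 * rho by rewrite mulr_gt0.
have K1 : 0 <= K / (4 * rho) ^+ n by rewrite divr_ge0// exprn_ge0// ltW.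
have cv : (fun N => \sum_(0 <= m < N) a n (M + m)%N * z ^+ (M + m) : C^o) @ \oo -->
    (h z - \sum_(0 <= m < M) a n m * z ^+ m : C^o).
  rewrite (_ : (fun N => _) = fun N => series (fun m => a n m * z ^+ m : C^o) (N + M)%N -
      \sum_(0 <= m < M) a n m * z ^+ m).
    by apply: cvgB; [rewrite cvg_shiftn; exact: hz|exact: cvg_cst].
  apply/funext => N; rewrite /series/= (@big_cat_nat _ _ _ M 0%N (N + M)%N)/= ?leq_addl//.
  rewrite addrAC subrr add0r -{3}[M]add0n big_addn addnK.
  by apply: eq_bigr => i _; rewrite addnC.
apply: (cvgc_le cv) => N; apply: (le_trans (ler_normc_sum _ _ _)).
apply: (@le_trans _ _ (\sum_(0 <= m < N) (K / (4 * rho) ^+ n / 4 ^+ M) / 2 ^+ m)).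
  apply: ler_sum => m _; rewrite normcM normcX.
  have zm : normc z ^+ (M + m) <= rho ^+ (M + m) by apply: lerXn2r; rewrite ?nnegrE ?normc_ge0// ltW.
  apply: (@le_trans _ _ (K / (4 * rho) ^+ (n + (M + m)) * rho ^+ (M + m))).
    by apply: ler_pM; rewrite ?normc_ge0 ?exprn_ge0 ?normc_ge0.
  have m24 : (4 ^+ m)^-1 <= (2 ^+ m)^-1 :> R.
    rewrite lef_pV2 ?posrE ?exprn_gt0//; apply: lerXn2r; rewrite ?nnegrE//; lra.
  apply: (@le_trans _ _ (K / (4 * rho) ^+ n / 4 ^+ M / 4 ^+ m)); last first.
    by apply: ler_wpM2l => //; rewrite divr_ge0// exprn_ge0.
  rewrite [(4 * rho) ^+ _]exprD [(4 * rho) ^+ (M + m)]exprMn !exprD.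
  have p0 : (4 * rho) ^+ n != 0 by rewrite expf_neq0// gt_eqF.
  have q0 : rho ^+ M != 0 by rewrite expf_neq0// gt_eqF.
  have s0 : rho ^+ m != 0 by rewrite expf_neq0// gt_eqF.
  have t0 : (4 : R) ^+ M != 0 by rewrite expf_neq0.
  have v0 : (4 : R) ^+ m != 0 by rewrite expf_neq0.
  move: p0 q0 s0 t0 v0; set p := (4 * rho) ^+ n; set q := rho ^+ M; set s := rho ^+ m.
  set t := 4 ^+ M; set v := 4 ^+ m => p0 q0 s0 t0 v0.
  by rewrite le_eqVlt; apply/orP; left; apply/eqP; field; rewrite p0 q0 s0 t0 v0.
have := @geo_half_sum R (K / (4 * rho) ^+ n / 4 ^+ M) N.
rewrite divr_ge0 ?exprn_ge0// => /(_ isT) /le_trans; apply.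
by rewrite le_eqVlt; apply/orP; left; apply/eqP; rewrite !mulrA.
Qed.

(** The partial sum of order [N] over diagonals differs from the one over components by the tails of
    [N] rows, the n-th starting at [m = N - n]. By [taylor_tail] each weighted tail is at most
    [2 * K / 4^N], so the difference is at most [2 * K / 2^N], and pointwise convergence of the
    series of components is enough. *)
Lemma expands_of_series a f c : rapid_decay a ->
  (forall n z, series (fun m => a n m * z ^+ m : C^o) @ \oo --> (c n z : C^o)) ->
  (forall z, series (fun n => z^* ^+ n * c n z : C^o) @ \oo --> (f z : C^o)) ->
  expands a f.
Proof.
move=> ga ac cf z.
pose rho := normc z + 1.
have zr : normc z <= rho by rewrite lerDl.
have r0 : 0 < rho by rewrite ltr_wpDl// normc_ge0.
have r4 : 0 < 4 * rho by rewrite mulr_gt0.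
have [K K0 aK] := ga _ r4.
pose s N := series (fun n => z^* ^+ n * c n z : C^o) N.
pose d N := series (fun k => diag a k z : C^o) N.
have sd N : normc (d N - s N) <= 2 * K / 2 ^+ N.
  have -> : d N - s N = - \sum_(0 <= n < N) z^* ^+ n * (c n z - \sum_(0 <= m < N - n) a n m * z ^+ m).
    under [in RHS]eq_bigr do rewrite mulrBr mulr_sumr.
    rewrite sumrB opprB /d /s /series/=; congr (_ - _).
    rewrite /diag (tri_sum (fun n m => a n m * (z^* ^+ n * z ^+ m))).
    by apply: eq_bigr => n _; apply: eq_bigr => m _; rewrite mulrCA.
  rewrite normcN; apply: (le_trans (ler_normc_sum _ _ _)).
  apply: (@le_trans _ _ (\sum_(0 <= n < N) 2 * K / 4 ^+ N)).
    rewrite !big_nat; apply: ler_sum => n /andP[_ nN].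
    rewrite normcM normcX normc_conj.
    have t := taylor_tail r0 K0 zr (aK n) (ac n z) (N - n).
    have zn : normc z ^+ n <= rho ^+ n by apply: lerXn2r; rewrite ?nnegrE ?normc_ge0// ltW.
    apply: (@le_trans _ _ (rho ^+ n * (2 * K / (4 * rho) ^+ n / 4 ^+ (N - n)))).
      by apply: ler_pM; rewrite ?exprn_ge0 ?normc_ge0.
    rewrite -[in leRHS](subnKC (ltnW nN)) exprD exprMn.
    have q0 : rho ^+ n != 0 by rewrite expf_neq0// gt_eqF.
    have t0 : (4 : R) ^+ n != 0 by rewrite expf_neq0.
    have v0 : (4 : R) ^+ (N - n) != 0 by rewrite expf_neq0.
    move: q0 t0 v0 {t}; set q := rho ^+ n; set t := 4 ^+ n; set v := 4 ^+ (N - n) => q0 t0 v0.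
    by rewrite le_eqVlt; apply/orP; left; apply/eqP; field; rewrite q0 t0 v0.
  rewrite sumr_const_nat subn0 -[leLHS]mulr_natl.
  have k1 : N%:R <= 2 ^+ N :> R by rewrite (le_trans _ (le_succ_exp2 R N))// ler_nat.
  apply: (@le_trans _ _ (2 ^+ N * (2 * K / 4 ^+ N))).
    by apply: ler_wpM2r => //; rewrite divr_ge0 ?exprn_ge0// mulr_ge0.
  have -> : (4 : R) = 2 * 2 by ring.
  rewrite exprMn; have t0 : (2 : R) ^+ N != 0 by rewrite expf_neq0.
  move: t0; set t := 2 ^+ N => t0.
  by rewrite le_eqVlt; apply/orP; left; apply/eqP; field; rewrite t0.
exact: (cvgc_close sd (cf z)).
Qed.

Lemma sfock_expands f c : sfock_expansion f c -> expands (fun n m => taylor (c n) m) f.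
Proof.
move=> fc; have [ck cf _] := fc.
apply: (expands_of_series (sfock_taylor_growth fc) _ cf) => n z.
by apply: taylor_series; have [] := ck n.
Qed.

(** Row [n] placed in row 0 of a double series free of the conjugate variable. The component is thus
    itself an instance of [expands], and termwise differentiation applies to it. *)
Definition slice a n : nat -> nat -> C := fun k m => if k == 0%N then a n m else 0.

Lemma rapid_decay_slice a n : rapid_decay a -> rapid_decay (slice a n).
Proof.
move=> ga T T0; have [K K0 aK] := ga T T0.
have Tn : 0 < T ^+ n by rewrite exprn_gt0.
exists (K / T ^+ n); first by rewrite divr_ge0// ltW.
move=> k m; rewrite /slice; case: eqP => [->|_]; last first.
  by rewrite normc0 divr_ge0 ?exprn_ge0 ?divr_ge0// ltW.
by rewrite add0n -mulrA -invfM -exprD.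
Qed.

Lemma diag_slice a n k z : diag (slice a n) k z = a n k * z ^+ k.
Proof.
rewrite /diag big_ord_recl/= subn0 expr0 mul1r big1 ?addr0// => i _.
by rewrite /slice/= mul0r.
Qed.

Lemma expands_slice a n h :
  (forall z, series (fun m => a n m * z ^+ m : C^o) @ \oo --> (h z : C^o)) -> expands (slice a n) h.
Proof.
move=> ah z; rewrite (_ : (fun k => _) = (fun m => a n m * z ^+ m : C^o)); first exact: ah.
by apply/funext => k; exact: diag_slice.
Qed.

End FockExpansion.

(** * Integration by parts on the plane *)

Section PlaneIntegral.
Variable R : realType.
Local Notation C := R[i].
Local Notation mR := (measurableTypeR R).
Local Notation plane := (mR * mR)%type.
Local Notation mu := (@lebesgue_measure R).

Definition box (x1 x2 y1 y2 : R) : set plane := `[x1, x2]%classic `*` `[y1, y2]%classic.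

Lemma measurable_box x1 x2 y1 y2 : measurable (box x1 x2 y1 y2).
Proof. by apply: measurableX; exact: measurable_itv. Qed.

Lemma continuous_integrable_box (G : R * R -> R) x1 x2 y1 y2 : continuous G ->
  (area R).-integrable (box x1 x2 y1 y2) (EFin \o (G : plane -> R)).
Proof.
move=> cG; apply: measurable_bounded_integrable.
- exact: measurable_box.
- rewrite /box (_ : area R _ = (mu `[x1, x2]%classic * mu `[y1, y2]%classic)%E); last first.
    by apply: product_measure1E; exact: measurable_itv.
  rewrite !lebesgue_measure_itv/=.
  by do 2 case: ifP => _; rewrite ?mule0 ?mul0e -?EFinM ?ltry.
- by apply: measurable_funTS; exact: continuous_measurable_plane.
- have cb : compact (box x1 x2 y1 y2 : set (R * R)).
    by apply: compact_setX; exact: segment_compact.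
  have := compact_bounded (continuous_compact (continuous_subspaceT cG) cb).
  move=> [M [Mr HM]]; exists M; split => // N MN p Qp.
  by apply: (HM N MN); exists p.
Qed.

(** Both orders are wanted: in Green's formula the variable of differentiation is integrated
    first. *)
Lemma fubini_box (G : R * R -> R) x1 x2 y1 y2 : continuous G ->
  \int[area R]_(p in box x1 x2 y1 y2) G p =
  \int[mu]_(x in `[x1, x2]) \int[mu]_(y in `[y1, y2]) G (x, y) /\
  \int[area R]_(p in box x1 x2 y1 y2) G p =
  \int[mu]_(y in `[y1, y2]) \int[mu]_(x in `[x1, x2]) G (x, y).
Proof.
move=> cG.
(* Extension by zero outside the box, so that Fubini is used on the whole product. *)
have iG : (mu \x mu)%E.-integrable setT ((EFin \o (G : plane -> R)) \_ (box x1 x2 y1 y2)).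
  apply/integrable_restrict => //; first exact: measurable_box.
  by rewrite setTI; exact: continuous_integrable_box.
have iy x : mu.-integrable `[y1, y2] (EFin \o (fun y => G (x, y))).
  apply: cont_integrable => y _.
  apply: (@continuous_comp _ _ _ (fun y => (x, y)) G); last exact: cG.
  exact: continuous_pairl.
have ix y : mu.-integrable `[x1, x2] (EFin \o (fun x => G (x, y))).
  apply: cont_integrable => x _.
  apply: (@continuous_comp _ _ _ (fun x => (x, y)) G); last exact: cG.
  exact: continuous_pairr.
split.
  rewrite /Rintegral [in LHS]integral_mkcond /area -(integral12_prod_meas1 iG).
  rewrite /fubini_F [in RHS]integral_mkcond; congr fine.
  apply: eq_integral => x _; rewrite patchE; case: ifPn => xx.
    rewrite fineK; last exact: integrable_fin_num (iy x).
    rewrite [RHS]integral_mkcond; apply: eq_integral => y _.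
    rewrite !patchE; congr (if _ then _ else _).
    by rewrite /box in_setX xx.
  rewrite integral0_eq// => y _; rewrite patchE ifF//.
  by rewrite /box in_setX (negbTE xx).
rewrite /Rintegral [in LHS]integral_mkcond /area -(integral21_prod_meas1 iG).
rewrite /fubini_G [in RHS]integral_mkcond; congr fine.
apply: eq_integral => y _; rewrite patchE; case: ifPn => yy.
  rewrite fineK; last exact: integrable_fin_num (ix y).
  rewrite [RHS]integral_mkcond; apply: eq_integral => x _.
  rewrite !patchE; congr (if _ then _ else _).
  by rewrite /box in_setX yy andbT.
rewrite integral0_eq// => x _; rewrite patchE ifF//.
by rewrite /box in_setX (negbTE yy) andbF.
Qed.

Lemma Rintegral_ftc (f F : R -> R) (a b : R) : a < b ->
  (forall x : R, is_derive x 1 F (f x)) -> continuous f ->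
  \int[mu]_(x in `[a, b]) f x = F b - F a.
Proof.
move=> ab dF cf.
have cF x : {for x, continuous F}.
  by apply: differentiable_continuous; apply/derivable1_diffP; have [] := dF x.
rewrite /Rintegral (@continuous_FTC2 _ f F)//.
- exact: continuous_subspaceT.
- split; first by move=> x _; have [] := dF x.
    by apply: cvg_at_right_filter; exact: cF.
  by apply: cvg_at_left_filter; exact: cF.
- by move=> x _; rewrite derive1E; have [] := dF x.
Qed.

(** Dominated convergence with [|G|] as the dominating function. The sets [Q n] need not increase:
    it suffices that each point is eventually in them, which suits boxes chosen independently for
    each [n]. *)
Lemma Rintegral_exhaust (G : plane -> R) (Q : nat -> set plane) (K : R) :
  (area R).-integrable setT (EFin \o G) -> (forall n, measurable (Q n)) ->
  (forall p, \forall n \near \oo, Q n p) ->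
  (forall n, `|\int[area R]_(p in Q n) G p| <= K / n.+1%:R) ->
  \int[area R]_p G p = 0.
Proof.
move=> iG mQ Qp GK.
have mG := measurable_int _ iG.
have h1 n : measurable_fun setT ((EFin \o G) \_ (Q n)).
  apply/measurable_restrict => //.
  by rewrite setTI; exact: measurable_funTS.
have h2 : {ae area R, forall p, setT p -> (fun n => ((EFin \o G) \_ (Q n)) p) @ \oo --> (EFin \o G) p}.
  apply: aeW => p _; apply: cvg_near_cst.
  by have := Qp p; apply: filterS => n Qnp; rewrite patchE mem_set.
have h3 : (area R).-integrable setT (fun p => `|(EFin \o G) p|%E) by exact: integrable_abse.
have h4 : {ae area R, forall p n, setT p -> (`|((EFin \o G) \_ (Q n)) p| <= `|(EFin \o G) p|)%E}.
  by apply: aeW => p n _; rewrite patchE; case: ifP => // _; rewrite abse0.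
have [_ _ cv] := dominated_convergence measurableT h1 mG h2 h3 h4.
have fin : (\int[area R]_p (EFin \o G) p)%E \is a fin_num by exact: integrable_fin_num.
rewrite -(fineK fin) in cv.
have cv1 : (fun n => \int[area R]_(p in Q n) G p) @ \oo --> \int[area R]_p G p.
  rewrite (_ : (fun n => _) = fine \o (fun n => \int[area R]_p ((EFin \o G) \_ (Q n)) p)%E).
    exact: fine_cvg cv.
  by apply/funext => n; rewrite /Rintegral integral_mkcond.
apply/eqP; rewrite -normr_eq0; apply/eqP/le_anti; rewrite normr_ge0 andbT.
have K0 : (fun n => K * harmonic n) @ \oo --> (0 : R).
  by rewrite -(mulr0 K); apply: cvgM; [exact: cvg_cst|exact: cvg_harmonic].
apply: ler_cvg_to (cvg_norm cv1) K0 _.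
by apply: nearW => n; exact: GK.
Qed.

End PlaneIntegral.

(** * The Fock pairing as an area integral *)

Section FockPairing.
Variable R : realType.
Local Notation C := R[i].
Local Notation mR := (measurableTypeR R).
Local Notation plane := (mR * mR)%type.
Local Notation mu := (@lebesgue_measure R).
Implicit Types (u v h k : C -> C).

Lemma cint_exhaust (H : plane -> C) (Q : nat -> set plane) (K : R) :
  cintegrable (area R) setT H -> (forall n, measurable (Q n)) ->
  (forall p, \forall n \near \oo, Q n p) ->
  (forall n, normc (cint (area R) (Q n) H) <= K / n.+1%:R) ->
  cint (area R) setT H = 0.
Proof.
move=> [i1 i2] mQ Qp HK; rewrite /cint.
rewrite (Rintegral_exhaust (K := K) i1 mQ Qp); last first.
  by move=> n; apply: le_trans (HK n); exact: ler_Re_normc (cint (area R) (Q n) H).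
rewrite (Rintegral_exhaust (K := K) i2 mQ Qp)//.
by move=> n; apply: le_trans (HK n); exact: ler_Im_normc (cint (area R) (Q n) H).
Qed.

Definition pcontinuous (X : R * R -> C) := continuous (fun p : R * R => X p : C^o).

Lemma pcontinuous_Re X : pcontinuous X -> continuous (fun p : R * R => complex.Re (X p)).
Proof. by move=> cX p; apply: continuous_comp (cX p) _; exact: continuous_Re. Qed.

Lemma pcontinuous_Im X : pcontinuous X -> continuous (fun p : R * R => complex.Im (X p)).
Proof. by move=> cX p; apply: continuous_comp (cX p) _; exact: continuous_Im. Qed.

Lemma pcontinuousD X Y : pcontinuous X -> pcontinuous Y -> pcontinuous (fun p => X p + Y p).
Proof. by move=> cX cY p; apply: (@cvgD C (C^o) _ _ (nbhs_filter p)); [exact: cX|exact: cY]. Qed.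

Lemma pcontinuousM X Y : pcontinuous X -> pcontinuous Y -> pcontinuous (fun p => X p * Y p).
Proof. by move=> cX cY p; apply: (@cvgM C _ _ (nbhs_filter p)); [exact: cX|exact: cY]. Qed.

Lemma pcontinuous_cst (c : C) : pcontinuous (fun=> c).
Proof. by move=> p; exact: cvg_cst. Qed.

Lemma pcontinuous_ReIm (f g : R * R -> R) : continuous f -> continuous g -> pcontinuous (fun p => f p +i* g p).
Proof. by move=> cf cg p; apply: (@cvgc_ReIm _ _ _ (nbhs_filter p)); [exact: cf|exact: cg]. Qed.

Lemma pcontinuous_conj X : pcontinuous X -> pcontinuous (fun p => (X p)^*%R).
Proof.
move=> cX.
rewrite (_ : (fun p => (X p)^*%R) = fun p => complex.Re (X p) +i* (- complex.Im (X p))).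
  apply: pcontinuous_ReIm; first exact: pcontinuous_Re.
  by move=> p; apply: continuousN; exact: pcontinuous_Im.
by apply/funext => p; rewrite conjE; case: (X p).
Qed.

Lemma pcontinuous_real (f : R * R -> R) : continuous f -> pcontinuous (fun p => (f p)%:C).
Proof. by move=> cf; apply: pcontinuous_ReIm => // p; exact: cvg_cst. Qed.

Lemma pcontinuous_comp h : continuous (h : C^o -> C^o) -> pcontinuous (fun p => h (complex_of_pair p)).
Proof. exact: continuous_comp_pair. Qed.

Lemma cintegrable_box X x1 x2 y1 y2 : pcontinuous X -> cintegrable (area R) (box x1 x2 y1 y2) X.
Proof.
by move=> cX; split; apply: continuous_integrable_box; [exact: pcontinuous_Re|exact: pcontinuous_Im].
Qed.

(** With [cint_box_y], the two halves of Green's formula on a box: Fubini with the differentiated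
    variable innermost, then the fundamental theorem of calculus for each component. *)
Lemma cint_box_x P X x1 x2 y1 y2 : x1 < x2 -> pcontinuous X ->
  (forall x y, is_derive_ReIm (fun x => P (x, y)) x (X (x, y))) ->
  cint (area R) (box x1 x2 y1 y2) X = seg (fun y => P (x2, y) - P (x1, y)) y1 y2.
Proof.
move=> x12 cX PX; rewrite /seg /cint; congr (_ +i* _).
  have [_ ->] := fubini_box x1 x2 y1 y2 (pcontinuous_Re cX).
  apply: eq_Rintegral => y _; rewrite raddfB/=.
  apply: (@Rintegral_ftc _ _ (fun x => complex.Re (P (x, y)))) => //.
    by move=> x; have [] := PX x y.
  move=> x; apply: (@continuous_comp _ _ _ (fun x => (x, y)) (fun p => complex.Re (X p))).
    exact: continuous_pairr.
  exact: pcontinuous_Re.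
have [_ ->] := fubini_box x1 x2 y1 y2 (pcontinuous_Im cX).
apply: eq_Rintegral => y _; rewrite raddfB/=.
apply: (@Rintegral_ftc _ _ (fun x => complex.Im (P (x, y)))) => //.
  by move=> x; have [] := PX x y.
move=> x; apply: (@continuous_comp _ _ _ (fun x => (x, y)) (fun p => complex.Im (X p))).
  exact: continuous_pairr.
exact: pcontinuous_Im.
Qed.

Lemma cint_box_y P X x1 x2 y1 y2 : y1 < y2 -> pcontinuous X ->
  (forall x y, is_derive_ReIm (fun y => P (x, y)) y (X (x, y))) ->
  cint (area R) (box x1 x2 y1 y2) X = seg (fun x => P (x, y2) - P (x, y1)) x1 x2.
Proof.
move=> y12 cX PX; rewrite /seg /cint; congr (_ +i* _).
  have [-> _] := fubini_box x1 x2 y1 y2 (pcontinuous_Re cX).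
  apply: eq_Rintegral => x _; rewrite raddfB/=.
  apply: (@Rintegral_ftc _ _ (fun y => complex.Re (P (x, y)))) => //.
    by move=> y; have [] := PX x y.
  move=> y; apply: (@continuous_comp _ _ _ (fun y => (x, y)) (fun p => complex.Re (X p))).
    exact: continuous_pairl.
  exact: pcontinuous_Re.
have [-> _] := fubini_box x1 x2 y1 y2 (pcontinuous_Im cX).
apply: eq_Rintegral => x _; rewrite raddfB/=.
apply: (@Rintegral_ftc _ _ (fun y => complex.Im (P (x, y)))) => //.
  by move=> y; have [] := PX x y.
move=> y; apply: (@continuous_comp _ _ _ (fun y => (x, y)) (fun p => complex.Im (X p))).
  exact: continuous_pairl.
exact: pcontinuous_Im.
Qed.

Definition fock_integrand h k (p : R * R) : C :=
  h (complex_of_pair p) * (k (complex_of_pair p))^* * (gauss_weight p)%:C.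

Lemma ReM_real (z : C) (x : R) : complex.Re (z * x%:C) = complex.Re z * x.
Proof. by case: z => a b /=; rewrite mulr0 subr0. Qed.

Lemma ImM_real (z : C) (x : R) : complex.Im (z * x%:C) = complex.Im z * x.
Proof. by case: z => a b /=; rewrite mulr0 add0r. Qed.

Lemma fock_dotE h k : fock_dot h k = (pi^-1)%:C * cint (area R) setT (fock_integrand h k).
Proof.
rewrite mulrC /fock_dot /cint; apply/eqP; rewrite eq_complex/= !mulr0 subr0 add0r !(mulrC pi^-1).
apply/andP; split; apply/eqP; congr (_ * _); apply: eq_Rintegral => p _.
  by rewrite /fock_integrand ReM_real.
by rewrite /fock_integrand ImM_real.
Qed.

(** From [a * b <= a^2 + b^2]. The same majorant serves for integrability over the plane and for the
    choice of the lines that bound the boxes. *)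
Lemma normc_fock_integrand h k p :
  normc (fock_integrand h k p) <= fock_density h p + fock_density k p.
Proof.
rewrite /fock_integrand 2!normcM normc_conj normc_real ger0_norm ?gauss_weight_ge0//.
rewrite /fock_density -mulrDl ler_wpM2r ?gauss_weight_ge0//.
set a := normc _; set b := normc _.
have a0 : 0 <= a by exact: normc_ge0.
have b0 : 0 <= b by exact: normc_ge0.
have := sqr_ge0 (a - b); have := mulr_ge0 a0 b0; nra.
Qed.

Lemma fock_continuous h : fock h -> continuous (h : C^o -> C^o).
Proof. by case=> eh _; exact: entire_continuous. Qed.

Lemma fock_density_integrable h : fock h ->
  (area R).-integrable setT (EFin \o (fock_density h : plane -> R)).
Proof.
move=> fh; have [eh hoo] := fh; apply/integrableP; split.
  apply/measurable_EFinP; apply: continuous_measurable_plane.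
  exact: (continuous_fock_density (fock_continuous fh)).
have [S hS] : exists S : R, (fock_norm2 h <= S%:E)%E.
  exists (fine (fock_norm2 h)); rewrite fineK// ge0_fin_numE//.
  rewrite /fock_norm2 mule_ge0 ?lee_fin ?invr_ge0 ?pi_ge0//.
  by apply: integral_ge0 => p _; rewrite lee_fin mulr_ge0 ?sqr_ge0 ?expR_ge0.
under eq_integral => p _ do rewrite /= ger0_norm ?fock_density_ge0//.
by apply: (le_lt_trans (fock_norm2_le hS)); rewrite ltry.
Qed.

Lemma pcontinuous_fock_integrand h k : continuous (h : C^o -> C^o) -> continuous (k : C^o -> C^o) ->
  pcontinuous (fock_integrand h k).
Proof.
move=> ch ck; apply: pcontinuousM; last by apply: pcontinuous_real; exact: continuous_gauss_weight.
by apply: pcontinuousM; [exact: pcontinuous_comp|apply: pcontinuous_conj; exact: pcontinuous_comp].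
Qed.

Lemma fock_integrable h k : fock h -> fock k -> cintegrable (area R) setT (fock_integrand h k).
Proof.
move=> fh fk.
have c := pcontinuous_fock_integrand (fock_continuous fh) (fock_continuous fk).
have iD := integrableD measurableT (fock_density_integrable fh) (fock_density_integrable fk).
split; apply: le_integrable iD => //.
- by apply/measurable_EFinP; apply: continuous_measurable_plane; exact: pcontinuous_Re.
- move=> p _; rewrite /= lee_fin [leRHS]ger0_norm ?addr_ge0 ?fock_density_ge0//.
  exact: le_trans (ler_Re_normc _) (normc_fock_integrand _ _ _).
- by apply/measurable_EFinP; apply: continuous_measurable_plane; exact: pcontinuous_Im.
- move=> p _; rewrite /= lee_fin [leRHS]ger0_norm ?addr_ge0 ?fock_density_ge0//.
  exact: le_trans (ler_Im_normc _) (normc_fock_integrand _ _ _).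
Qed.

Lemma fock_dotZl h k (c : C) : fock h -> fock k -> fock_dot (fun z => c * h z) k = c * fock_dot h k.
Proof.
move=> fh fk; rewrite !fock_dotE mulrCA -(cintZ c measurableT (fock_integrable fh fk)).
by congr (_ * _); apply: eq_cint => p _; rewrite /fock_integrand !mulrA.
Qed.

Lemma fock_dot0r h : fock_dot h (fun=> 0) = 0.
Proof.
rewrite fock_dotE (_ : fock_integrand h (fun=> 0) = fun=> 0).
  by rewrite /cint/= !Rintegral_cst// !mul0r mulr0.
by apply/funext => p; rewrite /fock_integrand rmorph0 mulr0 mul0r.
Qed.

End FockPairing.

(** * Differentiation and multiplication by [z] as adjoints in the Fock space *)

Section FockAdjoint.
Variable R : realType.
Local Notation C := R[i].
Local Notation mR := (measurableTypeR R).
Local Notation plane := (mR * mR)%type.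
Local Notation mu := (@lebesgue_measure R).
Implicit Types (u v h k : C -> C).

Lemma is_derive_ReIm_gauss_x (x y : R) :
  is_derive_ReIm (fun x => (gauss_weight (x, y))%:C) x (- (2 * x) * gauss_weight (x, y))%:C.
Proof.
apply: is_derive_ReIm_real; rewrite /gauss_weight/=.
have h : is_derive x 1 (fun x => - (x ^+ 2 + y ^+ 2)) (- (2 * x)).
  rewrite (_ : (fun x => _) = - ((id ^+ 2) + cst (y ^+ 2)))//.
  apply: is_derive_eq; rewrite /GRing.scale/=; ring.
have d := @is_derive1_comp _ expR (fun x : R => - (x ^+ 2 + y ^+ 2)) x _ _ (is_derive_expR _) h.
by apply: (is_derive_eq d); rewrite mulrC.
Qed.

Lemma is_derive_ReIm_gauss_y (x y : R) :
  is_derive_ReIm (fun y => (gauss_weight (x, y))%:C) y (- (2 * y) * gauss_weight (x, y))%:C.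
Proof.
rewrite (_ : (fun y => _) = fun y => (gauss_weight (y, x))%:C); last first.
  by apply/funext => t; rewrite /gauss_weight/= addrC.
rewrite (_ : gauss_weight (x, y) = gauss_weight (y, x)); last by rewrite /gauss_weight/= addrC.
exact: is_derive_ReIm_gauss_x.
Qed.

Lemma seg_density_bound P (g : R -> R) (a b S : R) : a <= b -> cont_on P a b -> continuous g ->
  (forall t, normc (P t) <= g t) -> (\int[mu]_t (g t)%:E <= S%:E)%E ->
  normc (seg P a b) <= 2 * S.
Proof.
move=> ab cP cg Pg gS.
have g0 t : 0 <= g t by apply: le_trans (Pg t); exact: normc_ge0.
have := @ler_normc_seg_line _ P g a b 0 1 S ab ler01 cP cg g0 gS.
by rewrite mul0r add0r mul1r; apply => t _; rewrite mul1r add0r.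
Qed.

(* Green's formula on boxes whose sides carry little mass of [u v exp(-|z|^2)], together with
   d_z (u v^* exp(-|z|^2)) = (u' v^* - u (z v)^* ) exp(-|z|^2). *)
Lemma fock_dot_adjoint u u' v v' : fock u -> fock v -> fock u' -> fock (mul_z v) ->
  continuous (v' : C^o -> C^o) ->
  (forall z, wirtinger u z (u' z) 0) -> (forall z, wirtinger v z (v' z) 0) ->
  fock_dot u' v = fock_dot u (mul_z v).
Proof.
move=> fu fv fu' fzv cv' du dv.
have cu := fock_continuous fu; have cv := fock_continuous fv; have cu' := fock_continuous fu'.
pose cp := @complex_of_pair R.
pose w (p : R * R) : C := (gauss_weight p)%:C.
have cw : pcontinuous w by apply: pcontinuous_real; exact: continuous_gauss_weight.
pose P (p : R * R) := fock_integrand u v p.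
have cP : pcontinuous P by exact: pcontinuous_fock_integrand.
pose A p := u' (cp p) * (v (cp p))^*.
pose B p := u (cp p) * (v' (cp p))^*.
have cA : pcontinuous A by apply: pcontinuousM; [exact: pcontinuous_comp|apply: pcontinuous_conj; exact: pcontinuous_comp].
have cB : pcontinuous B by apply: pcontinuousM; [exact: pcontinuous_comp|apply: pcontinuous_conj; exact: pcontinuous_comp].
have cAB : pcontinuous (fun p => u (cp p) * (v (cp p))^*).
  by apply: pcontinuousM; [exact: pcontinuous_comp|apply: pcontinuous_conj; exact: pcontinuous_comp].
have cfst : pcontinuous (fun p : R * R => (- (2 * p.1) * gauss_weight p)%:C).
  apply: (@pcontinuous_real R (fun p => - (2 * p.1) * gauss_weight p)) => p.
  apply: (@continuousM R _ (fun p : R * R => - (2 * p.1))); last exact: continuous_gauss_weight.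
  apply: (@continuousN R _ _ (fun p : R * R => 2 * p.1)).
  by apply: (@continuousM R _ (fun p : R * R => 2)); [exact: cvg_cst|exact: cvg_fst].
have csnd : pcontinuous (fun p : R * R => (- (2 * p.2) * gauss_weight p)%:C).
  apply: (@pcontinuous_real R (fun p => - (2 * p.2) * gauss_weight p)) => p.
  apply: (@continuousM R _ (fun p : R * R => - (2 * p.2))); last exact: continuous_gauss_weight.
  apply: (@continuousN R _ _ (fun p : R * R => 2 * p.2)).
  by apply: (@continuousM R _ (fun p : R * R => 2)); [exact: cvg_cst|exact: cvg_snd].
(* [X] and [Y] are the partial derivatives of [P] in [x] and [y]. In [Y] the term of [v] carries
   [- 'i] because conjugation acts on the factor ['i] of its [y]-derivative. *)
pose X (p : R * R) := (A p + B p) * w p + u (cp p) * (v (cp p))^* * (- (2 * p.1) * gauss_weight p)%:C.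
pose Y (p : R * R) := ('i * A p + (- 'i) * B p) * w p + u (cp p) * (v (cp p))^* * (- (2 * p.2) * gauss_weight p)%:C.
have cX : pcontinuous X.
  exact: (pcontinuousD (pcontinuousM (pcontinuousD cA cB) cw) (pcontinuousM cAB cfst)).
have cY : pcontinuous Y.
  exact: (pcontinuousD (pcontinuousM (pcontinuousD (pcontinuousM (@pcontinuous_cst R 'i%R) cA) (pcontinuousM (@pcontinuous_cst R (- 'i)%R) cB)) cw)
                 (pcontinuousM cAB csnd)).
have PX x y : is_derive_ReIm (fun x => P (x, y)) x (X (x, y)).
  have h1 := wirtinger_derive_x (du (x +i* y)); have h2 := wirtinger_derive_x (dv (x +i* y)).
  have := is_derive_ReImM (is_derive_ReImM h1 (is_derive_ReIm_conj h2)) (is_derive_ReIm_gauss_x x y).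
  by rewrite !addr0.
have PY x y : is_derive_ReIm (fun y => P (x, y)) y (Y (x, y)).
  have h1 := wirtinger_derive_y (du (x +i* y)); have h2 := wirtinger_derive_y (dv (x +i* y)).
  have := is_derive_ReImM (is_derive_ReImM h1 (is_derive_ReIm_conj h2)) (is_derive_ReIm_gauss_y x y).
  rewrite !subr0 /Y /A /B /w /cp /complex_of_pair/=.
  have e : u (x +i* y) * ('i * v' (x +i* y))^* = - 'i * (u (x +i* y) * (v' (x +i* y))^*).
    rewrite !conjE; move: (v' _) (u _) => [a b] [c d].
    by apply/eqP; rewrite eq_complex/=; apply/andP; split; apply/eqP; ring.
  by rewrite e -['i * _ * _]mulrA.
pose H p := fock_integrand u' v p - fock_integrand u (mul_z v) p.
(* Twice the Wirtinger derivative of [P]: the terms [B] cancel, and the derivatives of the weight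
   combine into [-2] times the conjugate of [z]. *)
have HE p : H p + H p = X p - 'i * Y p.
  case: p => x y; rewrite /H /X /Y /A /B /w /fock_integrand /mul_z /cp /complex_of_pair/= !conjE.
  move: (u' _) (v _) (u _) (v' _) (gauss_weight _) => [a1 a2] [b1 b2] [c1 c2] [d1 d2] e.
  by apply/eqP; rewrite eq_complex/=; apply/andP; split; apply/eqP; ring.
have iH : cintegrable (area R) setT H.
  by apply: cintegrableB => //; exact: fock_integrable.
have cH : pcontinuous H.
  rewrite /pcontinuous (_ : (fun p => H p) = fun p => fock_integrand u' v p + (-1) * fock_integrand u (mul_z v) p).
    exact: (pcontinuousD (pcontinuous_fock_integrand cu' cv)
                   (pcontinuousM (@pcontinuous_cst R (-1)) (pcontinuous_fock_integrand cu (fock_continuous fzv)))).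
  by apply/funext => p; rewrite mulN1r.
pose G p := fock_density u p + fock_density v p.
have cG : continuous G by move=> p; apply: cvgD; exact: continuous_fock_density.
have G0 p : 0 <= G p by rewrite addr_ge0 ?fock_density_ge0.
have iG : (area R).-integrable setT (EFin \o (G : plane -> R)).
  exact: (integrableD measurableT (fock_density_integrable fu) (fock_density_integrable fv)).
have [S S0 GS] : exists2 S : R, 0 < S & (\int[area R]_p (G p)%:E <= S%:E)%E.
  have Gf : (\int[area R]_p (G p)%:E)%E \is a fin_num by exact: integrable_fin_num iG.
  exists (fine (\int[area R]_p (G p)%:E)%E + 1).
    rewrite ltr_wpDl// fine_ge0//; apply: integral_ge0 => p _; by rewrite lee_fin.
  by rewrite EFinD fineK// leeDl// lee_fin.
(* Each line is sought at a distance between [N] and [2 * N] from its axis, an interval of length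
   [N]: the boxes exhaust the plane while the mass on each side is at most [2 * S / N]. *)
have lines n : exists q : R * R * (R * R),
    [/\ q.1.1 < - n.+1%:R /\ n.+1%:R < q.1.2, q.2.1 < - n.+1%:R /\ n.+1%:R < q.2.2,
      (\int[mu]_y (G (q.1.1, y))%:E <= (2 * S / n.+1%:R)%:E)%E /\
      (\int[mu]_y (G (q.1.2, y))%:E <= (2 * S / n.+1%:R)%:E)%E &
      (\int[mu]_x (G (x, q.2.1))%:E <= (2 * S / n.+1%:R)%:E)%E /\
      (\int[mu]_x (G (x, q.2.2))%:E <= (2 * S / n.+1%:R)%:E)%E].
  set N : R := n.+1%:R; have N0 : 0 < N by rewrite ltr0n.
  have L1 : N < 2 * N by rewrite ltr_pMl// ltr1n.
  have L2 : - (2 * N) < - N by rewrite ltrN2.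
  have e1 : 2 * N - N = N by ring.
  have e2 : - N - (- (2 * N)) = N by ring.
  have [x2 /andP[x2a _]] := good_vline L1 S0 cG G0 GS.
  have [x1 /andP[_ x1b]] := good_vline L2 S0 cG G0 GS.
  have [y2 /andP[y2a _]] := good_hline L1 S0 cG G0 GS.
  have [y1 /andP[_ y1b]] := good_hline L2 S0 cG G0 GS.
  rewrite e1 e2 => Iy1 Iy2 Ix1 Ix2; exists (x1, x2, (y1, y2)); split.
  - exact: (conj x1b x2a).
  - exact: (conj y1b y2a).
  - exact: (conj Ix1 Ix2).
  - exact: (conj Iy1 Iy2).
have [q qP] := choice lines.
pose Q n := box (q n).1.1 (q n).1.2 (q n).2.1 (q n).2.2.
have PG p : normc (P p) <= G p by exact: normc_fock_integrand.
have cGl (x : R) : continuous (fun y => G (x, y)).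
  by move=> y; apply: (@continuous_comp _ _ _ (fun y => (x, y)) G); [exact: continuous_pairl|exact: cG].
have cGr (y : R) : continuous (fun x => G (x, y)).
  by move=> x; apply: (@continuous_comp _ _ _ (fun x => (x, y)) G); [exact: continuous_pairr|exact: cG].
have cPl (x a b : R) : cont_on (fun y => P (x, y)) a b.
  by move=> y _; apply: (@continuous_comp _ _ _ (fun y => (x, y)) (P : R * R -> C^o)); [exact: continuous_pairl|exact: cP].
have cPr (y a b : R) : cont_on (fun x => P (x, y)) a b.
  by move=> x _; apply: (@continuous_comp _ _ _ (fun x => (x, y)) (P : R * R -> C^o)); [exact: continuous_pairr|exact: cP].
(* The four sides contribute at most [4 * S / N] each, and their sum bounds twice the integral of
   [H]. *)
have QH n : normc (cint (area R) (Q n) H) <= (8 * S) / n.+1%:R.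
  have [[x1n x2n] [y1n y2n] [Ix1 Ix2] [Iy1 Iy2]] := qP n.
  rewrite /Q; move: (q n).1.1 (q n).1.2 (q n).2.1 (q n).2.2 x1n x2n y1n y2n Ix1 Ix2 Iy1 Iy2.
  move=> x1 x2 y1 y2 x1n x2n y1n y2n Ix1 Ix2 Iy1 Iy2.
  set N : R := n.+1%:R in x1n x2n y1n y2n Ix1 Ix2 Iy1 Iy2 *; have N0 : 0 < N by rewrite ltr0n.
  have x12 : x1 < x2 by rewrite (lt_trans x1n)// (lt_trans _ x2n)// gtrN.
  have y12 : y1 < y2 by rewrite (lt_trans y1n)// (lt_trans _ y2n)// gtrN.
  have mQ := measurable_box x1 x2 y1 y2.
  have bX := etrans (cint_box_x y1 y2 x12 cX PX) (segB (cPl x2 y1 y2) (cPl x1 y1 y2)).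
  have bY := etrans (cint_box_y x1 x2 y12 cY PY) (segB (cPr y2 x1 x2) (cPr y1 x1 x2)).
  have v1 := seg_density_bound (ltW y12) (cPl x1 y1 y2) (cGl x1) (fun y => PG (x1, y)) Ix1.
  have v2 := seg_density_bound (ltW y12) (cPl x2 y1 y2) (cGl x2) (fun y => PG (x2, y)) Ix2.
  have h1 := seg_density_bound (ltW x12) (cPr y1 x1 x2) (cGr y1) (fun x => PG (x, y1)) Iy1.
  have h2 := seg_density_bound (ltW x12) (cPr y2 x1 x2) (cGr y2) (fun x => PG (x, y2)) Iy2.
  have iHb := cintegrable_box x1 x2 y1 y2 cH.
  have iXb := cintegrable_box x1 x2 y1 y2 cX.
  have iYb := cintegrable_box x1 x2 y1 y2 cY.
  have eq2 : cint (area R) (box x1 x2 y1 y2) H + cint (area R) (box x1 x2 y1 y2) H =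
      cint (area R) (box x1 x2 y1 y2) X - 'i * cint (area R) (box x1 x2 y1 y2) Y.
    rewrite -cintD// -cintZ// -cintB//; last exact: cintegrableZ.
    apply: eq_cint => p _; exact: HE.
  rewrite bX bY in eq2; move: eq2 v1 v2 h1 h2.
  move: (seg (fun y => P (x1, y)) y1 y2) (seg (fun y => P (x2, y)) y1 y2)
    (seg (fun x => P (x, y1)) x1 x2) (seg (fun x => P (x, y2)) x1 x2) => s1 s2 s3 s4.
  move: (cint _ _ _) => c; move=> eq2 v1 v2 h1 h2.
  have c2 : normc (c + c) = 2 * normc c by rewrite -mulr2n normcMn mulr2n; ring.
  have n1 := le_normcD (s2 - s1) (- ('i * (s4 - s3))).
  have n2 := le_normcD s4 (- s3); have n3 := le_normcD s2 (- s1).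
  rewrite -eq2 c2 in n1.
  rewrite !normcN normcM normc_i mul1r in n1 n2 n3.
  rewrite (_ : 8 * S / N = 4 * (2 * S / N)); last by ring.
  move: (2 * S / N) v1 v2 h1 h2 => E v1 v2 h1 h2; lra.
have H0 : cint (area R) setT H = 0.
  apply: (cint_exhaust (Q := Q) iH _ _ QH); first by move=> n; exact: measurable_box.
  move=> [x y]; have := nbhs_infty_ger (`|x| + `|y|); apply: filterS => n.
  have [[x1n x2n] [y1n y2n] _ _] := qP n.
  rewrite /Q /box/= !in_itv/=.
  move: (q n).1.1 (q n).1.2 (q n).2.1 (q n).2.2 x1n x2n y1n y2n => x1 x2 y1 y2.
  have x0 := normr_ge0 x; have y0 := normr_ge0 y.
  have xn := ler_norm x; have yn := ler_norm y.
  have := ler_norm (- x); have := ler_norm (- y); rewrite !normrN => yn' xn'.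
  rewrite -natr1; move: (n%:R) xn yn xn' yn' x0 y0 => N; move: `|x| `|y| => a b.
  by move=> *; split; apply/andP; split; lra.
rewrite !fock_dotE; congr (_ * _); apply/eqP; rewrite -subr_eq0 -H0; apply/eqP.
by rewrite /H cintB//; exact: fock_integrable.
Qed.

End FockAdjoint.

(** * The components of elements of SF(C) *)

Section Coefficients.
Variable R : realType.
Local Notation C := R[i].
Implicit Types (a b : nat -> nat -> C) (f g h : C -> C).

Lemma sfock_coefP f : sfock f -> sfock_expansion f (sfock_coef f).
Proof. by case=> c fc; exact: (xgetPex _ (ex_intro _ c fc : exists x, [set c | sfock_expansion f c] x)). Qed.

Definition sfock_taylor f n m : C := taylor (sfock_coef f n) m.

Lemma rapid_decay_sfock_taylor f : sfock f -> rapid_decay (sfock_taylor f).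
Proof. by move=> /sfock_coefP; exact: sfock_taylor_growth. Qed.

Lemma expands_sfock_taylor f : sfock f -> expands (sfock_taylor f) f.
Proof. by move=> /sfock_coefP; exact: sfock_expands. Qed.

Lemma sfock_coef_fock f n : sfock f -> fock (sfock_coef f n).
Proof. by move=> /sfock_coefP[]. Qed.

Lemma sfock_coef_series f n z : sfock f ->
  series (fun m => sfock_taylor f n m * z ^+ m : C^o) @ \oo --> (sfock_coef f n z : C^o).
Proof. by move=> sf; apply: taylor_series; have [] := sfock_coef_fock n sf. Qed.

Lemma series_mulc (u : nat -> C) (c l : C) : series (fun k => u k : C^o) @ \oo --> (l : C^o) ->
  series (fun k => c * u k : C^o) @ \oo --> (c * l : C^o).
Proof.
move=> ul; rewrite (_ : series _ = fun n => c * series (fun k => u k : C^o) n).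
  by apply: cvgM; [exact: cvg_cst|exact: ul].
by apply/funext => n; rewrite /series/= mulr_sumr.
Qed.

Lemma series_cvg0 (u : nat -> C) : (forall k, u k = 0) ->
  series (fun k => u k : C^o) @ \oo --> (0 : C^o).
Proof.
move=> u0; rewrite (_ : series _ = fun=> 0); first exact: cvg_cst.
by apply/funext => N; rewrite /series/= big1.
Qed.

Lemma eq_series_cvg (u v : nat -> C) (l : C) : (forall k, u k = v k) ->
  series (fun k => v k : C^o) @ \oo --> (l : C^o) -> series (fun k => u k : C^o) @ \oo --> (l : C^o).
Proof. by move=> /funext ->. Qed.

(** The way components are read off: any rapidly decaying double series for [f], wherever it comes
    from, has the components of [f] as its rows, since the coefficients are unique. *)
Lemma sfock_coef_expands f b n z : sfock f -> rapid_decay b -> expands b f ->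
  series (fun m => b n m * z ^+ m : C^o) @ \oo --> (sfock_coef f n z : C^o).
Proof.
move=> sf gb bf; have ab := expands_unique (rapid_decay_sfock_taylor sf) gb (expands_sfock_taylor sf) bf.
have e m : b n m * z ^+ m = sfock_taylor f n m * z ^+ m by rewrite ab.
exact: (eq_series_cvg e (sfock_coef_series (n := n) (z := z) sf)).
Qed.

Definition mz_coef a n m : C := if m is m'.+1 then a n m' else 0.
Definition mzb_coef a n m : C := if n is n'.+1 then a n' m else 0.

Lemma rapid_decay_mz a : rapid_decay a -> rapid_decay (mz_coef a).
Proof.
move=> ga T T0; have [K K0 aK] := ga T T0; have T1 : T != 0 by rewrite gt_eqF.
exists (K * T); first by rewrite mulr_ge0// ltW.
move=> n [|m]; first by rewrite /mz_coef normc0 divr_ge0 ?mulr_ge0 ?exprn_ge0// ltW.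
rewrite /mz_coef addnS exprS (_ : K * T / _ = K / T ^+ (n + m)); first exact: aK.
by field; rewrite T1 expf_neq0.
Qed.

Lemma rapid_decay_mzb a : rapid_decay a -> rapid_decay (mzb_coef a).
Proof.
move=> ga T T0; have [K K0 aK] := ga T T0; have T1 : T != 0 by rewrite gt_eqF.
exists (K * T); first by rewrite mulr_ge0// ltW.
move=> [|n] m; first by rewrite /mzb_coef normc0 divr_ge0 ?mulr_ge0 ?exprn_ge0// ltW.
rewrite /mzb_coef addSn exprS (_ : K * T / _ = K / T ^+ (n + m)); first exact: aK.
by field; rewrite T1 expf_neq0.
Qed.

Lemma diag_mz a k z : diag (mz_coef a) k.+1 z = z * diag a k z.
Proof.
rewrite /diag big_ord_recr/= subnn mul0r addr0 mulr_sumr; apply: eq_bigr => i _.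
have ik : (i <= k)%N by rewrite -ltnS.
rewrite (subSn ik) /= exprS.
by rewrite [z * (a _ _ * _)]mulrCA [z^* ^+ i * (z * _)]mulrCA.
Qed.

Lemma diag_mzb a k z : diag (mzb_coef a) k.+1 z = z^* * diag a k z.
Proof.
rewrite /diag big_ord_recl/= mul0r add0r mulr_sumr; apply: eq_bigr => i _.
rewrite -[bump 0 i]/(i.+1) subSS /= exprS -mulrA.
by rewrite [z^* * (a _ _ * _)]mulrCA.
Qed.

Lemma expands_mz a f : expands a f -> expands (mz_coef a) (mul_z f).
Proof.
move=> af z.
have h0 : diag (mz_coef a) 0 z = 0 by rewrite /diag big_ord_recl big_ord0 mul0r addr0.
exact: (series_shift h0 (fun k => diag_mz a k z) (series_mulc (c := z) (af z))).
Qed.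

Lemma expands_mzb a f : expands a f -> expands (mzb_coef a) (mul_zbar f).
Proof.
move=> af z.
have h0 : diag (mzb_coef a) 0 z = 0 by rewrite /diag big_ord_recl big_ord0 mul0r addr0.
exact: (series_shift h0 (fun k => diag_mzb a k z) (series_mulc (c := z^*%R) (af z))).
Qed.

Lemma sfock_coef_mul_z g n : sfock g -> sfock (mul_z g) ->
  sfock_coef (mul_z g) n = mul_z (sfock_coef g n).
Proof.
move=> sg szg; apply/funext => z.
apply: (cvgc_unique (sfock_coef_expands (n := n) (z := z) szg (rapid_decay_mz (rapid_decay_sfock_taylor sg))
  (expands_mz (expands_sfock_taylor sg)))).
have h0 : mz_coef (sfock_taylor g) n 0 * z ^+ 0 = 0 by rewrite mul0r.
have hS k : mz_coef (sfock_taylor g) n k.+1 * z ^+ k.+1 = z * (sfock_taylor g n k * z ^+ k).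
  by rewrite /mz_coef exprS mulrCA.
exact: (@series_shift R (fun k => mz_coef (sfock_taylor g) n k * z ^+ k) _ _ h0 hS
  (series_mulc (c := z) (sfock_coef_series (n := n) (z := z) sg))).
Qed.

Lemma sfock_coef_mul_zbar0 g : sfock g -> sfock (mul_zbar g) ->
  sfock_coef (mul_zbar g) 0 = fun=> 0.
Proof.
move=> sg szg; apply/funext => z.
apply: (cvgc_unique (sfock_coef_expands (n := 0%N) (z := z) szg (rapid_decay_mzb (rapid_decay_sfock_taylor sg))
  (expands_mzb (expands_sfock_taylor sg)))).
by apply: series_cvg0 => k; rewrite mul0r.
Qed.

Lemma sfock_coef_mul_zbarS g n : sfock g -> sfock (mul_zbar g) ->
  sfock_coef (mul_zbar g) n.+1 = sfock_coef g n.
Proof.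
move=> sg szg; apply/funext => z.
apply: (cvgc_unique (sfock_coef_expands (n := n.+1) (z := z) szg (rapid_decay_mzb (rapid_decay_sfock_taylor sg))
  (expands_mzb (expands_sfock_taylor sg)))).
exact: sfock_coef_series.
Qed.

Lemma sfock_coef_d_zbar f n : sfock f -> sfock (d_zbar f) ->
  sfock_coef (d_zbar f) n = fun z => n.+1%:R * sfock_coef f n.+1 z.
Proof.
move=> sf sdf; apply/funext => z.
apply: (cvgc_unique (sfock_coef_expands (n := n) (z := z) sdf (rapid_decay_dzb (rapid_decay_sfock_taylor sf))
  (expands_dzb (rapid_decay_sfock_taylor sf) (expands_sfock_taylor sf)))).
have e m : dzb_coef (sfock_taylor f) n m * z ^+ m = n.+1%:R * (sfock_taylor f n.+1 m * z ^+ m).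
  by rewrite /dzb_coef mulrA.
exact: (eq_series_cvg e (series_mulc (c := n.+1%:R) (sfock_coef_series (n := n.+1) (z := z) sf))).
Qed.

Lemma dz_slice a n : dz_coef (slice a n) = slice (dz_coef a) n.
Proof. by apply/funext => -[|k]; apply/funext => m; rewrite /dz_coef /slice//= mulr0. Qed.

(** Applied to a slice, [expands_wirtinger] gives a vanishing conjugate derivative, as every row of
    a slice after row 0 is zero. The remaining derivative [A] comes with its power series, against
    which row [n] of [d_z f] is matched. *)
Lemma slice_wirtinger a n h z : rapid_decay a ->
  (forall z, series (fun m => a n m * z ^+ m : C^o) @ \oo --> (h z : C^o)) ->
  exists2 A, series (fun m => dz_coef a n m * z ^+ m : C^o) @ \oo --> (A : C^o) & wirtinger h z A 0.
Proof.
move=> ga ah.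
have [A [B [cA cB AB]]] := expands_wirtinger z (rapid_decay_slice n ga) (expands_slice ah).
have B0 : B = 0.
  apply: (cvgc_unique cB); apply: series_cvg0 => k.
  by rewrite /diag big1// => i _; rewrite /dzb_coef /slice/= mulr0 mul0r.
exists A; last by rewrite -B0.
rewrite dz_slice in cA.
have e k : dz_coef a n k * z ^+ k = diag (slice (dz_coef a) n) k z by rewrite diag_slice.
exact: (eq_series_cvg e cA).
Qed.

Lemma slice_continuous a n h : rapid_decay a ->
  (forall z, series (fun m => a n m * z ^+ m : C^o) @ \oo --> (h z : C^o)) ->
  continuous (h : C^o -> C^o).
Proof. by move=> ga ah z; have [A _ /wirtinger_continuous] := slice_wirtinger z ga ah. Qed.

Lemma sfock_coef_wirtinger f n z : sfock f -> wirtinger (sfock_coef f n) z (d_z (sfock_coef f n) z) 0.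
Proof.
move=> sf; have [A _ hA] := slice_wirtinger z (rapid_decay_sfock_taylor sf) (fun z => sfock_coef_series (n := n) (z := z) sf).
by rewrite (wirtinger_d_z hA).
Qed.

Lemma d_z_sfock_coef_series f n z : sfock f ->
  series (fun m => dz_coef (sfock_taylor f) n m * z ^+ m : C^o) @ \oo --> (d_z (sfock_coef f n) z : C^o).
Proof.
move=> sf; have [A cA hA] := slice_wirtinger z (rapid_decay_sfock_taylor sf) (fun z => sfock_coef_series (n := n) (z := z) sf).
by rewrite (wirtinger_d_z hA).
Qed.

Lemma d_z_sfock_coef_continuous f n : sfock f -> continuous (d_z (sfock_coef f n) : C^o -> C^o).
Proof.
move=> sf; apply: (slice_continuous (rapid_decay_dz (rapid_decay_sfock_taylor sf))).
by move=> z; exact: d_z_sfock_coef_series.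
Qed.

Lemma sfock_coef_d_z f n : sfock f -> sfock (d_z f) ->
  sfock_coef (d_z f) n = d_z (sfock_coef f n).
Proof.
move=> sf sdf; apply/funext => z.
apply: (cvgc_unique (sfock_coef_expands (n := n) (z := z) sdf (rapid_decay_dz (rapid_decay_sfock_taylor sf))
  (expands_dz (rapid_decay_sfock_taylor sf) (expands_sfock_taylor sf)))).
exact: d_z_sfock_coef_series.
Qed.

(** Convergence is not assumed: [lim] is a choice among the limits of a sequence, and a sequence and
    its shift have the same limits, so both sides choose from one predicate. *)
Lemma lim_series_shift (u v : nat -> C) : u 0%N = 0 -> (forall k, u k.+1 = v k) ->
  lim (series (fun k => u k : C^o) @ \oo) = lim (series (fun k => v k : C^o) @ \oo).
Proof.
move=> u0 uv.
have -> : series (fun k => v k : C^o) = [sequence series (fun k => u k : C^o) n.+1]_n.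
  apply/funext => n; rewrite /series/= big_nat_recl// u0 add0r.
  by apply: eq_bigr => k _.
rewrite /lim /lim_in; congr (get _); apply/funext => l.
exact: (esym (cvg_shiftS (series (fun k => u k : C^o)) (nbhs l))).
Qed.

Lemma eq_sfock_dot f g f' g' :
  (forall n, fock_dot (sfock_coef f n) (sfock_coef g n) = fock_dot (sfock_coef f' n) (sfock_coef g' n)) ->
  sfock_dot f g = sfock_dot f' g'.
Proof.
move=> e.
have E : (fun n => n`!%:R * fock_dot (sfock_coef f n) (sfock_coef g n) : C^o) =
    (fun n => n`!%:R * fock_dot (sfock_coef f' n) (sfock_coef g' n) : C^o).
  by apply/funext => n; exact: (congr1 (fun x : C => n`!%:R * x) (e n)).
exact: (congr1 (fun u : nat -> C^o => lim (series u @ \oo)) E).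
Qed.

End Coefficients.

Theorem theorem2p16 (R : realType) :
  (forall f g : R[i] -> R[i],
     sfock f -> sfock g -> sfock (d_z f) -> sfock (mul_z g) ->
     sfock_dot (d_z f) g = sfock_dot f (mul_z g))
  /\
  (forall f g : R[i] -> R[i],
     sfock f -> sfock g -> sfock (d_zbar f) -> sfock (mul_zbar g) ->
     sfock_dot (d_zbar f) g = sfock_dot f (mul_zbar g)).
Proof.
split=> f g sf sg sdf smg.
  have e n : fock_dot (sfock_coef (d_z f) n) (sfock_coef g n) =
      fock_dot (sfock_coef f n) (sfock_coef (mul_z g) n).
    (* Here the assumptions on [d_z f] and [mul_z g] enter: the derivative of each component of [f],
       and [z] times each component of [g], lie in the Fock space, so both integrands are
       integrable. *)
    have fdf := sfock_coef_fock n sdf; have fzg := sfock_coef_fock n smg.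
    rewrite (sfock_coef_d_z n sf sdf) in fdf *.
    rewrite (sfock_coef_mul_z n sg smg) in fzg *.
    exact: (fock_dot_adjoint (sfock_coef_fock n sf) (sfock_coef_fock n sg) fdf fzg
      (d_z_sfock_coef_continuous (n := n) sg) (fun z => sfock_coef_wirtinger n z sf)
      (fun z => sfock_coef_wirtinger n z sg)).
  exact: eq_sfock_dot e.
(* Multiplication by the conjugate variable leaves no component of order 0, so the series on the
   right starts one index later. *)
have e0 : 0`!%:R * fock_dot (sfock_coef f 0) (sfock_coef (mul_zbar g) 0) = 0.
  by rewrite (sfock_coef_mul_zbar0 sg smg) fock_dot0r mulr0.
(* The factor [n + 1] produced by [d_zbar] turns the weight [n!] into [(n + 1)!]. *)
have eS n : n.+1`!%:R * fock_dot (sfock_coef f n.+1) (sfock_coef (mul_zbar g) n.+1) =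
    n`!%:R * fock_dot (sfock_coef (d_zbar f) n) (sfock_coef g n).
  rewrite (sfock_coef_mul_zbarS n sg smg) (sfock_coef_d_zbar n sf sdf).
  rewrite (fock_dotZl _ (sfock_coef_fock n.+1 sf) (sfock_coef_fock n sg)).
  by rewrite factS natrM mulrCA mulrA.
exact: (esym (@lim_series_shift R
  (fun n => n`!%:R * fock_dot (sfock_coef f n) (sfock_coef (mul_zbar g) n)) _ e0 eS)).
Qed.
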